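(* Let $\Omega, I \subset \mathbb{R}$ be open intervals containing $0$ and let $f : \Omega \times I \to \mathbb{R}$, $$f(x;\mu) = \begin{cases} f_L(x;\mu), & x \le 0, \\ f_R(x;\mu), & x \ge 0, \end{cases}$$ be piecewise-$C^3$ with $f_L(0;\mu) = f_R(0;\mu)$ for all $\mu \in I$ and $f_L(0;0) = f_R(0;0) = 0$. Let $a_L = \frac{\partial f_L}{\partial x}(0;0)$, $a_R = \frac{\partial f_R}{\partial x}(0;0)$ and $\beta = \frac{\partial f_L}{\partial \mu}(0;0) = \frac{\partial f_R}{\partial \mu}(0;0)$. Suppose $\beta > 0$, $a_L > 1$, and $0 < |a_R| < 1$. Let $\nu(\mu) = f(0;\mu)$, and for $\nu, s_L, s_R, t \in \mathbb{R}$ let $$g(y;\nu,s_L,s_R,t) = \begin{cases} \nu + s_L y + t y^2, & y \le 0, \\ \nu + s_R y, & y \ge 0. \end{cases}$$ Then there exist $\mu_0 > 0$, continuous functions $s_L(\mu) = a_L + O(\mu)$, $s_R(\mu) = a_R + O(\mu)$, and $t(\mu)$, and neighbourhoods $N$ and $M(\mu)$ of $0$, such that for $\tilde{g}(y;\mu) = g(y;\nu(\mu),s_L(\mu),s_R(\mu),t(\mu))$: (i) if $\mu \in (-\mu_0,0]$, then $f$ on $N$ and $\tilde{g}$ on $M(\mu)$ are differentiably conjugate; (ii) if $\mu \in (0,\mu_0)$ and $a_R > 0$, then $f$ on $N$ and $\tilde{g}$ on $M(\mu)$ are differentiably conjugate on the basins of attraction of their stable fixed points and on the basins of repulsion of their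 unstable fixed points; that is, $f$ on $\{x \in N : x > x_L\}$ and $\tilde g$ on $\{y \in M(\mu) : y > y_L\}$ are differentiably conjugate, and $f$ on $\{x \in N : x < x_R\}$ and $\tilde g$ on $\{y \in M(\mu) : y < y_R\}$ are differentiably conjugate; (iii) if $\mu \in (0,\mu_0)$ and $a_R < 0$, then $f$ on $\left( x_L, f_R^{-1}(x_L) \right)$ and $\tilde{g}$ on $\left( y_L, g_R^{-1}(y_L) \right)$ are differentiably conjugate, and $f$ on $\{ x \in N : x < 0 \}$ and $\tilde{g}$ on $\{ y \in M(\mu) : y < 0 \}$ are differentiably conjugate. Moreover, for any $\delta > 0$ we can choose $\mu_0 > 0$, $N = (-p,p)$, and $M(\mu) = (q^-(\mu),q^+(\mu))$ so that $$(1-\delta)\, p < \left| q^\pm(\mu) \right| < (1+\delta)\, p$$ for all $\mu \in (-\mu_0,\mu_0)$.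
   Context: Piecewise-$C^k$: $f_L$ (defined for $x \le 0$) and $f_R$ (defined for $x \ge 0$) are $C^k$ functions of $(x;\mu)$ that can be extended as $C^k$ functions to a neighbourhood of $x=0$, so their derivatives at $x=0$ are well-defined. Conjugacy: let $F : \Omega \to \mathbb{R}$ and $G : \Psi \to \mathbb{R}$ be continuous maps on open intervals, $U \subset \Omega$, $V \subset \Psi$. Then $F$ on $U$ and $G$ on $V$ are topologically conjugate if there is a homeomorphism $h : U \to V$ such that $h(F(x)) = G(h(x))$ for all $x \in U$ for which $F(x) \in U$. If $h$ is also a diffeomorphism ($C^1$ with $C^1$ inverse), then $F$ on $U$ and $G$ on $V$ are differentiably conjugate. (Here, for each fixed $\mu$, $F = f(\cdot\,;\mu)$ and $G = \tilde g(\cdot\,;\mu)$; $N$ does not depend on $\mu$, and neighbourhoods of $0$ are open intervals containing $0$.) Fixed points: under the hypotheses, for all sufficiently small $\mu > 0$ the map $f(\cdot\,;\mu)$ has, locally (near $0$), exactly two fixed points $x_L = x_L(\mu) < 0$ (unstable) and $x_R = x_R(\mu) > 0$ (stable), both tending to $0$ as $\mu \to 0^+$; likewise $\tilde g(\cdot\,;\mu)$ has, locally, exactly two fixed points $y_L = y_L(\mu) < 0$ (unstable) and $y_R = y_R(\mu) > 0$ (stable). It is always assumed that $\mu_0$ is small enough that these belong to $N$ and $M(\mu)$ respectively. In (iii), $f_R^{-1}$ is the local inverse of $f_R(\cdot\,;\mu)$ (which is decreasing near $0$), and $g_R^{-1}$ is the inverse of $g_R(y) = \nu(\mu) + s_R(\mu)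 y$. *)

(* Defs.v *)
From Stdlib Require Export Reals.
From Coquelicot Require Export Coquelicot.
Open Scope R_scope.

Definition open_interval (a b : R) : R -> Prop := fun x => a < x < b.

(* Possibly unbounded. *)
Definition open_interval_around_0 (A : R -> Prop) : Prop :=
  A 0 /\ exists a b : Rbar, forall x, A x <-> Rbar_lt a x /\ Rbar_lt x b.

(* Only used when [l 0 = r 0]. *)
Definition piecewise (l r : R -> R) (x : R) : R :=
  if Rle_dec x 0 then l x else r x.

(* [phi], as a function of [(x, mu)], is C^k on a neighbourhood in the plane
   of every point of [A].  [ex_diff_n] is a pointwise condition, so it is
   required on a whole neighbourhood of each point. *)
Definition Ck_near (k : nat) (phi : R -> R -> R) (A : R -> R -> Prop) : Prop :=
  forall x mu, A x mu -> locally_2d (fun u v => ex_diff_n phi k u v) x mu.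

(* [fL] and [fR] are total functions standing for C^k extensions of the two
   pieces across [x = 0]; the map [piecewise] built from them only uses [fL]
   for [x <= 0] and [fR] for [x >= 0]. *)
Definition piecewise_Ck (k : nat) (Omega J : R -> Prop) (fL fR : R -> R -> R)
    : Prop :=
  Ck_near k fL (fun x mu => Omega x /\ J mu /\ x <= 0) /\
  Ck_near k fR (fun x mu => Omega x /\ J mu /\ 0 <= x).

Definition pw_map (fL fR : R -> R -> R) (x mu : R) : R :=
  piecewise (fun z => fL z mu) (fun z => fR z mu) x.

Definition normal_form (nu sL sR t y : R) : R :=
  piecewise (fun z => nu + sL * z + t * z ^ 2) (fun z => nu + sR * z) y.

(* [s mu = c + O(mu)] as [mu -> 0]. *)
Definition eq_up_to_O_mu (s : R -> R) (c : R) : Prop :=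
  exists K : R, locally 0 (fun mu => Rabs (s mu - c) <= K * Rabs mu).

(* [U] is meant to be open: [Derive] is two-sided. *)
Definition C1_on (U : R -> Prop) (h : R -> R) : Prop :=
  forall x, U x -> ex_derive h x /\ continuous (Derive h) x.

(* The bijection [h : U -> V] and its inverse [k : V -> U] are total functions
   whose values outside [U] and [V] are irrelevant. *)
Definition diff_conjugate (F : R -> R) (U : R -> Prop)
    (G : R -> R) (V : R -> Prop) : Prop :=
  exists h k : R -> R,
    (forall x, U x -> V (h x) /\ k (h x) = x) /\
    (forall y, V y -> U (k y) /\ h (k y) = y) /\
    C1_on U h /\ C1_on V k /\
    (forall x, U x -> U (F x) -> h (F x) = G (h x)).

Definition lyapunov_stable (F : R -> R) (x : R) : Prop :=
  forall eps, 0 < eps -> exists d, 0 < d /\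
    forall y n, Rabs (y - x) < d -> Rabs (Nat.iter n F y - x) < eps.

Definition attracting (F : R -> R) (x : R) : Prop :=
  exists d, 0 < d /\
    forall y, Rabs (y - x) < d -> is_lim_seq (fun n => Nat.iter n F y) x.

Definition asymptotically_stable (F : R -> R) (x : R) : Prop :=
  lyapunov_stable F x /\ attracting F x.

Definition unstable (F : R -> R) (x : R) : Prop := ~ lyapunov_stable F x.

Definition fixed_point_pair (F : R -> R) (N : R -> Prop) (a b : R) : Prop :=
  N a /\ N b /\ a < 0 < b /\
  (forall x, N x -> (F x = x <-> x = a \/ x = b)) /\
  unstable F a /\ asymptotically_stable F b.

(* [f] on [N] and the normal form on [M mu] have the stated conjugacies for all
   [mu] in [(-mu0, mu0)].  In the case [aR < 0], [w] is the preimage of [xL]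
   under the local inverse of [fR], and [v] is the preimage of [yL] under the
   right-hand branch of the normal form. *)
Definition conjugacies (Omega J : R -> Prop) (fL fR : R -> R -> R) (aR : R)
    (sL sR t : R -> R) (mu0 : R) (N : R -> Prop) (M : R -> R -> Prop) : Prop :=
  let f mu x := pw_map fL fR x mu in
  let nu mu := f mu 0 in
  let g mu y := normal_form (nu mu) (sL mu) (sR mu) (t mu) y in
  0 < mu0 /\
  (forall mu, -mu0 < mu < mu0 ->
     J mu /\ continuous sL mu /\ continuous sR mu /\ continuous t mu) /\
  open_interval_around_0 N /\ (forall x, N x -> Omega x) /\
  (forall mu, -mu0 < mu < mu0 -> open_interval_around_0 (M mu)) /\
  (forall mu, -mu0 < mu <= 0 -> diff_conjugate (f mu) N (g mu) (M mu)) /\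
  exists xL xR yL yR : R -> R,
    filterlim xL (at_right 0) (locally 0) /\
    filterlim xR (at_right 0) (locally 0) /\
    filterlim yL (at_right 0) (locally 0) /\
    filterlim yR (at_right 0) (locally 0) /\
    forall mu, 0 < mu < mu0 ->
      fixed_point_pair (f mu) N (xL mu) (xR mu) /\
      fixed_point_pair (g mu) (M mu) (yL mu) (yR mu) /\
      (0 < aR ->
         diff_conjugate (f mu) (fun x => N x /\ xL mu < x)
                        (g mu) (fun y => M mu y /\ yL mu < y) /\
         diff_conjugate (f mu) (fun x => N x /\ x < xR mu)
                        (g mu) (fun y => M mu y /\ y < yR mu)) /\
      (aR < 0 ->
         (exists w v : R,
            unique (fun x => N x /\ 0 <= x /\ fR x mu = xL mu) w /\
            unique (fun y => nu mu + sR mu * y = yL mu) v /\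
            diff_conjugate (f mu) (open_interval (xL mu) w)
                           (g mu) (open_interval (yL mu) v)) /\
         diff_conjugate (f mu) (fun x => N x /\ x < 0)
                        (g mu) (fun y => M mu y /\ y < 0)).

(* Main.v *)
(* For each small mu both maps are replaced near 0 by piecewise maps whose
   branches are diffeomorphisms of the whole line.  A branch that contracts, or
   whose inverse contracts, towards a fixed point is linearised by Koenigs'
   method, so two such branches with equal multipliers are C^1 conjugate, the
   conjugacy can be made to fix 0, and its derivative is close to 1 near 0.

   The normal form is fitted accordingly.  Let xL and xR be the fixed points of
   the extended branches of f; they exist for all small mu, being virtual when
   mu < 0.  Take sR to be the slope of fR at xR, choose sL so that the ratio of
   the one-sided slopes at the kink is that of f, and choose t so that yL has
   the same multiplier lambda_L as xL.  This gives
     yL = nu / (1 - (sL + lambda_L) / 2),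
     t = (lambda_L - sL) (1 - (sL + lambda_L) / 2) / (2 nu),
   and t extends continuously to mu = 0 because lambda_L - sL and nu are
   differentiable at 0, where they vanish.

   A conjugacy of one pair of branches is then carried across the kink by the
   dynamics, fundamental domain by fundamental domain; equality of the slope
   ratios is what makes the result C^1 at the kink and at its preimages. *)

From Stdlib Require Import Lra Lia Psatz ClassicalEpsilon.
Require Import Defs.

(** * C^1 maps and diffeomorphisms of the line *)

(** The obstacle is uniformity in [mu]. As [mu] tends to 0 the fixed points merge with the kink, yet
    the conjugacies of the branches must keep slopes close to 1 on a fixed interval, since the ends
    of [M mu] are images of the ends of [N]. A Koenigs linearisation is unique only up to a factor,
    and that factor is spent on fixing 0. Its logarithm is small because [xL] and [yL], and likewise
    [xR] and [yR], have the same derivative at [mu = 0], so that their ratio tends to 1. The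
    remaining variation of the slope obeys a Lipschitz bound whose constant is independent of [mu].

    The slope condition at the kink comes from differentiating a conjugacy [h] of the piecewise maps
    at 0 from either side: [h'(0)] and [h'(nu)] are related through both pairs of branches, which
    forces the two ratios of one-sided slopes to agree. Extending the branches to the whole line
    keeps orbits from leaving the domain during pull-backs of unbounded length; the maps are cut
    back to [N] and [M mu] only after the conjugacies are complete. *)

Definition C1_at (h : R -> R) (x : R) : Prop :=
  locally x (fun u => ex_derive h u) /\ continuous (Derive h) x.

Lemma C1_at_is_derive (h : R -> R) (x : R) : C1_at h x -> is_derive h x (Derive h x).
Proof. intros [H _]. apply Derive_correct. exact (locally_singleton _ _ H). Qed.

Lemma C1_at_continuous (h : R -> R) (x : R) : C1_at h x -> continuous h x.
Proof.
  intros [H _]. apply (ex_derive_continuous (V := R_NormedModule)).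
  exact (locally_singleton _ _ H).
Qed.

Lemma C1_at_ext_loc (h g : R -> R) (x : R) :
  locally x (fun u => h u = g u) -> C1_at h x -> C1_at g x.
Proof.
  intros He [Hd Hc]. pose proof (locally_locally _ _ He) as He2. split.
  - generalize (filter_and _ _ He2 Hd). apply filter_imp. intros u [E D].
    exact (ex_derive_ext_loc _ _ _ E D).
  - apply (continuous_ext_loc _ (Derive h)); [|exact Hc].
    revert He2. apply filter_imp. intros u E. apply Derive_ext_loc. exact E.
Qed.

Lemma C1_at_of_is_derive (h dh : R -> R) (x : R) :
  locally x (fun u => is_derive h u (dh u)) -> continuous dh x -> C1_at h x.
Proof.
  intros Hd Hc. split.
  - revert Hd. apply filter_imp. intros u D. exists (dh u). exact D.
  - apply (continuous_ext_loc _ dh); [|exact Hc].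
    revert Hd. apply filter_imp. intros u D. symmetry. apply is_derive_unique. exact D.
Qed.

Lemma C1_at_of_is_derive_all (h dh : R -> R) (x : R) :
  (forall u, is_derive h u (dh u)) -> continuous dh x -> C1_at h x.
Proof.
  intros Hd. apply C1_at_of_is_derive. apply filter_forall. exact Hd.
Qed.

Lemma C1_at_comp (g h : R -> R) (x : R) :
  C1_at h x -> C1_at g (h x) -> C1_at (fun u => g (h u)) x.
Proof.
  intros Hh Hg.
  pose proof (C1_at_continuous _ _ Hh) as Hc.
  destruct Hg as [Hg1 Hg2]. destruct Hh as [Hh1 Hh2].
  apply (C1_at_of_is_derive _ (fun u => Derive h u * Derive g (h u))).
  - generalize (filter_and _ _ Hh1 (Hc _ Hg1)). apply filter_imp. intros u [A B].
    apply (is_derive_comp (V := R_NormedModule) g h u (Derive g (h u)) (Derive h u));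
      apply Derive_correct; assumption.
  - apply (continuous_mult (K := R_AbsRing)); [exact Hh2|].
    apply (continuous_comp h (Derive g)); assumption.
Qed.

Lemma C1_at_id (x : R) : C1_at (fun u => u) x.
Proof.
  apply (C1_at_of_is_derive_all _ (fun _ => 1)).
  - intros u. apply (is_derive_id (K := R_AbsRing)).
  - apply continuous_const.
Qed.

Lemma C1_at_affine (a b x : R) : C1_at (fun u => a + b * u) x.
Proof.
  apply (C1_at_of_is_derive_all _ (fun _ => b)).
  - intros u. auto_derive; [exact I|ring].
  - apply continuous_const.
Qed.

Lemma C1_at_opp (h : R -> R) (x : R) : C1_at h x -> C1_at (fun u => - h u) x.
Proof.
  intros H. apply (C1_at_ext_loc (fun u => 0 + (-1) * h u)).
  - apply filter_forall. intros u. ring.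
  - apply (C1_at_comp (fun v => 0 + (-1) * v) h); [exact H|apply C1_at_affine].
Qed.

Definition glue (b : R) (h1 h2 : R -> R) (x : R) : R :=
  if Rle_dec x b then h1 x else h2 x.

Lemma glue_le (b : R) (h1 h2 : R -> R) (x : R) : x <= b -> glue b h1 h2 x = h1 x.
Proof. intros H. unfold glue. destruct (Rle_dec x b); [reflexivity|lra]. Qed.

Lemma glue_gt (b : R) (h1 h2 : R -> R) (x : R) : b < x -> glue b h1 h2 x = h2 x.
Proof. intros H. unfold glue. destruct (Rle_dec x b); [lra|reflexivity]. Qed.

Lemma glue_ge (b : R) (h1 h2 : R -> R) (x : R) : h1 b = h2 b -> b <= x -> glue b h1 h2 x = h2 x.
Proof. intros E [L | <-]; [apply glue_gt; exact L|]. rewrite glue_le by lra. exact E. Qed.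

Lemma locally_lt (a b : R) : a < b -> locally a (fun u => u < b).
Proof. intros H. apply (open_lt b a H). Qed.

Lemma locally_gt (a b : R) : b < a -> locally a (fun u => b < u).
Proof. intros H. apply (open_gt b a H). Qed.

(** The filter form of differentiability, unfolded once: gluing, inversion and difference quotients
    all work with this explicit linear error. *)
Lemma is_derive_eps (h : R -> R) (x l : R) :
  is_derive h x l <->
  forall eps, 0 < eps -> locally x (fun u => Rabs (h u - h x - l * (u - x)) <= eps * Rabs (u - x)).
Proof.
  split.
  - intros H eps He. destruct H as [_ H].
    specialize (H x (fun P p => p)). specialize (H (mkposreal eps He)).
    revert H. apply filter_imp. intros u Hu.
    unfold norm, minus, plus, opp, scal in Hu; simpl in Hu.
    unfold abs, mult in Hu; simpl in Hu.
    replace (h u - h x - l * (u - x)) with (h u + - h x + - ((u + - x) * l)) by ring.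
    exact Hu.
  - intros H. split; [apply is_linear_scal_l|].
    intros y Hy. apply (is_filter_lim_locally_unique (V := R_NormedModule)) in Hy. subst y.
    intros eps. generalize (H eps (cond_pos eps)). apply filter_imp. intros u Hu.
    unfold norm, minus, plus, opp, scal; simpl. unfold abs, mult; simpl.
    replace (h u + - h x + - ((u + - x) * l)) with (h u - h x - l * (u - x)) by ring.
    exact Hu.
Qed.

Lemma is_derive_glue (h1 h2 : R -> R) (b l : R) :
  h1 b = h2 b -> is_derive h1 b l -> is_derive h2 b l -> is_derive (glue b h1 h2) b l.
Proof.
  intros E D1 D2. apply is_derive_eps. intros eps He.
  generalize (filter_and _ _ (proj1 (is_derive_eps _ _ _) D1 eps He)
                             (proj1 (is_derive_eps _ _ _) D2 eps He)).
  apply filter_imp. intros u [A B].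
  rewrite (glue_le b h1 h2 b) by lra. unfold glue.
  destruct (Rle_dec u b); [exact A|]. rewrite E. exact B.
Qed.

(** Each piece is required to be smooth only on its own side of [b], because a piece built by
    pulling back along a branch may be smooth on that side alone. *)
Lemma C1_at_glue (h1 h2 : R -> R) (b x : R) :
  (x <= b -> C1_at h1 x) -> (b <= x -> C1_at h2 x) ->
  h1 b = h2 b -> (x = b -> Derive h1 b = Derive h2 b) -> C1_at (glue b h1 h2) x.
Proof.
  intros H1 H2 E ED. destruct (Rtotal_order x b) as [L | [L | L]].
  - apply (C1_at_ext_loc h1); [|apply H1; lra].
    generalize (locally_lt x b L). apply filter_imp. intros u Hu. rewrite glue_le; lra.
  - subst x. specialize (H1 (Rle_refl b)). specialize (H2 (Rle_refl b)).
    specialize (ED eq_refl).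
    apply (C1_at_of_is_derive _ (glue b (Derive h1) (Derive h2))).
    + destruct H1 as [H1 H1']. destruct H2 as [H2 H2'].
      generalize (filter_and _ _ H1 H2). apply filter_imp. intros u [A B].
      destruct (Rtotal_order u b) as [L | [L | L]].
      * rewrite glue_le by lra. apply (is_derive_ext_loc h1); [|apply Derive_correct; exact A].
        generalize (locally_lt u b L). apply filter_imp. intros v Hv. rewrite glue_le; lra.
      * subst u. rewrite glue_le by lra. apply is_derive_glue; [exact E| |].
        -- apply Derive_correct; exact A.
        -- rewrite ED. apply Derive_correct; exact B.
      * rewrite glue_gt by lra. apply (is_derive_ext_loc h2); [|apply Derive_correct; exact B].
        generalize (locally_gt u b L). apply filter_imp. intros v Hv. rewrite glue_gt; lra.
    + destruct H1 as [H1 H1']. destruct H2 as [H2 H2'].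
      unfold continuous in *. rewrite (glue_le b _ _ b) by lra. rewrite <- ED in H2'.
      intros P HP. change (locally b (fun u => P (glue b (Derive h1) (Derive h2) u))).
      pose proof (H1' P HP : locally b (fun u => P (Derive h1 u))) as A1.
      pose proof (H2' P HP : locally b (fun u => P (Derive h2 u))) as A2.
      generalize (filter_and _ _ A1 A2). apply filter_imp. intros u [A B]. unfold glue.
      destruct (Rle_dec u b); assumption.
  - apply (C1_at_ext_loc h2); [|apply H2; lra].
    generalize (locally_gt x b L). apply filter_imp. intros u Hu. rewrite glue_gt; lra.
Qed.

Set Implicit Arguments.

(** The inverse is a parameter rather than an existential, so that later formulas can mention it.
    Orientation is left open, since the right branch may be decreasing. *)
Record diffeo (h k : R -> R) : Prop := {
  diffeo_kh : forall x, k (h x) = x;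
  diffeo_hk : forall y, h (k y) = y;
  diffeo_C1 : forall x, C1_at h x;
  diffeo_C1' : forall y, C1_at k y }.

Unset Implicit Arguments.

Definition increasing_fun (h : R -> R) : Prop := forall x y, x < y -> h x < h y.

Lemma diffeo_sym (h k : R -> R) : diffeo h k -> diffeo k h.
Proof. intros [A B C D]. split; assumption. Qed.

Lemma diffeo_comp (g gi h hi : R -> R) :
  diffeo g gi -> diffeo h hi -> diffeo (fun x => g (h x)) (fun y => hi (gi y)).
Proof.
  intros [A B C D] [A' B' C' D']. split; intros.
  - rewrite A. apply A'.
  - rewrite B'. apply B.
  - apply C1_at_comp; auto.
  - apply C1_at_comp; auto.
Qed.

Lemma diffeo_affine (a b : R) : b <> 0 -> diffeo (fun x => a + b * x) (fun y => (y - a) / b).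
Proof.
  intros Hb. split; intros.
  - field; exact Hb.
  - field; exact Hb.
  - apply C1_at_affine.
  - apply (C1_at_ext_loc (fun u => - a / b + / b * u)); [|apply C1_at_affine].
    apply filter_forall. intros u. field. exact Hb.
Qed.

Lemma diffeo_opp : diffeo (fun x => - x) (fun x => - x).
Proof.
  split; intros; try ring; apply C1_at_opp; apply C1_at_id.
Qed.

Lemma increasing_le (h : R -> R) (x y : R) : increasing_fun h -> x <= y -> h x <= h y.
Proof. intros H [L | ->]; [left; apply H; exact L|lra]. Qed.

Lemma increasing_lt_inv (h : R -> R) (x y : R) : increasing_fun h -> h x < h y -> x < y.
Proof.
  intros H L. destruct (Rlt_le_dec x y) as [A | A]; [exact A|].
  pose proof (increasing_le h y x H A). lra.
Qed.

Lemma increasing_le_inv (h : R -> R) (x y : R) : increasing_fun h -> h x <= h y -> x <= y.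
Proof.
  intros H L. destruct (Rle_lt_dec x y) as [A | A]; [exact A|].
  pose proof (H y x A). lra.
Qed.

Lemma diffeo_increasing_inv (h k : R -> R) :
  diffeo h k -> increasing_fun h -> increasing_fun k.
Proof.
  intros D H x y L. apply (increasing_lt_inv h _ _ H). now rewrite !(diffeo_hk D).
Qed.

Lemma diffeo_Derive_inv (h k : R -> R) (x : R) :
  diffeo h k -> Derive h x * Derive k (h x) = 1.
Proof.
  intros D. rewrite <- Derive_comp.
  - rewrite (Derive_ext _ (fun u => u)); [apply Derive_id|apply (diffeo_kh D)].
  - exists (Derive k (h x)). apply C1_at_is_derive, (diffeo_C1' D).
  - exists (Derive h x). apply C1_at_is_derive, (diffeo_C1 D).
Qed.

Lemma MVT_all (f df : R -> R) (a b : R) :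
  (forall x, is_derive f x (df x)) ->
  exists c, Rmin a b <= c <= Rmax a b /\ f b - f a = df c * (b - a).
Proof.
  intros H. apply MVT_gen; intros; [apply H|].
  apply continuity_pt_filterlim. apply (ex_derive_continuous (V := R_NormedModule)).
  exists (df x). apply H.
Qed.

Lemma increasing_of_deriv (h dh : R -> R) :
  (forall x, is_derive h x (dh x)) -> (forall x, 0 < dh x) -> increasing_fun h.
Proof.
  intros H P x y L. destruct (MVT_all h dh x y H) as [c [_ E]].
  specialize (P c). nra.
Qed.

Lemma increasing_inverse_continuous (h k : R -> R) (y : R) :
  increasing_fun h -> (forall v, h (k v) = v) -> continuous k y.
Proof.
  intros Hi Hk. apply filterlim_locally. intros eps.
  pose proof (cond_pos eps) as He.
  assert (A : h (k y - eps) < y) by (rewrite <- (Hk y) at 2; apply Hi; lra).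
  assert (B : y < h (k y + eps)) by (rewrite <- (Hk y) at 1; apply Hi; lra).
  generalize (filter_and _ _ (locally_gt y _ A) (locally_lt y _ B)).
  apply filter_imp. intros v [V1 V2]. rewrite <- (Hk v) in V1, V2.
  apply (increasing_lt_inv h _ _ Hi) in V1. apply (increasing_lt_inv h _ _ Hi) in V2.
  change (Rabs (k v - k y) < eps). apply Rabs_def1; lra.
Qed.

Lemma is_derive_inverse (h k : R -> R) (y l : R) :
  continuous k y -> (forall v, h (k v) = v) -> 0 < l -> is_derive h (k y) l ->
  is_derive k y (/ l).
Proof.
  intros Hc Hk Hl Hd. apply is_derive_eps. intros eps He.
  (* [l / 2] yields the crude bound of [k v - k y] by [2 / l] times [v - y]; [eps * l * l / 2] turns
     this bound into the required error after division by [l]. *)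
  set (e := Rmin (l / 2) (eps * l * l / 2)).
  assert (He1 : 0 < e).
  { unfold e. apply Rmin_glb_lt; [lra|]. assert (0 < eps * l * l) by (repeat apply Rmult_lt_0_compat; lra). lra. }
  pose proof (proj1 (is_derive_eps _ _ _) Hd e He1) as H.
  generalize (Hc _ H). unfold filtermap. apply filter_imp. intros v Hv.
  rewrite !Hk in Hv.
  assert (E1 : e <= l / 2) by apply Rmin_l.
  assert (E2 : e <= eps * l * l / 2) by apply Rmin_r.
  set (d := k v - k y) in *. set (w := v - y) in *.
  assert (Q : Rabs d <= 2 / l * Rabs w).
  { assert (l * Rabs d <= Rabs w + e * Rabs d).
    { replace (l * Rabs d) with (Rabs (l * d)) by (rewrite Rabs_mult, (Rabs_pos_eq l); lra).
      replace (l * d) with (w - (w - l * d)) by ring.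
      eapply Rle_trans; [apply Rabs_triang|]. rewrite Rabs_Ropp. lra. }
    pose proof (Rabs_pos d).
    apply (Rmult_le_reg_l (l / 2)); [lra|].
    replace (l / 2 * (2 / l * Rabs w)) with (Rabs w) by (field; lra). nra. }
  replace (d - / l * w) with (- / l * (w - l * d)) by (field; lra).
  rewrite Rabs_mult, Rabs_Ropp, (Rabs_pos_eq (/ l)) by (left; apply Rinv_0_lt_compat; lra).
  apply (Rmult_le_reg_l l); [lra|]. rewrite <- Rmult_assoc, Rinv_r, Rmult_1_l by lra.
  eapply Rle_trans; [exact Hv|].
  apply Rle_trans with (eps * l * l / 2 * (2 / l * Rabs w)).
  - apply Rmult_le_compat; try lra. apply Rabs_pos.
  - right. field. lra.
Qed.

Lemma continuous_onto (h : R -> R) (y : R) :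
  (forall x, continuous h x) -> (exists x1, h x1 <= y) -> (exists x2, y <= h x2) ->
  exists x, h x = y.
Proof.
  intros Hc [x1 H1] [x2 H2].
  destruct (IVT_gen h x1 x2 y) as [x [_ E]].
  - intros x. apply continuity_pt_filterlim. apply Hc.
  - unfold Rmin, Rmax. destruct (Rle_dec (h x1) (h x2)); lra.
  - exists x. exact E.
Qed.

Lemma diffeo_of_deriv (h dh : R -> R) :
  (forall x, is_derive h x (dh x)) -> (forall x, continuous dh x) -> (forall x, 0 < dh x) ->
  (forall y, exists x, h x <= y) -> (forall y, exists x, y <= h x) ->
  exists k, diffeo h k.
Proof.
  intros Hd Hc Hp Hm HM.
  pose proof (increasing_of_deriv h dh Hd Hp) as Hi.
  assert (Hch : forall x, continuous h x).
  { intros x. apply (ex_derive_continuous (V := R_NormedModule)). exists (dh x). apply Hd. }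
  assert (Hsur : forall y, exists x, h x = y) by (intros y; apply continuous_onto; auto).
  set (k := fun y => proj1_sig (constructive_indefinite_description _ (Hsur y))).
  assert (Hk : forall y, h (k y) = y).
  { intros y. unfold k. destruct (constructive_indefinite_description _ (Hsur y)); assumption. }
  assert (Hkc : forall y, continuous k y) by (intros y; apply (increasing_inverse_continuous h); auto).
  exists k. split.
  - intros x. destruct (Rtotal_order (k (h x)) x) as [L | [L | L]]; [|exact L|];
      apply Hi in L; rewrite Hk in L; lra.
  - exact Hk.
  - intros x. apply (C1_at_of_is_derive_all _ dh); auto.
  - intros y. apply (C1_at_of_is_derive_all _ (fun v => / dh (k v))).
    + intros v. apply (is_derive_inverse h); auto.
    + apply (continuous_comp (fun v => dh (k v)) Rinv).
      * apply (continuous_comp k dh); auto.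
      * apply continuity_pt_filterlim. apply (continuity_pt_inv (fun u => u)); [apply continuity_pt_id|].
        specialize (Hp (k y)). lra.
Qed.

Lemma diffeo_of_deriv_bound (h dh : R -> R) (m : R) :
  0 < m -> (forall x, is_derive h x (dh x)) -> (forall x, continuous dh x) ->
  (forall x, m <= dh x) -> exists k, diffeo h k.
Proof.
  intros Hm Hd Hc Hl. apply (diffeo_of_deriv h dh); auto.
  - intros x. specialize (Hl x). lra.
  - intros y. exists (Rmin 0 ((y - h 0) / m)).
    destruct (MVT_all h dh 0 (Rmin 0 ((y - h 0) / m)) Hd) as [c [_ E]].
    specialize (Hl c). set (z := (y - h 0) / m) in *.
    assert (z * m = y - h 0) by (unfold z; field; lra).
    assert (Rmin 0 z <= 0) by apply Rmin_l. assert (Rmin 0 z <= z) by apply Rmin_r. nra.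
  - intros y. exists (Rmax 0 ((y - h 0) / m)).
    destruct (MVT_all h dh 0 (Rmax 0 ((y - h 0) / m)) Hd) as [c [_ E]].
    specialize (Hl c). set (z := (y - h 0) / m) in *.
    assert (z * m = y - h 0) by (unfold z; field; lra).
    assert (0 <= Rmax 0 z) by apply Rmax_l. assert (z <= Rmax 0 z) by apply Rmax_r. nra.
Qed.

(** * Koenigs linearisation *)

(** Dividing by the multiplier [DT xs] makes the record insensitive to orientation:
    [contraction_ratio] says that [DT] keeps the sign of [DT xs] and that the logarithm of the
    quotient is defined and Lipschitz on the range concerned. *)
Record contraction (k m K : R) (T DT : R -> R) (xs : R) : Prop := {
  contraction_deriv : forall x, is_derive T x (DT x);
  contraction_bound : forall x, Rabs (DT x) <= k;
  contraction_ratio : forall x, m <= DT x / DT xs;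
  contraction_mult : m <= Rabs (DT xs);
  contraction_lip : forall x y, Rabs (DT x - DT y) <= K * Rabs (x - y);
  contraction_fix : T xs = xs }.

Lemma lipschitz_continuous (f : R -> R) (C x : R) :
  (forall u v, Rabs (f u - f v) <= C * Rabs (u - v)) -> continuous f x.
Proof.
  intros H. apply filterlim_locally. intros eps.
  pose proof (cond_pos eps) as He.
  set (c := Rmax 1 C). assert (1 <= c) by apply Rmax_l. assert (C <= c) by apply Rmax_r.
  assert (Hd : 0 < eps / c) by (apply Rdiv_lt_0_compat; lra).
  exists (mkposreal _ Hd). intros u Hu. change (Rabs (u - x) < eps / c) in Hu.
  change (Rabs (f u - f x) < eps).
  apply Rle_lt_trans with (c * Rabs (u - x)).
  - eapply Rle_trans; [apply H|]. apply Rmult_le_compat_r; [apply Rabs_pos|lra].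
  - apply Rlt_le_trans with (c * (eps / c)); [apply Rmult_lt_compat_l; lra|right; field; lra].
Qed.

Lemma deriv_bound_lipschitz (f df : R -> R) (C x y : R) :
  (forall u, is_derive f u (df u)) -> (forall u, Rabs (df u) <= C) ->
  Rabs (f x - f y) <= C * Rabs (x - y).
Proof.
  intros H HC. destruct (MVT_all f df y x H) as [c [_ E]]. rewrite E, Rabs_mult.
  apply Rmult_le_compat_r; [apply Rabs_pos|apply HC].
Qed.

Lemma iter_lipschitz (T : R -> R) (k : R) (n : nat) (x y : R) :
  0 <= k -> (forall u v, Rabs (T u - T v) <= k * Rabs (u - v)) ->
  Rabs (Nat.iter n T x - Nat.iter n T y) <= k ^ n * Rabs (x - y).
Proof.
  intros Hk H. induction n as [|n IH]; simpl; [lra|].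
  eapply Rle_trans; [apply H|]. rewrite Rmult_assoc. apply Rmult_le_compat_l; assumption.
Qed.

Lemma iter_fix (T : R -> R) (n : nat) (x : R) : T x = x -> Nat.iter n T x = x.
Proof. intros H. induction n as [|n IH]; simpl; [reflexivity|]. now rewrite IH. Qed.

Lemma exp_nondecreasing (x y : R) : x <= y -> exp x <= exp y.
Proof. intros [L | ->]; [left; apply exp_increasing; exact L|lra]. Qed.

Lemma exp_lt_2 (x : R) : x <= 1 / 2 -> exp x < 2.
Proof.
  intros Hx. apply exp_nondecreasing in Hx. pose proof (exp_pos (1 / 2)).
  assert (Q : exp (1 / 2) * exp (1 / 2) <= 3).
  { rewrite <- exp_plus. replace (1 / 2 + 1 / 2) with 1 by field. exact exp_le_3. }
  nra.
Qed.

Lemma ln_le_sub (z : R) : 0 < z -> ln z <= z - 1.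
Proof. intros H. pose proof (exp_ineq1_le (ln z)) as E. rewrite exp_ln in E by exact H. lra. Qed.

Lemma ln_lipschitz (m a b : R) : 0 < m -> m <= a -> m <= b -> Rabs (ln a - ln b) <= Rabs (a - b) / m.
Proof.
  intros Hm.
  assert (W : forall a b, m <= a -> m <= b -> ln a - ln b <= Rabs (a - b) / m).
  { intros u v Hu Hv. rewrite <- ln_div by lra.
    eapply Rle_trans; [apply ln_le_sub; apply Rdiv_lt_0_compat; lra|].
    replace (u / v - 1) with ((u - v) / v) by (field; lra).
    apply Rle_trans with (Rabs (u - v) / v).
    - apply Rmult_le_compat_r; [left; apply Rinv_0_lt_compat; lra|apply Rle_abs].
    - apply Rmult_le_compat_l; [apply Rabs_pos|apply Rinv_le_contravar; lra]. }
  intros Ha Hb. apply Rabs_le. split.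
  - pose proof (W b a Hb Ha). rewrite Rabs_minus_sym in H. lra.
  - apply W; assumption.
Qed.

Lemma is_derive_RInt_continuous (f : R -> R) (a x : R) :
  (forall u, continuous f u) -> is_derive (fun u => RInt f a u) x (f x).
Proof.
  intros H. apply (is_derive_RInt (V := R_NormedModule) f _ a); [|apply H].
  apply filter_forall. intros u. apply (RInt_correct (V := R_CompleteNormedModule)).
  apply (ex_RInt_continuous (V := R_CompleteNormedModule)). intros; apply H.
Qed.

Lemma pow_small (q e : R) : 0 <= q < 1 -> 0 < e -> exists n, q ^ n < e.
Proof.
  intros Hq He. destruct (pow_lt_1_zero q) with (y := e) as [N HN].
  - rewrite Rabs_pos_eq; lra.
  - exact He.
  - exists N. eapply Rle_lt_trans; [apply Rle_abs|]. apply HN. lia.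
Qed.

(* Koenigs' linearisation: the logarithm of its derivative is the series of
   [ln (DT (T^n x) / DT xs)], which inherits a Lipschitz bound because [T^n]
   is [k^n]-Lipschitz. *)
Lemma koenigs_linearisation (k m K : R) (T Ti DT : R -> R) (xs : R) :
  0 <= k < 1 -> 0 < m -> 0 <= K ->
  contraction k m K T DT xs -> (forall y, T (Ti y) = y) ->
  exists phi phii l : R -> R,
    diffeo phi phii /\ (forall x, is_derive phi x (exp (l x))) /\ phi xs = 0 /\
    (forall x y, Rabs (l x - l y) <= K / (m * m) / (1 - k) * Rabs (x - y)) /\ l xs = 0 /\
    (forall x, phi (T x) = DT xs * phi x).
Proof.
  intros Hk Hm HK HT HTi. destruct HT as [Hd Hb Hr Hlam Hl Hx].
  set (lam := DT xs) in *.
  assert (Hlam0 : lam <> 0) by (intros E; rewrite E, Rabs_R0 in Hlam; lra).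
  set (u := fun x => ln (DT x / lam)).
  set (C := K / (m * m)).
  assert (HC : 0 <= C).
  { unfold C. apply Rmult_le_pos; [exact HK|]. left. apply Rinv_0_lt_compat. nra. }
  assert (Hu : forall x y, Rabs (u x - u y) <= C * Rabs (x - y)).
  { intros x y. unfold u. eapply Rle_trans; [apply (ln_lipschitz m); auto|].
    replace (DT x / lam - DT y / lam) with ((DT x - DT y) * / lam) by (field; exact Hlam0).
    rewrite Rabs_mult, Rabs_inv. unfold C.
    apply Rle_trans with (K * Rabs (x - y) * / m / m); [|right; field; lra].
    apply Rmult_le_compat_r; [left; apply Rinv_0_lt_compat; lra|].
    apply Rmult_le_compat; [apply Rabs_pos|left; apply Rinv_0_lt_compat; lra|apply Hl|].
    apply Rinv_le_contravar; lra. }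
  assert (Hux : u xs = 0) by (unfold u; fold lam; rewrite Rdiv_diag by exact Hlam0; apply ln_1).
  assert (HTl : forall x y, Rabs (T x - T y) <= k * Rabs (x - y))
    by (intros; apply (deriv_bound_lipschitz T DT); auto).
  set (a := fun x n => u (Nat.iter n T x)).
  assert (Hg : forall c, ex_series (fun n => C * c * k ^ n)).
  { intros c. apply (ex_series_scal_l (C * c) (fun n => k ^ n)). apply ex_series_geom.
    rewrite Rabs_pos_eq; lra. }
  assert (Ha : forall x y n, Rabs (a x n - a y n) <= C * Rabs (x - y) * k ^ n).
  { intros x y n. unfold a. eapply Rle_trans; [apply Hu|].
    rewrite Rmult_assoc. apply Rmult_le_compat_l; [exact HC|]. rewrite Rmult_comm.
    rewrite Rmult_comm. rewrite (Rmult_comm (Rabs _)). apply iter_lipschitz; [lra|exact HTl]. }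
  assert (Hax : forall n, a xs n = 0) by (intros n; unfold a; rewrite iter_fix; auto).
  assert (Hsum : forall x, ex_series (a x)).
  { intros x. apply (ex_series_le (V := R_CompleteNormedModule)) with (2 := Hg (Rabs (x - xs))).
    intros n. change (Rabs (a x n) <= C * Rabs (x - xs) * k ^ n).
    specialize (Ha x xs n). rewrite Hax, Rminus_0_r in Ha. exact Ha. }
  set (l := fun x => Series (a x)).
  assert (Hlip : forall x y, Rabs (l x - l y) <= C / (1 - k) * Rabs (x - y)).
  { intros x y. unfold l. rewrite <- Series_minus by auto.
    assert (Q : ex_series (fun n => Rabs (a x n - a y n))).
    { apply (ex_series_le (V := R_CompleteNormedModule)) with (2 := Hg (Rabs (x - y))).
      intros n. change (Rabs (Rabs (a x n - a y n)) <= C * Rabs (x - y) * k ^ n).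
      rewrite Rabs_Rabsolu. apply Ha. }
    eapply Rle_trans; [apply Series_Rabs; exact Q|].
    eapply Rle_trans; [apply Series_le; [|apply Hg]|].
    - intros n. split; [apply Rabs_pos|apply Ha].
    - rewrite Series_scal_l, Series_geom by (rewrite Rabs_pos_eq; lra). right. field. lra. }
  assert (Hrec : forall x, l x = u x + l (T x)).
  { intros x. unfold l. rewrite (Series_incr_1 (a x)) by auto.
    f_equal. apply Series_ext. intros n. unfold a.
    f_equal. apply Nat.iter_succ_r. }
  assert (Hlx : l xs = 0).
  { unfold l. rewrite (Series_ext _ (fun n => 0 * 1)) by (intros n; rewrite Hax; ring).
    rewrite Series_scal_l. ring. }
  (* The series prescribes the logarithm of the derivative, so the linearisation is obtained by
     integrating from the fixed point; its derivative is automatically positive and equals 1 at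
     [xs]. *)
  set (phi := (fun x => RInt (fun s => exp (l s)) xs x) : R -> R).
  assert (Hlc : forall x, continuous (fun s => exp (l s)) x).
  { intros x. apply (continuous_comp l exp).
    - apply (lipschitz_continuous l (C / (1 - k))). exact Hlip.
    - apply continuity_pt_filterlim. apply derivable_continuous_pt. apply derivable_pt_exp. }
  assert (Hphi : forall x, is_derive phi x (exp (l x)))
    by (intros x; apply (is_derive_RInt_continuous (fun s => exp (l s))); exact Hlc).
  assert (Hphi0 : phi xs = 0) by (unfold phi; apply (RInt_point (V := R_CompleteNormedModule))).
  (* Both sides vanish at [xs], and by [Hrec] they have the same derivative: shifting the series by
     one term multiplies [exp (l x)] by exactly [DT x / lam]. *)
  assert (Hconj : forall x, phi (T x) = lam * phi x).
  { intros x.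
    destruct (MVT_all (fun z => phi (T z) - lam * phi z) (fun z => 0) xs x) as [c [_ E]].
    - intros z.
      replace 0 with (minus (DT z * exp (l (T z))) (lam * exp (l z))).
      + apply (is_derive_minus (V := R_NormedModule)).
        * apply (is_derive_comp (V := R_NormedModule) phi T); [apply Hphi|apply Hd].
        * apply (is_derive_scal phi z lam). apply Hphi.
      + rewrite (Hrec z), exp_plus. unfold u. rewrite exp_ln.
        * unfold minus, plus, opp; simpl. field. exact Hlam0.
        * specialize (Hr z). lra.
    - rewrite Hx, Hphi0 in E. lra. }
  assert (Hinc : increasing_fun phi)
    by (apply (increasing_of_deriv phi (fun x => exp (l x))); [exact Hphi|intros; apply exp_pos]).
  (* Two steps at a time, because [lam] may be negative: going back by [Ti] twice divides [phi] by
     [q] and keeps its sign, so [phi] is unbounded on both sides of [xs], hence onto. *)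
  set (q := lam * lam).
  assert (Hlk : Rabs lam <= k) by apply Hb.
  assert (Hq : 0 <= q < 1).
  { unfold q. rewrite <- (Rabs_pos_eq (lam * lam)) by nra. rewrite Rabs_mult.
    pose proof (Rabs_pos lam). nra. }
  assert (Hiter : forall n x, exists z, phi x = q ^ n * phi z).
  { intros n. induction n as [|n IH]; intros x.
    - exists x. simpl. ring.
    - destruct (IH (Ti (Ti x))) as [z E]. exists z. simpl. rewrite Rmult_assoc, <- E.
      rewrite <- (HTi x) at 1. rewrite Hconj. rewrite <- (HTi (Ti x)) at 1. rewrite Hconj.
      unfold q. ring. }
  destruct (diffeo_of_deriv phi (fun x => exp (l x))) as [phii Hdi].
  - exact Hphi.
  - exact Hlc.
  - intros x. apply exp_pos.
  - intros y. assert (N : phi (xs - 1) < 0) by (rewrite <- Hphi0; apply Hinc; lra).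
    destruct (pow_small q (- phi (xs - 1) / (1 + Rabs y)) Hq) as [n Hn].
    { pose proof (Rabs_pos y). apply Rdiv_lt_0_compat; lra. }
    destruct (Hiter n (xs - 1)) as [z E]. exists z.
    pose proof (Rabs_pos y). pose proof (Rle_abs (- y)) as A. rewrite Rabs_Ropp in A.
    apply (Rmult_lt_compat_r (1 + Rabs y)) in Hn; [|lra].
    unfold Rdiv in Hn. rewrite Rmult_assoc, Rinv_l, Rmult_1_r in Hn by lra.
    assert (0 <= q ^ n) by (apply pow_le; lra).
    destruct (Rle_lt_dec (phi z) y) as [G | G]; [exact G|]. exfalso. nra.
  - intros y. assert (N : 0 < phi (xs + 1)) by (rewrite <- Hphi0; apply Hinc; lra).
    destruct (pow_small q (phi (xs + 1) / (1 + Rabs y)) Hq) as [n Hn].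
    { pose proof (Rabs_pos y). apply Rdiv_lt_0_compat; lra. }
    destruct (Hiter n (xs + 1)) as [z E]. exists z.
    pose proof (Rabs_pos y). pose proof (Rle_abs y) as A.
    apply (Rmult_lt_compat_r (1 + Rabs y)) in Hn; [|lra].
    unfold Rdiv in Hn. rewrite Rmult_assoc, Rinv_l, Rmult_1_r in Hn by lra.
    assert (0 <= q ^ n) by (apply pow_le; lra).
    destruct (Rle_lt_dec y (phi z)) as [G | G]; [exact G|]. exfalso. nra.
  - exists phi, phii, l. tauto.
Qed.

(** Two maps with equal multipliers are both linearised to the same multiplication, which commutes
    with scaling; so the second inverse linearisation composed with [c] times the first is a
    conjugacy for every [c > 0]. The freedom in [c] is used to fix 0, and [A = ln c]. Then [lh x] is
    [A] plus the difference of the two logarithmic slopes, both of which vanish at the fixed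
    points. *)
Lemma conjugate_contractions (k m K : R) (T Ti DT S Si DS : R -> R) (xs ys : R) :
  0 <= k < 1 -> 0 < m -> 0 <= K ->
  contraction k m K T DT xs -> (forall y, T (Ti y) = y) ->
  contraction k m K S DS ys -> (forall y, S (Si y) = y) ->
  DT xs = DS ys -> (xs = 0 /\ ys = 0) \/ 0 < xs * ys ->
  exists h kh lh : R -> R, exists A : R,
    diffeo h kh /\ (forall x, is_derive h x (exp (lh x))) /\ h 0 = 0 /\ h xs = ys /\
    (forall x, h (T x) = S (h x)) /\
    (forall x, Rabs (lh x - A) <=
       K / (m * m) / (1 - k) * (Rabs (x - xs) + Rabs (h x - ys))) /\
    (xs = 0 -> A = 0).
Proof.
  intros Hk Hm HK HT HTi HS HSi Hlam Hpos.
  destruct (koenigs_linearisation k m K T Ti DT xs) as (phi & phii & l & D1 & P1 & Z1 & L1 & L1' & C1); auto.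
  destruct (koenigs_linearisation k m K S Si DS ys) as (psi & psii & l2 & D2 & P2 & Z2 & L2 & L2' & C2); auto.
  set (C := K / (m * m) / (1 - k)) in *.
  pose proof (increasing_of_deriv phi _ P1 (fun x => exp_pos _)) as I1.
  pose proof (increasing_of_deriv psi _ P2 (fun x => exp_pos _)) as I2.
  (* [phi] is increasing with zero [xs], so [phi 0] has the sign opposite to [xs], and similarly for
     [psi]: fixed points on the same side of 0 make the quotient positive. If both are 0, every [c]
     fixes 0 and 1 is chosen. *)
  assert (Hc : exists c, 0 < c /\ c * phi 0 = psi 0 /\ (xs = 0 -> c = 1)).
  { destruct Hpos as [[E1 E2] | Hpos].
    - exists 1. subst xs ys. rewrite Z1, Z2. split; [lra|split; [ring|reflexivity]].
    - assert (Q : 0 < psi 0 / phi 0 /\ phi 0 <> 0).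
      { destruct (Rlt_le_dec 0 xs) as [A | A].
        - assert (0 < ys) by nra.
          assert (phi 0 < 0) by (pose proof (I1 0 xs A); lra).
          assert (psi 0 < 0) by (pose proof (I2 0 ys H); lra).
          split; [|lra]. replace (psi 0 / phi 0) with ((- psi 0) / (- phi 0)) by (field; lra).
          apply Rdiv_lt_0_compat; lra.
        - assert (xs < 0) by (destruct A as [A | A]; [exact A|rewrite A in Hpos; lra]).
          assert (ys < 0) by nra.
          assert (0 < phi 0) by (pose proof (I1 xs 0 H); lra).
          assert (0 < psi 0) by (pose proof (I2 ys 0 H0); lra).
          split; [|lra]. apply Rdiv_lt_0_compat; lra. }
      exists (psi 0 / phi 0). destruct Q as [Q1 Q2]. split; [exact Q1|]. split; [field; exact Q2|].
      intros ->. lra. }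
  destruct Hc as (c & Hc0 & Hc1 & Hc2).
  exists (fun x => psii (c * phi x)).
  exists (fun y => phii ((psi y - 0) / c)).
  exists (fun x => ln c + l x - l2 (psii (c * phi x))), (ln c).
  split; [|split; [|split; [|split; [|split; [|split]]]]].
  - assert (D : diffeo (fun x => psii (0 + c * phi x)) (fun y => phii ((psi y - 0) / c))).
    { apply (diffeo_comp psii psi (fun x => 0 + c * phi x) (fun y => phii ((y - 0) / c))).
      - apply diffeo_sym. exact D2.
      - apply (diffeo_comp (fun v => 0 + c * v) (fun y => (y - 0) / c)); [|exact D1].
        apply diffeo_affine. lra. }
    destruct D as [Q1 Q2 Q3 Q4]. split.
    + intros x. rewrite <- (Q1 x) at 2. now rewrite Rplus_0_l.
    + intros y. rewrite <- (Q2 y) at 2. now rewrite Rplus_0_l.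
    + intros x. apply (C1_at_ext_loc _ _ _ (filter_forall _ (fun u => f_equal psii (Rplus_0_l (c * phi u)))) (Q3 x)).
    + exact Q4.
  - intros x.
    replace (exp (ln c + l x - l2 (psii (c * phi x)))) with
      (scal (c * exp (l x)) (/ exp (l2 (psii (c * phi x))))).
    + apply (is_derive_comp (V := R_NormedModule) psii (fun x => c * phi x)).
      * apply (is_derive_inverse psi).
        -- apply C1_at_continuous, (diffeo_C1' D2).
        -- apply (diffeo_hk D2).
        -- apply exp_pos.
        -- apply P2.
      * apply (is_derive_scal phi x c). apply P1.
    + unfold Rminus. rewrite !exp_plus, exp_Ropp, exp_ln by exact Hc0. reflexivity.
  - rewrite Hc1. apply (diffeo_kh D2).
  - rewrite Z1, Rmult_0_r, <- Z2. apply (diffeo_kh D2).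
  - intros x. rewrite <- (diffeo_kh D2 (S (psii (c * phi x)))).
    rewrite C1, C2, (diffeo_hk D2), Hlam. f_equal. ring.
  - intros x. set (hx := psii (c * phi x)).
    replace (ln c + l x - l2 hx - ln c) with ((l x - l xs) - (l2 hx - l2 ys)) by (rewrite L1', L2'; ring).
    eapply Rle_trans; [apply Rabs_triang|]. rewrite Rabs_Ropp, Rmult_plus_distr_l.
    apply Rplus_le_compat; auto.
  - intros E. rewrite (Hc2 E). apply ln_1.
Qed.

Lemma segment_from_0 (b x : R) :
  Rmin 0 b <= x <= Rmax 0 b -> Rabs x <= Rabs b /\ Rabs (x - b) <= Rabs b.
Proof.
  unfold Rmin, Rmax. intros H. unfold Rabs.
  destruct (Rle_dec 0 b); repeat destruct (Rcase_abs _); lra.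
Qed.

Lemma increasing_segment (h : R -> R) (a b x : R) :
  increasing_fun h -> Rmin a b <= x <= Rmax a b -> Rmin (h a) (h b) <= h x <= Rmax (h a) (h b).
Proof.
  intros I. pose proof (fun u v => increasing_le h u v I) as J.
  unfold Rmin, Rmax. intros H. destruct (Rle_dec a b) as [L | L].
  - pose proof (J a b L). destruct (Rle_dec (h a) (h b)); [|lra]. split; apply J; apply H.
  - pose proof (I b a (Rnot_le_lt _ _ L)). destruct (Rle_dec (h a) (h b)); [lra|]. split; apply J; apply H.
Qed.

(** The closeness of [ys / xs] to 1 controls the scaling constant, and the Lipschitz bound then
    controls the slope near 0. That bound also involves [h x], whose size is what the slope bound
    should yield; the circle is broken by [eta <= 1/2], which keeps the slope below 2. The clause on
    [xs = 0] gives slope exactly 1 at the origin, so that a left and a right conjugacy can later be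
    glued there. *)
Lemma pinned_conjugacy (k m K eta0 : R) (T Ti DT S Si DS : R -> R) (xs ys : R) :
  0 <= k < 1 -> 0 < m -> 0 <= K -> 0 <= eta0 ->
  contraction k m K T DT xs -> (forall y, T (Ti y) = y) ->
  contraction k m K S DS ys -> (forall y, S (Si y) = y) ->
  DT xs = DS ys ->
  (xs = 0 /\ ys = 0) \/ (xs <> 0 /\ exp (- eta0) <= ys / xs <= exp eta0) ->
  exists h kh lh : R -> R,
    diffeo h kh /\ (forall x, is_derive h x (exp (lh x))) /\ h 0 = 0 /\ h xs = ys /\
    (forall x, h (T x) = S (h x)) /\
    (xs = 0 -> lh 0 = 0) /\
    (forall p eta x, 0 < p -> eta <= 1/2 ->
       eta0 + K / (m * m) / (1 - k) * (3 * p + 2 * Rabs xs + 2 * Rabs ys) <= eta ->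
       Rabs x <= p -> Rabs (lh x) <= eta).
Proof.
  intros Hk Hm HK He HT HTi HS HSi Hlam Hpos.
  destruct (conjugate_contractions k m K T Ti DT S Si DS xs ys)
    as (h & kh & lh & A & D & P & Z & X & C & L & A0); auto.
  { destruct Hpos as [Hpos | [Hx [Q1 Q2]]]; [left; exact Hpos|right].
    pose proof (exp_pos (- eta0)). replace (xs * ys) with (xs * xs * (ys / xs)) by (field; exact Hx).
    apply Rmult_lt_0_compat; [|lra]. nra. }
  set (c := K / (m * m) / (1 - k)) in *.
  assert (Hc : 0 <= c).
  { unfold c. apply Rmult_le_pos; [apply Rmult_le_pos; [exact HK|]|]; left; apply Rinv_0_lt_compat; nra. }
  pose proof (increasing_of_deriv h _ P (fun x => exp_pos _)) as I.
  (* The mean slope of [h] between 0 and [xs] is [ys / xs], so [lh] has modulus at most [eta0] at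
     some point between them; the Lipschitz bound carries this over to [A]. *)
  assert (HA : Rabs A <= eta0 + c * (Rabs xs + Rabs ys)).
  { pose proof (Rabs_pos xs). pose proof (Rabs_pos ys).
    destruct Hpos as [[E _] | [Hx [Q1 Q2]]].
    - rewrite (A0 E), Rabs_R0. apply Rplus_le_le_0_compat; [exact He|]. apply Rmult_le_pos; lra.
    - destruct (MVT_all h (fun x => exp (lh x)) 0 xs P) as [z [Hz E]].
      rewrite X, Z, !Rminus_0_r in E.
      assert (E2 : exp (lh z) = ys / xs) by (rewrite E; field; exact Hx).
      rewrite <- E2 in Q1, Q2.
      assert (B : Rabs (lh z) <= eta0).
      { apply Rabs_le. split; apply Rnot_lt_le; intros N; apply exp_increasing in N; lra. }
      specialize (L z).
      destruct (segment_from_0 xs z Hz) as [_ B1].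
      pose proof (increasing_segment h 0 xs z I Hz) as B2. rewrite Z, X in B2.
      apply segment_from_0 in B2. destruct B2 as [_ B2].
      replace A with (lh z - (lh z - A)) by ring.
      eapply Rle_trans; [apply Rabs_triang|]. rewrite Rabs_Ropp.
      assert (c * (Rabs (z - xs) + Rabs (h z - ys)) <= c * (Rabs xs + Rabs ys))
        by (apply Rmult_le_compat_l; lra). lra. }
  assert (G : forall x, Rabs (lh x) <= eta0 + c * (Rabs x + Rabs (h x) + 2 * Rabs xs + 2 * Rabs ys)).
  { intros x. replace (lh x) with (A + (lh x - A)) by ring.
    eapply Rle_trans; [apply Rabs_triang|]. specialize (L x).
    assert (Rabs (x - xs) <= Rabs x + Rabs xs)
      by (unfold Rminus; rewrite <- (Rabs_Ropp xs); apply Rabs_triang).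
    assert (Rabs (h x - ys) <= Rabs (h x) + Rabs ys)
      by (unfold Rminus; rewrite <- (Rabs_Ropp ys); apply Rabs_triang).
    assert (c * (Rabs (x - xs) + Rabs (h x - ys)) <= c * (Rabs x + Rabs xs + (Rabs (h x) + Rabs ys)))
      by (apply Rmult_le_compat_l; lra). lra. }
  exists h, kh, lh. split; [exact D|]. split; [exact P|]. split; [exact Z|]. split; [exact X|].
  split; [exact C|]. split.
  - intros E. assert (ys = 0) by (destruct Hpos as [[_ ?] | [? _]]; [assumption|contradiction]).
    specialize (L 0). rewrite Z, (A0 E), E, H in L.
    replace (0 - 0) with 0 in L by ring. rewrite Rabs_R0, Rminus_0_r in L.
    pose proof (Rabs_pos (lh 0)). destruct (Req_dec (lh 0) 0) as [|N]; [assumption|].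
    apply Rabs_pos_lt in N. lra.
  - intros p eta x Hp He2 Hb Hx.
    (* The [3 * p] of the hypothesis is [p] for the point plus [2 * p] for its image. *)
    assert (B : forall z, Rabs z <= p -> Rabs (h z) <= 2 * p -> Rabs (lh z) <= eta).
    { intros z Z1 Z2. eapply Rle_trans; [apply G|]. eapply Rle_trans; [|exact Hb].
      apply Rplus_le_compat_l. apply Rmult_le_compat_l; lra. }
    pose proof (exp_lt_2 eta He2) as E2.
    assert (W : forall z, Rabs z <= p -> Rabs (h z) < 2 * p).
    { (* On the preimage of [[-2p, 2p]] the slope is below 2, so [h] cannot reach [2p] within [[-p, p]]. *)
      intros z Hz. apply Rnot_le_lt. intros N.
      set (q := 2 * p / Rabs (h z)). set (w := h z * q).
      assert (Hq : 0 <= q <= 1).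
      { unfold q. split; [left; apply Rdiv_lt_0_compat; lra|].
        apply (Rmult_le_reg_r (Rabs (h z))); [lra|]. unfold Rdiv. rewrite Rmult_assoc, Rinv_l; lra. }
      assert (Hw : Rabs w = 2 * p).
      { unfold w. rewrite Rabs_mult, (Rabs_pos_eq q) by apply Hq. unfold q. field. lra. }
      assert (K1 : h (kh w) = w) by apply (diffeo_hk D).
      assert (kh0 : kh 0 = 0) by (rewrite <- Z at 1; apply (diffeo_kh D)).
      assert (K2 : Rmin 0 (h z) <= w <= Rmax 0 (h z))
        by (unfold w, Rmin, Rmax; destruct (Rle_dec 0 (h z)); split; nra).
      apply (increasing_segment kh) in K2; [|exact (diffeo_increasing_inv _ _ D I)].
      rewrite kh0, (diffeo_kh D) in K2. apply segment_from_0 in K2. destruct K2 as [K2 _].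
      destruct (MVT_all h (fun x => exp (lh x)) 0 (kh w) P) as [y [Hy E]].
      rewrite K1, Z, !Rminus_0_r in E.
      pose proof (increasing_segment h 0 (kh w) y I Hy) as Y2. rewrite Z, K1 in Y2.
      apply segment_from_0 in Hy, Y2.
      assert (Y : Rabs y <= p /\ Rabs (h y) <= 2 * p) by lra.
      specialize (B y (proj1 Y) (proj2 Y)).
      assert (exp (lh y) <= exp eta).
      { apply exp_nondecreasing. apply Rle_trans with (1 := Rle_abs (lh y)). exact B. }
      assert (Rabs w = exp (lh y) * Rabs (kh w)).
      { rewrite E at 1. rewrite Rabs_mult, (Rabs_pos_eq (exp _)); [reflexivity|left; apply exp_pos]. }
      assert (exp (lh y) * Rabs (kh w) <= exp (lh y) * p)
        by (apply Rmult_le_compat_l; [left; apply exp_pos|lra]).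
      assert (exp (lh y) * p < 2 * p) by (apply Rmult_lt_compat_r; lra). lra. }
    apply B; [exact Hx|]. left. apply W. exact Hx.
Qed.

(** * Extension along orbits *)

Definition hits (T : R -> R) (D : R -> Prop) (x : R) : Prop := exists n, D (Nat.iter n T x).

Lemma iter_C1 (T : R -> R) (n : nat) (x : R) :
  (forall u, C1_at T u) -> C1_at (fun u => Nat.iter n T u) x.
Proof.
  intros H. induction n as [|n IH]; [apply C1_at_id|].
  apply (C1_at_comp T (fun u => Nat.iter n T u)); [exact IH|apply H].
Qed.

Lemma iter_cancel (T Ti : R -> R) (n : nat) (x : R) :
  (forall u, Ti (T u) = u) -> Nat.iter n Ti (Nat.iter n T x) = x.
Proof.
  intros H. induction n as [|n IH]; [reflexivity|].
  rewrite Nat.iter_succ_r. change (Nat.iter (S n) T x) with (T (Nat.iter n T x)).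
  rewrite H. exact IH.
Qed.

(* Pull a conjugacy back along orbits: [h] is [S^-n o h1 o T^n] for any [n]
   with [T^n x] in [D]. *)
Lemma extend_along_orbits (T S Si h1 : R -> R) (D : R -> Prop) :
  open D -> (forall u, C1_at T u) -> (forall u, C1_at Si u) -> (forall u, Si (S u) = u) ->
  (forall x, D x -> C1_at h1 x) ->
  (forall x, D x -> D (T x) -> h1 (T x) = S (h1 x)) ->
  (forall x n, D x -> D (Nat.iter (Datatypes.S n) T x) -> D (T x)) ->
  exists h : R -> R,
    (forall x n, D (Nat.iter n T x) -> h x = Nat.iter n Si (h1 (Nat.iter n T x))) /\
    (forall x, hits T D x -> C1_at h x).
Proof.
  intros HD HT HSi HS Hh Hconj Hbet.
  (* [Hbet] keeps an orbit inside [D] between two visits, so the conjugacy relation known only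
     within [D] can be chained. *)
  assert (J : forall j z, D z -> D (Nat.iter j T z) -> h1 (Nat.iter j T z) = Nat.iter j S (h1 z)).
  { intros j. induction j as [|j IH]; intros z Dz Dj; [reflexivity|].
    pose proof (Hbet z j Dz Dj) as DT. rewrite !Nat.iter_succ_r in *.
    rewrite IH by assumption. now rewrite Hconj. }
  assert (Ind : forall n j x, D (Nat.iter n T x) -> D (Nat.iter (j + n) T x) ->
    Nat.iter n Si (h1 (Nat.iter n T x)) = Nat.iter (j + n) Si (h1 (Nat.iter (j + n) T x))).
  { intros n j x D1 D2. rewrite (Nat.iter_add j n _ T) in *. rewrite (J j (Nat.iter n T x)) by assumption.
    rewrite Nat.add_comm, (Nat.iter_add n j). now rewrite (iter_cancel S Si). }
  (* Any visiting time will do, since [Ind] makes the value independent of it. This independence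
     also gives smoothness: near a given point one fixed time can be used. *)
  set (N := fun x => epsilon (inhabits 0%nat) (fun n => D (Nat.iter n T x))).
  exists (fun x => Nat.iter (N x) Si (h1 (Nat.iter (N x) T x))).
  assert (F : forall x n, D (Nat.iter n T x) ->
    Nat.iter (N x) Si (h1 (Nat.iter (N x) T x)) = Nat.iter n Si (h1 (Nat.iter n T x))).
  { intros x n Dn.
    assert (DN : D (Nat.iter (N x) T x)) by (unfold N; apply epsilon_spec; exists n; exact Dn).
    set (i := N x) in *. destruct (Nat.le_ge_cases i n) as [L | L].
    - replace n with ((n - i) + i)%nat in * by lia. apply Ind; assumption.
    - symmetry. replace i with ((i - n) + n)%nat in * by lia. apply Ind; assumption. }
  split; [exact F|].
  intros x [n Dn].
  apply (C1_at_ext_loc (fun u => Nat.iter n Si (h1 (Nat.iter n T u)))).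
  - assert (O : locally x (fun u => D (Nat.iter n T u))).
    { apply (C1_at_continuous _ _ (iter_C1 T n x HT) D). apply HD. exact Dn. }
    revert O. apply filter_imp. intros u Du. symmetry. apply F. exact Du.
  - apply (C1_at_comp (fun v => Nat.iter n Si v) (fun u => h1 (Nat.iter n T u))).
    + apply (C1_at_comp h1 (fun u => Nat.iter n T u)); [apply iter_C1; exact HT|apply Hh; exact Dn].
    + apply iter_C1. exact HSi.
Qed.

(** The local map and its inverse are extended separately; the extensions remain mutually inverse
    because iterating forward [n] times reduces the question to [D] and [E]. The condition that
    [E (S (h1 x))] implies [D (T x)] supplies the local conjugacy relation for [k1]. *)
Lemma extend_conjugacy (T Ti S Si h1 k1 : R -> R) (D E : R -> Prop) :
  open D -> open E -> diffeo T Ti -> diffeo S Si ->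
  (forall x, D x -> E (h1 x) /\ k1 (h1 x) = x) ->
  (forall y, E y -> D (k1 y) /\ h1 (k1 y) = y) ->
  (forall x, D x -> C1_at h1 x) -> (forall y, E y -> C1_at k1 y) ->
  (forall x, D x -> D (T x) -> h1 (T x) = S (h1 x)) ->
  (forall x, D x -> E (S (h1 x)) -> D (T x)) ->
  (forall x n, D x -> D (Nat.iter (Datatypes.S n) T x) -> D (T x)) ->
  (forall y n, E y -> E (Nat.iter (Datatypes.S n) S y) -> E (S y)) ->
  exists h k : R -> R,
    (forall x, D x -> h x = h1 x) /\ (forall y, E y -> k y = k1 y) /\
    (forall x, hits T D x -> hits S E (h x) /\ k (h x) = x /\ C1_at h x) /\
    (forall y, hits S E y -> hits T D (k y) /\ h (k y) = y /\ C1_at k y) /\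
    (forall x, hits T D (T x) -> h (T x) = S (h x)).
Proof.
  intros OD OE DT DS Hhk Hkh Hh Hk Hc Hc' BD BE.
  destruct (extend_along_orbits T S Si h1 D) as (h & F & Ch); auto.
  { apply (diffeo_C1 DT). } { apply (diffeo_C1' DS). } { apply (diffeo_kh DS). }
  destruct (extend_along_orbits S T Ti k1 E) as (k & G & Ck); auto.
  { apply (diffeo_C1 DS). } { apply (diffeo_C1' DT). } { apply (diffeo_kh DT). }
  { intros y Ey ES. destruct (Hkh y Ey) as [D1 E1].
    assert (D2 : D (T (k1 y))) by (apply Hc'; [exact D1|rewrite E1; exact ES]).
    rewrite <- (proj2 (Hhk _ D2)). f_equal. rewrite Hc by assumption. now rewrite E1. }
  exists h, k. split; [|split; [|split; [|split]]].
  - intros x Dx. exact (F x 0%nat Dx).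
  - intros y Ey. exact (G y 0%nat Ey).
  - intros x [n Dn].
    assert (E1 : Nat.iter n S (h x) = h1 (Nat.iter n T x)).
    { rewrite (F x n Dn). apply (iter_cancel Si S). apply (diffeo_hk DS). }
    destruct (Hhk _ Dn) as [E2 E3].
    split; [exists n; rewrite E1; exact E2|]. split.
    + rewrite (G (h x) n) by (rewrite E1; exact E2). rewrite E1, E3.
      apply (iter_cancel T Ti). apply (diffeo_kh DT).
    + apply Ch. exists n. exact Dn.
  - intros y [n En].
    assert (E1 : Nat.iter n T (k y) = k1 (Nat.iter n S y)).
    { rewrite (G y n En). apply (iter_cancel Ti T). apply (diffeo_hk DT). }
    destruct (Hkh _ En) as [E2 E3].
    split; [exists n; rewrite E1; exact E2|]. split.
    + rewrite (F (k y) n) by (rewrite E1; exact E2). rewrite E1, E3.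
      apply (iter_cancel S Si). apply (diffeo_kh DS).
    + apply Ck. exists n. exact En.
  - intros x [n Dn]. rewrite (F (T x) n Dn).
    rewrite (F x (Datatypes.S n)) by (rewrite Nat.iter_succ_r; exact Dn).
    rewrite (Nat.iter_succ_r n _ T). simpl. now rewrite (diffeo_hk DS).
Qed.

(** The starting data live on the open interval from [T b] to [Ti b], which consists of two adjacent
    fundamental domains, so that the delicate point [b] is interior. The right half of the map is
    the left half pulled back once. *)
Lemma glue_fundamental_domain (T Ti S Si hA kA : R -> R) (b b' : R) :
  diffeo T Ti -> diffeo S Si -> diffeo hA kA ->
  increasing_fun T -> increasing_fun S -> increasing_fun hA ->
  S b' < b' -> hA b = b' -> hA (T b) = S b' ->
  forall x, T b < x < Ti b ->
    S b' < glue b hA (fun x => Si (hA (T x))) x < Si b' /\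
    glue b' kA (fun y => Ti (kA (S y))) (glue b hA (fun x => Si (hA (T x))) x) = x.
Proof.
  intros DT DS DA IT IS IA HS Hb HTb x Hx.
  pose proof (diffeo_increasing_inv _ _ DS IS) as ISi.
  assert (HSb : forall u, T u < b -> hA (T u) < b') by (intros; rewrite <- Hb; apply IA; assumption).
  assert (IB : forall u v, u < v -> Si (hA (T u)) < Si (hA (T v))) by (intros; apply ISi, IA, IT; assumption).
  assert (Bb : Si (hA (T b)) = b') by (rewrite HTb; apply (diffeo_kh DS)).
  assert (TTi : T (Ti b) = b) by apply (diffeo_hk DT).
  destruct (Rle_lt_dec x b) as [L | L].
  - rewrite (glue_le b) by exact L.
    pose proof (IA _ _ (proj1 Hx)) as A1. pose proof (increasing_le hA _ _ IA L) as A2.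
    rewrite HTb in A1. rewrite Hb in A2.
    rewrite glue_le by exact A2. split; [|apply (diffeo_kh DA)]. split; [exact A1|].
    apply Rle_lt_trans with (1 := A2). rewrite <- (diffeo_kh DS b') at 1. apply ISi, HS.
  - rewrite (glue_gt b hA) by exact L. pose proof (IB _ _ L) as A1. rewrite Bb in A1.
    pose proof (IT _ _ (proj2 Hx)) as A2. rewrite TTi in A2.
    rewrite glue_gt by exact A1. rewrite (diffeo_hk DS), (diffeo_kh DA), (diffeo_kh DT).
    split; [|reflexivity]. split; [lra|apply ISi, HSb, A2].
Qed.

(* [T] moves [b] to the left, and the interval [(T b, b]] is a fundamental
   domain; matching the derivatives at its endpoints is what makes the
   extension differentiable at [b] and at its preimages. *)
Lemma extend_leftward (T Ti S Si hA kA : R -> R) (b b' : R) :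
  diffeo T Ti -> diffeo S Si -> diffeo hA kA ->
  increasing_fun T -> increasing_fun S -> increasing_fun hA ->
  T b < b -> S b' < b' -> hA b = b' -> hA (T b) = S b' ->
  Derive hA b = Derive (fun x => Si (hA (T x))) b ->
  exists h k : R -> R,
    (forall x, x <= b -> h x = hA x) /\
    (forall y, y <= b' -> k y = kA y) /\
    (forall x, hits T (fun u => u <= b) x ->
       hits S (fun v => v <= b') (h x) /\ k (h x) = x /\ C1_at h x) /\
    (forall y, hits S (fun v => v <= b') y ->
       hits T (fun u => u <= b) (k y) /\ h (k y) = y /\ C1_at k y) /\
    (forall x, hits T (fun u => u <= b) x -> b <= x -> h (T x) = S (h x)) /\
    (forall x y, hits T (fun u => u <= b) y -> x < y -> h x < h y).
Proof.
  intros DT DS DA IT IS IA HT HS Hb HTb HD.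
  pose proof (diffeo_increasing_inv _ _ DA IA) as IkA.
  assert (Hb' : kA b' = b) by (rewrite <- Hb; apply (diffeo_kh DA)).
  assert (HTb' : kA (S b') = T b) by (rewrite <- HTb; apply (diffeo_kh DA)).
  assert (DB : diffeo (fun x => Si (hA (T x))) (fun y => Ti (kA (S y)))).
  { split; intros.
    - now rewrite (diffeo_hk DS), (diffeo_kh DA), (diffeo_kh DT).
    - now rewrite (diffeo_hk DT), (diffeo_hk DA), (diffeo_kh DS).
    - apply (C1_at_comp Si (fun u => hA (T u))); [|apply (diffeo_C1' DS)].
      apply C1_at_comp; [apply (diffeo_C1 DT)|apply (diffeo_C1 DA)].
    - apply (C1_at_comp Ti (fun u => kA (S u))); [|apply (diffeo_C1' DT)].
      apply C1_at_comp; [apply (diffeo_C1 DS)|apply (diffeo_C1' DA)]. }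
  assert (Bb : Si (hA (T b)) = b') by (rewrite HTb; apply (diffeo_kh DS)).
  assert (Bb' : Ti (kA (S b')) = b) by (rewrite HTb'; apply (diffeo_kh DT)).
  set (h1 := glue b hA (fun x => Si (hA (T x)))).
  set (k1 := glue b' kA (fun y => Ti (kA (S y)))).
  assert (h1le : forall x, x <= b -> h1 x = hA x) by (intros; apply glue_le; assumption).
  assert (h1ge : forall x, b <= x -> h1 x = Si (hA (T x))).
  { intros x L. apply (glue_ge b hA (fun x => Si (hA (T x)))); [congruence|exact L]. }
  assert (k1le : forall y, y <= b' -> k1 y = kA y) by (intros; apply glue_le; assumption).
  assert (Ch1 : forall x, C1_at h1 x).
  { intros x. apply C1_at_glue.
    - intros _. apply (diffeo_C1 DA).
    - intros _. apply (diffeo_C1 DB).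
    - congruence.
    - intros _. exact HD. }
  assert (Ck1 : forall y, C1_at k1 y).
  { intros y. apply C1_at_glue.
    - intros _. apply (diffeo_C1' DA).
    - intros _. apply (diffeo_C1' DB).
    - congruence.
    - intros _. pose proof (diffeo_Derive_inv _ _ b DA) as Q1.
      pose proof (diffeo_Derive_inv _ _ b DB) as Q2. cbv beta in Q2. rewrite Bb in Q2. rewrite Hb in Q1.
      rewrite <- HD in Q2. apply (Rmult_eq_reg_l (Derive hA b)); [congruence|].
      intros Z. rewrite Z in Q1. lra. }
  assert (HTi : forall x, x < Ti b -> T x < b).
  { intros x L. rewrite <- (diffeo_hk DT b). apply IT. exact L. }
  assert (HTi' : b < Ti b) by (apply (increasing_lt_inv T _ _ IT); rewrite (diffeo_hk DT); exact HT).
  assert (HSi' : b' < Si b') by (apply (increasing_lt_inv S _ _ IS); rewrite (diffeo_hk DS); exact HS).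
  (* Once an orbit is at or below [b], all later iterates are at or below [T b], outside the
     interval; so a point with a later visit lies strictly to the right of [b], and its image is
     still in the interval. *)
  assert (Bet : forall T Ti b, diffeo T Ti -> increasing_fun T -> T b < b -> forall x n,
    T b < x < Ti b -> T b < Nat.iter (Datatypes.S n) T x < Ti b -> T b < T x < Ti b).
  { clear. intros T Ti b DT IT HT x n Hx Hn.
    assert (HTi : T x < b) by (rewrite <- (diffeo_hk DT b); apply IT; lra).
    assert (HTi' : b < Ti b) by (apply (increasing_lt_inv T _ _ IT); rewrite (diffeo_hk DT); exact HT).
    split; [|lra]. apply IT. apply Rnot_le_lt. intros L.
    assert (It : forall n, Nat.iter n T x <= b).
    { intros i. induction i as [|i IH]; [exact L|].
      simpl. apply (increasing_le T _ _ IT) in IH. lra. }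
    specialize (It n). apply (increasing_le T _ _ IT) in It. simpl in Hn. lra. }
  destruct (extend_conjugacy T Ti S Si h1 k1 (fun x => T b < x < Ti b) (fun y => S b' < y < Si b'))
    as (h & k & Fh & Fk & Gh & Gk & Gc); auto.
  { apply open_and; [apply open_gt|apply open_lt]. }
  { apply open_and; [apply open_gt|apply open_lt]. }
  { apply glue_fundamental_domain; assumption. }
  { apply glue_fundamental_domain; try assumption. apply diffeo_sym; assumption. }
  { intros x Hx HTx. assert (b < x) by (apply (increasing_lt_inv T _ _ IT); lra).
    rewrite (h1ge x) by lra. rewrite (diffeo_hk DS). apply h1le.
    specialize (HTi x (proj2 Hx)). lra. }
  { intros x Hx HSx. split; [|specialize (HTi x (proj2 Hx)); lra].
    apply IT. apply Rnot_le_lt. intros L. rewrite h1le in HSx by exact L.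
    pose proof (increasing_le hA _ _ IA L). rewrite Hb in H.
    pose proof (increasing_le S _ _ IS H). lra. }
  { apply (Bet T Ti b); assumption. }
  { apply (Bet S Si b'); assumption. }
  (* An orbit descending from the right of [b] cannot jump over the interval: while a point is above
     [b], its image is above [T b]. *)
  assert (Hit : forall T Ti b, diffeo T Ti -> increasing_fun T -> T b < b -> forall x,
    T b < x -> hits T (fun u => u <= b) x -> hits T (fun u => T b < u < Ti b) x).
  { clear. intros T Ti b DT IT HT.
    assert (HTi' : b < Ti b) by (apply (increasing_lt_inv T _ _ IT); rewrite (diffeo_hk DT); exact HT).
    intros x Hx [n Hn]. revert x Hx Hn. induction n as [|n IH]; intros x Hx Hn.
    - simpl in Hn. exists 0%nat. simpl. lra.
    - destruct (Rle_lt_dec x b) as [L | L]; [exists 0%nat; simpl; lra|].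
      rewrite Nat.iter_succ_r in Hn. destruct (IH (T x) (IT _ _ L) Hn) as [j Hj].
      exists (Datatypes.S j). rewrite Nat.iter_succ_r. exact Hj. }
  (* At or below [T b] orbits never enter the fundamental interval and [h] carries no information,
     so [hA] itself is used up to [b]. The two descriptions agree between [T b] and [b]. *)
  set (hf := glue b hA h). set (kf := glue b' kA k).
  assert (hfle : forall x, x <= b -> hf x = hA x) by (intros; apply glue_le; assumption).
  assert (hfgt : forall x, T b < x -> hf x = h x).
  { intros x L. destruct (Rle_lt_dec x b) as [L1 | L1]; [|apply glue_gt; exact L1].
    rewrite hfle, (Fh x), h1le by lra. reflexivity. }
  assert (kfle : forall y, y <= b' -> kf y = kA y) by (intros; apply glue_le; assumption).
  assert (kfgt : forall y, S b' < y -> kf y = k y).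
  { intros x L. destruct (Rle_lt_dec x b') as [L1 | L1]; [|apply glue_gt; exact L1].
    rewrite kfle, (Fk x), k1le by lra. reflexivity. }
  assert (above : forall T Ti S Si h k hA kA b b', diffeo T Ti -> increasing_fun T -> T b < b ->
    increasing_fun S -> S b' < b' -> increasing_fun kA -> kA b' = b ->
    (forall x, hits T (fun x => T b < x < Ti b) x ->
      hits S (fun y => S b' < y < Si b') (h x) /\ k (h x) = x /\ C1_at h x) ->
    (forall y, S b' < y < Si b' -> k y = glue b' kA hA y) -> b' < Si b' ->
    forall x, hits T (fun u => u <= b) x -> b < x -> b' < h x).
  { clear - Hit. intros T Ti S Si h k hA kA b b' DT IT HT IS HS IkA Hb' G Fk HSi x Hx L.
    apply Rnot_le_lt. intros N.
    destruct (G x) as (A1 & A2 & A3); [apply Hit; auto; lra|].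
    assert (Q : S b' < h x).
    { destruct A1 as [n A1]. apply Rnot_le_lt. intros M.
      assert (It : forall i, Nat.iter i S (h x) <= S b').
      { intros i. induction i as [|i IH]; [exact M|]. simpl. apply (increasing_le S); [exact IS|lra]. }
      specialize (It n). lra. }
    rewrite Fk, glue_le in A2 by lra.
    pose proof (increasing_le kA _ _ IkA N). lra. }
  assert (kgt : forall x, hits T (fun u => u <= b) x -> b < x -> b' < h x)
    by (apply (above T Ti S Si h k (fun y => Ti (kA (S y))) kA); assumption).
  assert (hgt : forall y, hits S (fun u => u <= b') y -> b' < y -> b < k y)
    by (apply (above S Si T Ti k h (fun x => Si (hA (T x))) hA); assumption).
  assert (hits_D : forall T Ti b x, diffeo T Ti -> increasing_fun T -> T b < b ->
    hits T (fun u => T b < u < Ti b) x -> hits T (fun u => u <= b) x).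
  { clear. intros T Ti b x DT IT HT [n Hn]. exists (Datatypes.S n). simpl. left.
    rewrite <- (diffeo_hk DT b). apply IT. lra. }
  assert (Cf : forall x, hits T (fun u => u <= b) x -> b <= x -> hf (T x) = S (hf x)).
  { intros x Hx [L | <-].
    - pose proof (IT _ _ L). rewrite !hfgt by lra. apply Gc.
      destruct (Hit T Ti b DT IT HT x) as [n Hn]; [lra|exact Hx|].
      destruct n as [|n].
      + simpl in Hn. exists 0%nat. simpl. specialize (HTi x (proj2 Hn)). lra.
      + exists n. rewrite Nat.iter_succ_r in Hn. exact Hn.
    - rewrite !hfle by lra. congruence. }
  exists hf, kf. split; [|split; [|split; [|split; [|split]]]].
  - exact hfle.
  - exact kfle.
  - intros x Hx. destruct (Rle_lt_dec x b) as [L | L].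
    + rewrite hfle by exact L.
      assert (hA x <= b') by (rewrite <- Hb; apply increasing_le; assumption).
      split; [exists 0%nat; exact H|]. split.
      * rewrite kfle by assumption. apply (diffeo_kh DA).
      * destruct L as [L | ->].
        -- apply (C1_at_ext_loc hA); [|apply (diffeo_C1 DA)].
           generalize (locally_lt x b L). apply filter_imp. intros u Hu. symmetry. apply hfle. lra.
        -- apply (C1_at_ext_loc h1); [|apply Ch1].
           generalize (filter_and _ _ (locally_gt b _ HT) (locally_lt b _ HTi')). apply filter_imp.
           intros u Hu. rewrite hfgt by lra. symmetry. apply Fh. lra.
    + destruct (Gh x) as (A1 & A2 & A3); [apply Hit; auto; lra|].
      rewrite hfgt by lra. pose proof (kgt x Hx L). split; [|split].
      * apply (hits_D S Si b'); assumption.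
      * rewrite kfgt by lra. exact A2.
      * apply (C1_at_ext_loc h); [|exact A3].
        generalize (locally_gt x b L). apply filter_imp. intros u Hu. symmetry. apply hfgt. lra.
  - intros x Hx. destruct (Rle_lt_dec x b') as [L | L].
    + rewrite kfle by exact L.
      assert (kA x <= b) by (rewrite <- Hb'; apply increasing_le; assumption).
      split; [exists 0%nat; exact H|]. split.
      * rewrite hfle by assumption. apply (diffeo_hk DA).
      * destruct L as [L | ->].
        -- apply (C1_at_ext_loc kA); [|apply (diffeo_C1' DA)].
           generalize (locally_lt x b' L). apply filter_imp. intros u Hu. symmetry. apply kfle. lra.
        -- apply (C1_at_ext_loc k1); [|apply Ck1].
           generalize (filter_and _ _ (locally_gt b' _ HS) (locally_lt b' _ HSi')). apply filter_imp.
           intros u Hu. rewrite kfgt by lra. symmetry. apply Fk. lra.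
    + destruct (Gk x) as (A1 & A2 & A3); [apply Hit; auto; lra|].
      rewrite kfgt by lra. pose proof (hgt x Hx L). split; [|split].
      * apply (hits_D T Ti b); assumption.
      * rewrite hfgt by lra. exact A2.
      * apply (C1_at_ext_loc k); [|exact A3].
        generalize (locally_gt x b' L). apply filter_imp. intros u Hu. symmetry. apply kfgt. lra.
  - exact Cf.
  (* Induction on the number of steps of the larger point: to the right of [b] the order of the
     images is known one step later and is pulled back by monotonicity of [S]. *)
  - intros x y [n Hn]. revert x y Hn.
    induction n as [|n IH]; intros x y Hn L.
    + simpl in Hn. rewrite !hfle by lra. apply IA. exact L.
    + assert (Hy : hits T (fun u => u <= b) y) by (exists (Datatypes.S n); exact Hn).
      destruct (Rle_lt_dec y b) as [Ly | Ly]; [rewrite !hfle by lra; apply IA; exact L|].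
      destruct (Rle_lt_dec x b) as [Lx | Lx].
      * rewrite hfle, (hfgt y) by lra. pose proof (kgt y Hy Ly).
        pose proof (increasing_le hA _ _ IA Lx). lra.
      * rewrite Nat.iter_succ_r in Hn. specialize (IH (T x) (T y) Hn (IT _ _ L)).
        assert (Hx : hits T (fun u => u <= b) x).
        { exists (Datatypes.S n). rewrite Nat.iter_succ_r.
          assert (It : forall i u v, u <= v -> Nat.iter i T u <= Nat.iter i T v).
          { clear - IT. intros i u v Huv. induction i as [|i IHi]; [exact Huv|].
            simpl. apply (increasing_le T); assumption. }
          specialize (It n (T x) (T y)). pose proof (IT _ _ L). lra. }
        rewrite (Cf x Hx), (Cf y Hy) in IH by lra. apply (increasing_lt_inv S _ _ IS). exact IH.
Qed.

(** * Reflection in the origin and extension in the opposite direction *)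

Lemma iter_reflect (T : R -> R) (n : nat) (x : R) :
  Nat.iter n (fun u => - T (- u)) x = - Nat.iter n T (- x).
Proof.
  induction n as [|n IH]; simpl; [ring|]. rewrite IH. now rewrite Ropp_involutive.
Qed.

Lemma diffeo_reflect (h k : R -> R) : diffeo h k -> diffeo (fun x => - h (- x)) (fun y => - k (- y)).
Proof.
  intros D. apply (diffeo_comp (fun x => - x) (fun x => - x) (fun x => h (- x)) (fun y => - k y)).
  - apply diffeo_opp.
  - apply (diffeo_comp h k (fun x => - x) (fun x => - x)); [exact D|apply diffeo_opp].
Qed.

Lemma increasing_reflect (h : R -> R) : increasing_fun h -> increasing_fun (fun x => - h (- x)).
Proof. intros H x y L. apply Ropp_lt_contravar, H. lra. Qed.

Lemma C1_at_reflect (h : R -> R) (x : R) : C1_at h (- x) -> C1_at (fun u => - h (- u)) x.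
Proof.
  intros H. apply C1_at_opp. apply (C1_at_comp h (fun u => - u)); [|exact H].
  apply C1_at_opp, C1_at_id.
Qed.

Lemma Derive_reflect (h : R -> R) (x : R) :
  C1_at h (- x) -> Derive (fun u => - h (- u)) x = Derive h (- x).
Proof.
  intros H. apply is_derive_unique.
  replace (Derive h (- x)) with (- scal (- 1) (Derive h (- x))) by (unfold scal; simpl; unfold mult; simpl; ring).
  apply (is_derive_opp (V := R_NormedModule) (fun u => h (- u))).
  apply (is_derive_comp (V := R_NormedModule) h (fun u => - u)).
  - apply C1_at_is_derive. exact H.
  - apply (is_derive_opp (V := R_NormedModule) (fun u => u)). apply (is_derive_id (K := R_AbsRing)).
Qed.

(** Conjugating every map by [x |-> - x] turns motion to the right into motion to the left and
    leaves derivatives unchanged at reflected points, so the leftward case applies. *)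
Lemma extend_rightward (T Ti S Si hA kA : R -> R) (b b' : R) :
  diffeo T Ti -> diffeo S Si -> diffeo hA kA ->
  increasing_fun T -> increasing_fun S -> increasing_fun hA ->
  b < T b -> b' < S b' -> hA b = b' -> hA (T b) = S b' ->
  Derive hA b = Derive (fun x => Si (hA (T x))) b ->
  exists h k : R -> R,
    (forall x, b <= x -> h x = hA x) /\
    (forall y, b' <= y -> k y = kA y) /\
    (forall x, hits T (fun u => b <= u) x ->
       hits S (fun v => b' <= v) (h x) /\ k (h x) = x /\ C1_at h x) /\
    (forall y, hits S (fun v => b' <= v) y ->
       hits T (fun u => b <= u) (k y) /\ h (k y) = y /\ C1_at k y) /\
    (forall x, hits T (fun u => b <= u) x -> x <= b -> h (T x) = S (h x)).
Proof.
  intros DT DS DA IT IS IA HT HS Hb HTb HD.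
  destruct (extend_leftward (fun x => - T (- x)) (fun x => - Ti (- x)) (fun x => - S (- x))
    (fun x => - Si (- x)) (fun x => - hA (- x)) (fun x => - kA (- x)) (- b) (- b'))
    as (h & k & Q1 & Q2 & Q3 & Q4 & Q5 & _).
  1-3: apply diffeo_reflect; assumption.
  1-3: apply increasing_reflect; assumption.
  { rewrite Ropp_involutive. lra. }
  { rewrite Ropp_involutive. lra. }
  { rewrite Ropp_involutive. lra. }
  { rewrite !Ropp_involutive. lra. }
  { rewrite (Derive_ext (fun x => - Si (- - hA (- - T (- x)))) (fun x => - Si (hA (T (- x)))))
      by (intros; now rewrite !Ropp_involutive).
    rewrite Derive_reflect by apply (diffeo_C1 DA).
    rewrite (Derive_reflect (fun x => Si (hA (T x)))).
    - now rewrite !Ropp_involutive.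
    - apply (C1_at_comp Si (fun u => hA (T u))); [|apply (diffeo_C1' DS)].
      apply C1_at_comp; [apply (diffeo_C1 DT)|apply (diffeo_C1 DA)]. }
  assert (hr : forall T b x, hits T (fun u => b <= u) x -> hits (fun u => - T (- u)) (fun u => u <= - b) (- x)).
  { clear. intros T b x [n Hn]. exists n. rewrite iter_reflect, Ropp_involutive. lra. }
  assert (hr' : forall T b x, hits (fun u => - T (- u)) (fun u => u <= - b) x -> hits T (fun u => b <= u) (- x)).
  { clear. intros T b x [n Hn]. exists n. rewrite iter_reflect in Hn. lra. }
  exists (fun x => - h (- x)), (fun y => - k (- y)). split; [|split; [|split; [|split]]].
  - intros x L. rewrite Q1 by lra. now rewrite !Ropp_involutive.
  - intros x L. rewrite Q2 by lra. now rewrite !Ropp_involutive.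
  - intros x Hx. destruct (Q3 (- x) (hr _ _ _ Hx)) as (A1 & A2 & A3). split; [|split].
    + apply hr'. exact A1.
    + rewrite Ropp_involutive, A2. ring.
    + apply C1_at_reflect. exact A3.
  - intros x Hx. destruct (Q4 (- x) (hr _ _ _ Hx)) as (A1 & A2 & A3). split; [|split].
    + apply hr'. exact A1.
    + rewrite Ropp_involutive, A2. ring.
    + apply C1_at_reflect. exact A3.
  - intros x Hx L. specialize (Q5 (- x) (hr _ _ _ Hx)).
    rewrite Ropp_involutive in Q5. rewrite Q5 by lra. ring.
Qed.

(** * Conjugacies of piecewise maps with diffeomorphic branches *)

(** A two-sided derivative is determined by the values on one side. The sign of [s] selects that
    side, positive for the right; the lemma compares maps that coincide only on a half-line, at its
    endpoint included. *)
Lemma Derive_eq_one_sided (f g : R -> R) (s b : R) :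
  s <> 0 -> ex_derive f b -> ex_derive g b ->
  (forall x, 0 <= s * (x - b) -> f x = g x) -> Derive f b = Derive g b.
Proof.
  intros Hs [lf Hf] [lg Hg] H.
  rewrite (is_derive_unique _ _ _ Hf), (is_derive_unique _ _ _ Hg).
  destruct (Req_dec lf lg) as [E | N]; [exact E|exfalso].
  set (e := Rabs (lf - lg) / 3).
  assert (He : 0 < Rabs (lf - lg)) by (apply Rabs_pos_lt; lra).
  assert (He' : 0 < e) by (unfold e; lra).
  destruct (filter_and _ _ (proj1 (is_derive_eps _ _ _) Hf e He') (proj1 (is_derive_eps _ _ _) Hg e He'))
    as [d Hd].
  pose proof (cond_pos d) as Hdp. pose proof (Rabs_pos_lt s Hs) as Hsp.
  set (u := b + s * (d / (2 * Rabs s))).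
  assert (Hu : Rabs (u - b) = d / 2).
  { unfold u. replace (b + s * (d / (2 * Rabs s)) - b) with (s * (d / (2 * Rabs s))) by ring.
    rewrite Rabs_mult, (Rabs_pos_eq (d / _)) by (left; apply Rdiv_lt_0_compat; lra).
    field. lra. }
  destruct (Hd u) as [A B]; [change (Rabs (u - b) < d); rewrite Hu; lra|].
  assert (E1 : f u = g u).
  { apply H. unfold u. replace (s * (b + s * (d / (2 * Rabs s)) - b)) with (s * s * (d / (2 * Rabs s))) by ring.
    apply Rmult_le_pos; [nra|]. left. apply Rdiv_lt_0_compat; lra. }
  assert (E2 : f b = g b) by (apply H; rewrite Rminus_diag; lra).
  rewrite E1, E2 in A. rewrite Hu in A, B.
  assert (C : Rabs ((lf - lg) * (u - b)) <= 2 * e * (d / 2)).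
  { replace ((lf - lg) * (u - b)) with ((g u - g b - lg * (u - b)) - (g u - g b - lf * (u - b))) by ring.
    eapply Rle_trans; [apply Rabs_triang|]. rewrite Rabs_Ropp. lra. }
  rewrite Rabs_mult, Hu in C. unfold e in C. nra.
Qed.

Lemma C1_at_ex_derive (h : R -> R) (x : R) : C1_at h x -> ex_derive h x.
Proof. intros H. exists (Derive h x). apply C1_at_is_derive. exact H. Qed.

Lemma C1_at_Derive_comp (g h : R -> R) (x : R) :
  C1_at h x -> C1_at g (h x) -> Derive (fun u => g (h u)) x = Derive h x * Derive g (h x).
Proof. intros Hh Hg. apply Derive_comp; apply C1_at_ex_derive; assumption. Qed.

Lemma diffeo_Derive_neq_0 (h k : R -> R) (x : R) : diffeo h k -> Derive h x <> 0.
Proof. intros D E. pose proof (diffeo_Derive_inv _ _ x D). rewrite E in H. lra. Qed.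

Lemma diffeo_Derive_inv_eq (h k : R -> R) (x : R) : diffeo h k -> Derive k (h x) = / Derive h x.
Proof.
  intros D. pose proof (diffeo_Derive_inv _ _ x D). pose proof (diffeo_Derive_neq_0 _ _ x D).
  apply (Rmult_eq_reg_l (Derive h x)); [|assumption]. rewrite H. field. assumption.
Qed.

Lemma diffeo_glue (hA kA hB kB : R -> R) :
  diffeo hA kA -> diffeo hB kB -> increasing_fun hA -> increasing_fun hB ->
  hA 0 = 0 -> hB 0 = 0 -> Derive hA 0 = Derive hB 0 ->
  diffeo (glue 0 hA hB) (glue 0 kA kB) /\ increasing_fun (glue 0 hA hB).
Proof.
  intros DA DB IA IB A0 B0 E.
  assert (kA0 : kA 0 = 0) by (rewrite <- A0 at 1; apply (diffeo_kh DA)).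
  assert (kB0 : kB 0 = 0) by (rewrite <- B0 at 1; apply (diffeo_kh DB)).
  pose proof (diffeo_increasing_inv _ _ DA IA) as IkA. pose proof (diffeo_increasing_inv _ _ DB IB) as IkB.
  split; [split|].
  - intros x. destruct (Rle_lt_dec x 0) as [L | L].
    + pose proof (increasing_le hA _ _ IA L). rewrite (glue_le 0 hA), glue_le by lra. apply (diffeo_kh DA).
    + pose proof (IB _ _ L). rewrite (glue_gt 0 hA), glue_gt by lra. apply (diffeo_kh DB).
  - intros x. destruct (Rle_lt_dec x 0) as [L | L].
    + pose proof (increasing_le kA _ _ IkA L). rewrite (glue_le 0 kA), glue_le by lra. apply (diffeo_hk DA).
    + pose proof (IkB _ _ L). rewrite (glue_gt 0 kA), glue_gt by lra. apply (diffeo_hk DB).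
  - intros x. apply C1_at_glue; intros; auto; [apply (diffeo_C1 DA)|apply (diffeo_C1 DB)|congruence].
  - intros x. apply C1_at_glue; intros; [apply (diffeo_C1' DA)|apply (diffeo_C1' DB)|congruence|].
    pose proof (diffeo_Derive_inv_eq _ _ 0 DA) as E1. pose proof (diffeo_Derive_inv_eq _ _ 0 DB) as E2.
    rewrite A0 in E1. rewrite B0 in E2. congruence.
  - intros x y L. destruct (Rle_lt_dec y 0) as [L1 | L1].
    + rewrite !glue_le by lra. apply IA, L.
    + pose proof (IB _ _ L1). destruct (Rle_lt_dec x 0) as [L2 | L2].
      * pose proof (increasing_le hA _ _ IA L2). rewrite glue_le, glue_gt by lra. lra.
      * rewrite !glue_gt by lra. apply IB, L.
Qed.

(** A working form of [diff_conjugate] that exposes the conjugacy and its inverse, so that their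
    values are still available when the domains are cut down to bounded intervals. *)
Definition conj_on (F : R -> R) (U : R -> Prop) (G : R -> R) (V : R -> Prop) (h k : R -> R) : Prop :=
  (forall x, U x -> V (h x) /\ k (h x) = x /\ C1_at h x) /\
  (forall y, V y -> U (k y) /\ h (k y) = y /\ C1_at k y) /\
  (forall x, U x -> U (F x) -> h (F x) = G (h x)).

Lemma iter_conj (h T S : R -> R) (n : nat) (x : R) :
  (forall u, h (T u) = S (h u)) -> h (Nat.iter n T x) = Nat.iter n S (h x).
Proof. intros H. induction n as [|n IH]; simpl; [reflexivity|]. now rewrite H, IH. Qed.

Lemma expansion_hits (T : R -> R) (lo xs b x : R) :
  increasing_fun T -> 1 < lo -> (forall u v, lo * Rabs (u - v) <= Rabs (T u - T v)) ->
  T xs = xs -> xs < x -> hits T (fun u => b <= u) x.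
Proof.
  intros I Hlo H Hx L.
  assert (A : forall n, xs < Nat.iter n T x /\ lo ^ n * (x - xs) <= Nat.iter n T x - xs).
  { intros n. induction n as [|n [IH1 IH2]]; simpl; [lra|].
    assert (xs < T (Nat.iter n T x)) by (rewrite <- Hx at 1; apply I; exact IH1).
    split; [assumption|]. specialize (H (Nat.iter n T x) xs). rewrite Hx in H.
    rewrite !Rabs_pos_eq in H by lra. nra. }
  destruct (pow_small (/ lo) ((x - xs) / (1 + Rabs (b - xs)))) as [n Hn].
  - split; [left; apply Rinv_0_lt_compat; lra|]. rewrite <- Rinv_1. apply Rinv_lt_contravar; lra.
  - apply Rdiv_lt_0_compat; [lra|]. pose proof (Rabs_pos (b - xs)). lra.
  - exists n. destruct (A n) as [_ A2]. rewrite pow_inv in Hn.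
    pose proof (Rle_abs (b - xs)). pose proof (Rabs_pos (b - xs)).
    assert (P : 0 < lo ^ n) by (apply pow_lt; lra).
    apply (Rmult_lt_compat_r (lo ^ n * (1 + Rabs (b - xs)))) in Hn; [|nra].
    replace (/ lo ^ n * (lo ^ n * (1 + Rabs (b - xs)))) with (1 + Rabs (b - xs)) in Hn by (field; lra).
    replace ((x - xs) / (1 + Rabs (b - xs)) * (lo ^ n * (1 + Rabs (b - xs)))) with (lo ^ n * (x - xs)) in Hn by (field; lra).
    lra.
Qed.

Lemma contraction_hits (T : R -> R) (k xs b x : R) :
  0 <= k < 1 -> (forall u v, Rabs (T u - T v) <= k * Rabs (u - v)) ->
  T xs = xs -> xs < b -> hits T (fun u => u <= b) x.
Proof.
  intros Hk H Hx L. pose proof (Rabs_pos (x - xs)).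
  destruct (pow_small k ((b - xs) / (1 + Rabs (x - xs))) Hk) as [n Hn].
  - apply Rdiv_lt_0_compat; lra.
  - exists n. pose proof (iter_lipschitz T k n x xs (proj1 Hk) H) as A.
    rewrite (iter_fix T n xs Hx) in A.
    apply (Rmult_lt_compat_r (1 + Rabs (x - xs))) in Hn; [|lra].
    replace ((b - xs) / (1 + Rabs (x - xs)) * (1 + Rabs (x - xs))) with (b - xs) in Hn by (field; lra).
    assert (0 <= k ^ n) by (apply pow_le; lra).
    pose proof (Rle_abs (Nat.iter n T x - xs)). nra.
Qed.

(** Applying [T] as many times as [Ti] was applied returns to [x], so the distance of the backward
    iterate from [xs] is at least [k ^ - n] times that of [x]. *)
Lemma contraction_inverse_hits (T Ti : R -> R) (k xs b x : R) :
  increasing_fun T -> diffeo T Ti ->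
  0 <= k < 1 -> (forall u v, Rabs (T u - T v) <= k * Rabs (u - v)) ->
  T xs = xs -> x < xs -> hits Ti (fun u => u <= b) x.
Proof.
  intros I D Hk H Hx L. pose proof (Rabs_pos (xs - b)).
  pose proof (diffeo_increasing_inv _ _ D I) as Ii.
  assert (Hxi : Ti xs = xs) by (rewrite <- Hx at 1; apply (diffeo_kh D)).
  destruct (pow_small k ((xs - x) / (1 + Rabs (xs - b))) Hk) as [n Hn].
  - apply Rdiv_lt_0_compat; lra.
  - exists n. apply Rnot_lt_le. intros N.
    assert (L2 : Nat.iter n Ti x < xs).
    { clear - L Hxi Ii. induction n as [|n IH]; simpl; [exact L|]. rewrite <- Hxi. apply Ii. exact IH. }
    pose proof (iter_lipschitz T k n (Nat.iter n Ti x) xs (proj1 Hk) H) as A.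
    rewrite (iter_fix T n xs Hx), (iter_cancel Ti T) in A by apply (diffeo_hk D).
    rewrite !Rabs_left in A by lra.
    apply (Rmult_lt_compat_r (1 + Rabs (xs - b))) in Hn; [|lra].
    replace ((xs - x) / (1 + Rabs (xs - b)) * (1 + Rabs (xs - b))) with (xs - x) in Hn by (field; lra).
    assert (0 <= k ^ n) by (apply pow_le; lra).
    pose proof (Rle_abs (xs - b)). nra.
Qed.

Set Implicit Arguments.

(* [FL, FR] and [GL, y |-> nu + sR * y] are the branches of two piecewise maps,
   extended to diffeomorphisms of the whole line; [hL] and [hR] conjugate the
   extended left and right branches. *)
Record branches (p eta k lo nu sR xL xR yL yR : R) (FL FLi FR FRi GL GLi hL kL hR kR : R -> R) : Prop := {
  br_FL : diffeo FL FLi;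
  br_FL_inc : increasing_fun FL;
  br_GL : diffeo GL GLi;
  br_GL_inc : increasing_fun GL;
  br_FR : diffeo FR FRi;
  br_sR : sR <> 0;
  br_FL0 : FL 0 = nu;
  br_FR0 : FR 0 = nu;
  br_GL0 : GL 0 = nu;
  br_slope : Derive FL 0 * sR = Derive GL 0 * Derive FR 0;
  br_hL : diffeo hL kL;
  br_hL_inc : increasing_fun hL;
  br_hL0 : hL 0 = 0;
  br_hLx : hL xL = yL;
  br_hL_conj : forall x, hL (FL x) = GL (hL x);
  br_hR : diffeo hR kR;
  br_hR_inc : increasing_fun hR;
  br_hR0 : hR 0 = 0;
  br_hRx : hR xR = yR;
  br_hR_conj : forall x, hR (FR x) = nu + sR * hR x;
  br_lo : 1 < lo;
  br_expand : forall x y, lo * Rabs (x - y) <= Rabs (FL x - FL y);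
  br_fixL : FL xL = xL;
  br_k : 0 <= k < 1;
  br_contract : forall x y, Rabs (FR x - FR y) <= k * Rabs (x - y);
  br_fixR : FR xR = xR;
  br_hL_bound : forall x, Rabs x <= p -> exp (- eta) <= Derive hL x <= exp eta;
  br_hR_bound : forall x, Rabs x <= p -> exp (- eta) <= Derive hR x <= exp eta;
  br_FR_bound : forall x, Rabs x <= p -> Rabs (FR x) <= p;
  br_zero : nu = 0 -> Derive hL 0 = Derive hR 0 }.

Unset Implicit Arguments.

Section Branches.
Context (p eta k lo nu sR xL xR yL yR : R) (FL FLi FR FRi GL GLi hL kL hR kR : R -> R).
Context (B : branches p eta k lo nu sR xL xR yL yR FL FLi FR FRi GL GLi hL kL hR kR).

Let GR := fun y => nu + sR * y.
Let GRi := fun y => (y - nu) / sR.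
Let F := glue 0 FL FR.
Let G := glue 0 GL GR.

Let GR_diffeo : diffeo GR GRi.
Proof. apply diffeo_affine. exact (br_sR B). Qed.

Let Derive_GR (x : R) : Derive GR x = sR.
Proof. apply is_derive_unique. unfold GR. auto_derive; [exact I|ring]. Qed.

Let dFR := br_FR B.
Let FR0 := br_FR0 B.
Let dhL := br_hL B.
Let hL0 := br_hL0 B.
Let dhR := br_hR B.
Let IhL := br_hL_inc B.
Let FL0 := br_FL0 B.
Let hR0 := br_hR0 B.
Let IhR := br_hR_inc B.
Let IFL := br_FL_inc B.
Let hL_conj := br_hL_conj B.
Let hR_conj := br_hR_conj B.
Let CFL := diffeo_C1 (br_FL B).
Let CGL := diffeo_C1 (br_GL B).
Let CFR := diffeo_C1 dFR.
Let ChL := diffeo_C1 dhL.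
Let ChR := diffeo_C1 dhR.
Let CGR := diffeo_C1 GR_diffeo.
Let CGRi := diffeo_C1' GR_diffeo.

Let chain_GRi (h : R -> R) (x : R) : C1_at h x -> Derive (fun u => GRi (h u)) x = Derive h x / sR.
Proof.
  intros Ch. rewrite (C1_at_Derive_comp GRi h) by auto.
  rewrite <- (diffeo_hk GR_diffeo (h x)).
  rewrite (diffeo_Derive_inv_eq _ _ _ GR_diffeo), Derive_GR. reflexivity.
Qed.

Let Derive_hL_nu : Derive FL 0 * Derive hL nu = Derive GL 0 * Derive hL 0.
Proof.
  assert (E : Derive (fun u => hL (FL u)) 0 = Derive (fun u => GL (hL u)) 0)
    by (apply Derive_ext; exact hL_conj).
  rewrite (C1_at_Derive_comp hL FL), (C1_at_Derive_comp GL hL) in E by auto.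
  rewrite FL0, hL0 in E. lra.
Qed.

Let Derive_hR_FR (x : R) : Derive FR x * Derive hR (FR x) = sR * Derive hR x.
Proof.
  assert (E : Derive (fun u => hR (FR u)) x = Derive (fun u => GR (hR u)) x)
    by (apply Derive_ext; exact hR_conj).
  rewrite (C1_at_Derive_comp hR FR), (C1_at_Derive_comp GR hR) in E by auto.
  rewrite Derive_GR in E. lra.
Qed.

Let hL_nu : hL nu = nu.
Proof.
  rewrite <- FL0 at 1. rewrite hL_conj, hL0. apply (br_GL0 B).
Qed.

Let hR_nu : hR nu = nu.
Proof.
  rewrite <- FR0 at 1. rewrite hR_conj, hR0. ring.
Qed.

(** The equality of slope ratios at work. Differentiating the left conjugacy at 0 expresses
    [hL'(nu)] through [hL'(0)] and the two left slopes; inserting it into the chain rule for the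
    pull-back through the right branches returns [hL'(0)] precisely under [br_slope]. *)
Let match_left : Derive hL 0 = Derive (fun x => GRi (hL (FR x))) 0.
Proof.
  rewrite (chain_GRi (fun x => hL (FR x))) by (apply C1_at_comp; auto).
  rewrite (C1_at_Derive_comp hL FR) by auto. rewrite FR0.
  pose proof (br_slope B). pose proof (br_sR B).
  pose proof (diffeo_Derive_neq_0 _ _ 0 (br_FL B)).
  apply (Rmult_eq_reg_l (Derive FL 0 * sR)); [|apply Rmult_integral_contrapositive_currified; assumption].
  replace (Derive FL 0 * sR * (Derive FR 0 * Derive hL nu / sR))
    with (Derive FR 0 * (Derive FL 0 * Derive hL nu)) by (field; assumption).
  rewrite Derive_hL_nu, H. ring.
Qed.

Let kL0 : kL 0 = 0.
Proof. rewrite <- hL0 at 1. apply (diffeo_kh dhL). Qed.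
Let kR0 : kR 0 = 0.
Proof. rewrite <- hR0 at 1. apply (diffeo_kh dhR). Qed.
Let kR_nu : kR nu = nu.
Proof. rewrite <- hR_nu at 1. apply (diffeo_kh dhR). Qed.
Let kL_conj (y : R) : kL (GL y) = FL (kL y).
Proof.
  rewrite <- (diffeo_hk dhL y) at 1. rewrite <- hL_conj. apply (diffeo_kh dhL).
Qed.
Let kR_conj (y : R) : kR (GR y) = FR (kR y).
Proof.
  rewrite <- (diffeo_hk dhR y) at 1. unfold GR. rewrite <- hR_conj. apply (diffeo_kh dhR).
Qed.
Let kL_inc := diffeo_increasing_inv _ _ dhL IhL.
Let kR_inc := diffeo_increasing_inv _ _ dhR IhR.

(** Differentiating the right conjugacy shows that this ratio equals [hR'(x) / hR'(FR x)], a
    quotient of two slopes that are each within a factor [exp eta] of 1. *)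
Let ratio_pos (x : R) : Rabs x <= p ->
  exp (- (2 * eta)) <= Derive FR x / sR <= exp (2 * eta).
Proof.
  intros Hx. pose proof (br_hR_bound B x Hx) as [A1 A2].
  pose proof (br_hR_bound B (FR x) (br_FR_bound B x Hx)) as [A3 A4].
  pose proof (Derive_hR_FR x) as E. pose proof (br_sR B).
  pose proof (exp_pos (- eta)). pose proof (exp_pos eta).
  replace (Derive FR x / sR) with (Derive hR x / Derive hR (FR x)).
  2:{ apply (Rmult_eq_reg_l (Derive hR (FR x) * sR)); [|apply Rmult_integral_contrapositive_currified; lra].
      field_simplify; lra. }
  assert (E1 : exp (- (2 * eta)) = exp (- eta) / exp eta)
    by (unfold Rdiv; rewrite <- exp_Ropp, <- exp_plus; f_equal; ring).
  assert (E2 : exp (2 * eta) = exp eta / exp (- eta))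
    by (unfold Rdiv; rewrite <- exp_Ropp, <- exp_plus; f_equal; ring).
  rewrite E1, E2. unfold Rdiv. split; apply Rmult_le_compat; try lra.
  - left. apply Rinv_0_lt_compat. assumption.
  - apply Rinv_le_contravar; lra.
  - left. apply Rinv_0_lt_compat. lra.
  - apply Rinv_le_contravar; lra.
Qed.

Let exp_mul_bound (a b x y : R) :
  exp (- a) <= x <= exp a -> exp (- b) <= y <= exp b -> exp (- (a + b)) <= x * y <= exp (a + b).
Proof.
  intros Hx Hy. rewrite Ropp_plus_distr, !exp_plus.
  pose proof (exp_pos (- a)). pose proof (exp_pos (- b)).
  split; apply Rmult_le_compat; lra.
Qed.

(** The exponent [3 * eta] is the worst case among the conjugacies built for [nu <= 0]: a ratio
    controlled by [2 * eta] times a branch conjugacy controlled by [eta]. *)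
Let endpoint_bound (h : R -> R) : 0 < p ->
  (forall x, C1_at h x) -> h 0 = 0 ->
  (forall x, 0 <= x <= p -> exp (- (3 * eta)) <= Derive h x <= exp (3 * eta)) ->
  exp (- (3 * eta)) * p <= h p <= exp (3 * eta) * p.
Proof.
  intros Hp Ch H0 Hb.
  destruct (MVT_all h (Derive h) 0 p) as [c [Hc E]].
  - intros x. apply C1_at_is_derive, Ch.
  - rewrite Rmin_left, Rmax_right in Hc by lra. rewrite H0 in E.
    specialize (Hb c Hc). nra.
Qed.

(** A decreasing right branch with [nu <= 0] sends the right half-line to the left one in a single
    step, so [hL] is pulled back just once and glued by [match_left]. *)
Lemma conj_nonpositive_decreasing :
  0 < p -> nu <= 0 -> sR < 0 -> (forall x y, x < y -> FR y < FR x) ->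
  exists h k, conj_on F (fun _ => True) G (fun _ => True) h k /\ increasing_fun h /\
    (forall x, x <= 0 -> h x = hL x) /\
    exp (- (3 * eta)) * p <= h p <= exp (3 * eta) * p.
Proof.
  intros Hp Hnu Hs HFR.
  assert (DB : diffeo (fun x => GRi (hL (FR x))) (fun y => FRi (kL (GR y)))).
  { apply (diffeo_comp GRi GR (fun x => hL (FR x)) (fun y => FRi (kL y))).
    - apply diffeo_sym, GR_diffeo.
    - apply (diffeo_comp hL kL FR FRi); [exact dhL|exact dFR]. }
  assert (B0 : GRi (hL (FR 0)) = 0).
  { rewrite FR0, hL_nu. unfold GRi. unfold Rdiv. ring. }
  assert (IB : increasing_fun (fun x => GRi (hL (FR x)))).
  { intros x y L. apply HFR, IhL in L. unfold GRi, Rdiv.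
    pose proof (Rinv_lt_0_compat _ Hs). nra. }
  destruct (diffeo_glue _ _ _ _ dhL DB IhL IB hL0 B0 match_left) as [D Ih].
  eexists; eexists. split; [split; [|split]|split; [|split]].
  - intros x _. split; [exact I|]. split; [apply (diffeo_kh D)|apply (diffeo_C1 D)].
  - intros x _. split; [exact I|]. split; [apply (diffeo_hk D)|apply (diffeo_C1' D)].
  - intros x _ _. unfold F, G. destruct (Rle_lt_dec x 0) as [L | L].
    + pose proof (increasing_le hL _ _ IhL L) as A. rewrite hL0 in A.
      pose proof (increasing_le FL _ _ IFL L) as A'. rewrite FL0 in A'.
      rewrite (glue_le 0 FL), (glue_le 0 hL _ x), (glue_le 0 GL), glue_le by lra. apply hL_conj.
    + pose proof (IB _ _ L) as A. cbv beta in A. rewrite B0 in A.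
      pose proof (HFR _ _ L) as A'. rewrite FR0 in A'.
      rewrite (glue_gt 0 FL), (glue_gt 0 hL _ x), (glue_gt 0 GL), glue_le by lra.
      symmetry. apply (diffeo_hk GR_diffeo).
  - exact Ih.
  - intros x L. apply glue_le. exact L.
  - apply endpoint_bound; [exact Hp|exact (diffeo_C1 D)|rewrite glue_le by lra; apply hL0|].
    intros x Hx. assert (Hxp : Rabs x <= p) by (rewrite Rabs_pos_eq; lra).
    rewrite (Derive_eq_one_sided _ (fun x => GRi (hL (FR x))) 1 x).
    + rewrite (chain_GRi (fun x => hL (FR x))) by (apply C1_at_comp; auto).
      rewrite (C1_at_Derive_comp hL FR) by auto.
      replace (3 * eta) with (2 * eta + eta) by ring.
      replace (Derive FR x * Derive hL (FR x) / sR) with (Derive FR x / sR * Derive hL (FR x))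
        by (field; lra).
      apply exp_mul_bound; [apply ratio_pos; exact Hxp|].
      apply (br_hL_bound B). apply (br_FR_bound B). exact Hxp.
    + lra.
    + apply C1_at_ex_derive, (diffeo_C1 D).
    + apply C1_at_ex_derive, (diffeo_C1 DB).
    + intros z Hz. apply (glue_ge 0 hL (fun x => GRi (hL (FR x)))); [rewrite B0; apply hL0|lra].
Qed.

(** Both half-lines are invariant when [nu = 0], so [hL] and [hR] already conjugate side by side,
    and [br_zero] makes their slopes agree at the kink. *)
Lemma conj_zero_increasing :
  0 < p -> 0 <= eta -> nu = 0 -> 0 < sR -> increasing_fun FR ->
  exists h k, conj_on F (fun _ => True) G (fun _ => True) h k /\ increasing_fun h /\
    (forall x, x <= 0 -> h x = hL x) /\
    exp (- (3 * eta)) * p <= h p <= exp (3 * eta) * p.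
Proof.
  intros Hp He Hnu Hs HFR.
  destruct (diffeo_glue _ _ _ _ dhL dhR IhL IhR hL0 hR0
    (br_zero B Hnu)) as [D Ih].
  eexists; eexists. split; [split; [|split]|split; [|split]].
  - intros x _. split; [exact I|]. split; [apply (diffeo_kh D)|apply (diffeo_C1 D)].
  - intros x _. split; [exact I|]. split; [apply (diffeo_hk D)|apply (diffeo_C1' D)].
  - intros x _ _. unfold F, G. destruct (Rle_lt_dec x 0) as [L | L].
    + pose proof (increasing_le hL _ _ IhL L) as A. rewrite hL0 in A.
      pose proof (increasing_le FL _ _ IFL L) as A'. rewrite FL0 in A'.
      rewrite (glue_le 0 FL), (glue_le 0 hL _ x), (glue_le 0 GL), glue_le by lra. apply hL_conj.
    + pose proof (br_hR_inc B L) as A. rewrite hR0 in A.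
      pose proof (HFR _ _ L) as A'. rewrite FR0 in A'.
      rewrite (glue_gt 0 FL), (glue_gt 0 hL _ x), (glue_gt 0 GL), glue_gt by lra. apply hR_conj.
  - exact Ih.
  - intros x L. apply glue_le. exact L.
  - apply endpoint_bound; [exact Hp|exact (diffeo_C1 D)|rewrite glue_le by lra; apply hL0|].
    intros x Hx. assert (Hxp : Rabs x <= p) by (rewrite Rabs_pos_eq; lra).
    rewrite (Derive_eq_one_sided _ hR 1 x).
    + pose proof (br_hR_bound B x Hxp).
      assert (exp (- (3 * eta)) <= exp (- eta)) by (apply exp_nondecreasing; lra).
      assert (exp eta <= exp (3 * eta)) by (apply exp_nondecreasing; lra). lra.
    + lra.
    + apply C1_at_ex_derive, (diffeo_C1 D).
    + apply C1_at_ex_derive, ChR.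
    + intros z Hz. apply glue_ge; [rewrite hL0, hR0; reflexivity|lra].
Qed.

(** The right fixed point is virtual, [xR < 0], so every orbit of the extended right branch reaches
    the left half-line, and [hL] is pulled back along these orbits. Here [hR] serves as a yardstick:
    it transfers the hitting property to [GR] and controls the slope of the extension uniformly in
    the number of steps. *)
Lemma conj_negative_increasing :
  0 < p -> 0 <= eta -> nu < 0 -> 0 < sR -> increasing_fun FR ->
  exists h k, conj_on F (fun _ => True) G (fun _ => True) h k /\ increasing_fun h /\
    (forall x, x <= 0 -> h x = hL x) /\
    exp (- (3 * eta)) * p <= h p <= exp (3 * eta) * p.
Proof.
  intros Hp He Hnu Hs HFR.
  assert (IGR : increasing_fun GR) by (intros x y L; unfold GR; nra).
  assert (HxR : xR < 0).
  { pose proof (br_contract B xR 0) as A. rewrite (br_fixR B), FR0, Rminus_0_r in A.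
    pose proof (br_k B). apply Rnot_le_lt. intros N. rewrite !Rabs_pos_eq in A by lra. nra. }
  assert (HitF : forall x, hits FR (fun u => u <= 0) x)
    by (intros x; apply (contraction_hits FR k xR); [exact (br_k B)|exact (br_contract B)|exact (br_fixR B)|exact HxR]).
  assert (HitG : forall y, hits GR (fun u => u <= 0) y).
  { intros y. destruct (HitF (kR y)) as [n Hn]. exists n.
    rewrite <- (iter_conj kR GR FR n y kR_conj) in Hn.
    apply (increasing_le_inv kR _ _ kR_inc). rewrite kR0. exact Hn. }
  destruct (extend_leftward FR FRi GR GRi hL kL 0 0) as (h & kk & Q1 & Q2 & Q3 & Q4 & Q5 & Q6).
  { exact dFR. } { exact GR_diffeo. } { exact dhL. } { exact HFR. } { exact IGR. }
  { exact IhL. } { rewrite FR0. exact Hnu. }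
  { unfold GR. lra. } { exact hL0. }
  { rewrite FR0, hL_nu. unfold GR. ring. } { exact match_left. }
  assert (Ch : forall x, C1_at h x) by (intros x; apply (Q3 x (HitF x))).
  assert (Ih : increasing_fun h) by (intros x y L; apply Q6; [apply HitF|exact L]).
  assert (h0 : h 0 = 0) by (rewrite Q1 by lra; exact hL0).
  exists h, kk. split; [split; [|split]|split; [|split]].
  - intros x _. destruct (Q3 x (HitF x)) as (A1 & A2 & A3). auto.
  - intros x _. destruct (Q4 x (HitG x)) as (A1 & A2 & A3). auto.
  - intros x _ _. unfold F, G. destruct (Rle_lt_dec x 0) as [L | L].
    + pose proof (increasing_le FL _ _ IFL L) as A'. rewrite FL0 in A'.
      pose proof (increasing_le h _ _ Ih L) as A. rewrite h0 in A.
      rewrite !glue_le by assumption. rewrite !Q1 by lra. apply hL_conj.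
    + pose proof (Ih _ _ L) as A. rewrite h0 in A.
      rewrite !glue_gt by auto. apply Q5; [apply HitF|lra].
  - exact Ih.
  - exact Q1.
  - apply endpoint_bound; [exact Hp|exact Ch|exact h0|].
    (* The ratio [h' / hR'] is invariant under [FR], so its bounds near [[nu, 0]] propagate. *)
    assert (W : forall n x, Nat.iter n FR x <= 0 -> Rabs x <= p ->
      exp (- (2 * eta)) <= Derive h x / Derive hR x <= exp (2 * eta)).
    { intros n. induction n as [|n IH]; intros x Hn Hx.
      - simpl in Hn. rewrite (Derive_eq_one_sided h hL (-1) x).
        + pose proof (br_hL_bound B x Hx). pose proof (br_hR_bound B x Hx).
          pose proof (exp_pos (- eta)).
          replace (2 * eta) with (eta + eta) by ring. apply exp_mul_bound; [assumption|].
          replace (exp eta) with (/ exp (- eta)) by (rewrite exp_Ropp, Rinv_inv; reflexivity).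
          rewrite exp_Ropp at 1. split; apply Rinv_le_contravar; lra.
        + lra.
        + apply C1_at_ex_derive, Ch.
        + apply C1_at_ex_derive, ChL.
        + intros z Hz. apply Q1. lra.
      - destruct (Rle_lt_dec x 0) as [L | L].
        + apply (IH x); [|exact Hx].
          clear - L Hn HFR Hnu FR0. induction n as [|n IHn]; [exact L|].
          assert (N : forall i, Nat.iter i FR x <= 0).
          { intros i. induction i as [|i IHi]; [exact L|]. simpl.
            apply (increasing_le FR _ _ HFR) in IHi. rewrite FR0 in IHi. lra. }
          apply N.
        + rewrite Nat.iter_succ_r in Hn. specialize (IH (FR x) Hn (br_FR_bound B x Hx)).
          assert (E : Derive FR x * Derive h (FR x) = sR * Derive h x).
          { assert (E : Derive (fun u => h (FR u)) x = Derive (fun u => GR (h u)) x).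
            { apply (Derive_eq_one_sided _ _ 1).
              - lra.
              - apply C1_at_ex_derive, C1_at_comp; auto.
              - apply C1_at_ex_derive, (C1_at_comp GR h); auto.
              - intros z Hz. apply Q5; [apply HitF|lra]. }
            rewrite (C1_at_Derive_comp h FR), (C1_at_Derive_comp GR h) in E by auto.
            rewrite Derive_GR in E. lra. }
          pose proof (Derive_hR_FR x) as E2.
          pose proof (br_hR_bound B x Hx). pose proof (br_hR_bound B (FR x) (br_FR_bound B x Hx)).
          pose proof (exp_pos (- eta)). pose proof (diffeo_Derive_neq_0 _ _ x dFR) as N0.
          replace (Derive h x / Derive hR x) with (Derive h (FR x) / Derive hR (FR x)); [exact IH|].
          replace (Derive h x) with (Derive FR x * Derive h (FR x) / sR) by (rewrite E; field; lra).
          replace (Derive hR x) with (Derive FR x * Derive hR (FR x) / sR) by (rewrite E2; field; lra).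
          field. repeat split; lra. }
    intros x Hx. assert (Hxp : Rabs x <= p) by (rewrite Rabs_pos_eq; lra).
    destruct (HitF x) as [n Hn]. specialize (W n x Hn Hxp).
    pose proof (br_hR_bound B x Hxp). pose proof (exp_pos (- eta)).
    replace (Derive h x) with (Derive h x / Derive hR x * Derive hR x) by (field; lra).
    replace (3 * eta) with (2 * eta + eta) by ring. apply exp_mul_bound; assumption.
Qed.

(** For [nu > 0] the left branch expands away from [xL < 0] and carries every point right of [xL]
    into the right half-line, so [hR] is pulled back along orbits of [FL]. Differentiating the right
    conjugacy at 0 relates [hR'(nu)] to [hR'(0)], and [br_slope] converts this into the matching
    condition for the left branches. The resulting map serves both signs of [sR]. *)
Let left_extension :
  0 < nu -> xL < 0 /\ yL < 0 /\
  exists h k : R -> R,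
    (forall x, 0 <= x -> h x = hR x) /\ (forall y, 0 <= y -> k y = kR y) /\
    (forall x, xL < x -> yL < h x /\ k (h x) = x /\ C1_at h x) /\
    (forall y, yL < y -> xL < k y /\ h (k y) = y /\ C1_at k y) /\
    (forall x, xL < x -> x <= 0 -> h (FL x) = GL (h x)) /\
    (forall x, xL < x -> x < 0 -> h x < 0) /\ (forall y, yL < y -> y < 0 -> k y < 0).
Proof.
  intros Hnu.
  assert (HxL : xL < 0).
  { pose proof (br_expand B xL 0) as A. rewrite (br_fixL B), FL0, Rminus_0_r in A.
    pose proof (br_lo B). apply Rnot_le_lt. intros N. rewrite Rabs_pos_eq in A by exact N.
    assert (Rabs (xL - nu) <= Rmax xL nu) by (unfold Rabs, Rmax; destruct (Rcase_abs _), (Rle_dec _ _); lra).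
    pose proof (increasing_le FL _ _ IFL N) as A'. rewrite (br_fixL B), FL0 in A'.
    rewrite Rabs_pos_eq in A by lra. nra. }
  assert (HyL : yL < 0) by (rewrite <- (br_hLx B), <- hL0; apply IhL; exact HxL).
  assert (HitF : forall x, hits FL (fun u => 0 <= u) x <-> xL < x).
  { intros x. split.
    - intros [n Hn]. apply Rnot_le_lt. intros N.
      assert (It : forall i, Nat.iter i FL x <= xL).
      { intros i. induction i as [|i IH]; [exact N|]. simpl. rewrite <- (br_fixL B).
        apply increasing_le; [exact IFL|exact IH]. }
      specialize (It n). lra.
    - intros L. apply (expansion_hits FL lo xL);
        [exact IFL|exact (br_lo B)|exact (br_expand B)|exact (br_fixL B)|exact L]. }
  assert (HitG : forall y, hits GL (fun u => 0 <= u) y <-> yL < y).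
  { intros y. rewrite <- (diffeo_hk dhL y) at 2. rewrite <- (br_hLx B).
    assert (E : forall n, Nat.iter n FL (kL y) = kL (Nat.iter n GL y))
      by (intros n; symmetry; apply iter_conj; exact kL_conj).
    split.
    - intros [n Hn]. apply IhL. apply HitF. exists n. rewrite E, <- kL0.
      apply increasing_le; [exact kL_inc|exact Hn].
    - intros L. apply (increasing_lt_inv hL _ _ IhL) in L. apply HitF in L.
      destruct L as [n Hn]. exists n. rewrite E, <- kL0 in Hn.
      apply (increasing_le_inv kL _ _ kL_inc). exact Hn. }
  split; [exact HxL|]. split; [exact HyL|].
  destruct (extend_rightward FL FLi GL GLi hR kR 0 0) as (h & kk & Q1 & Q2 & Q3 & Q4 & Q5).
  { exact (br_FL B). } { exact (br_GL B). } { exact dhR. } { exact IFL. }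
  { exact (br_GL_inc B). } { exact IhR. }
  { rewrite FL0. exact Hnu. } { rewrite (br_GL0 B). exact Hnu. } { exact hR0. }
  { rewrite FL0, (br_GL0 B). exact hR_nu. }
  { rewrite (C1_at_Derive_comp GLi (fun x => hR (FL x))), (C1_at_Derive_comp hR FL).
    - rewrite FL0, hR_nu.
      pose proof (diffeo_Derive_inv_eq _ _ 0 (br_GL B)) as E. rewrite (br_GL0 B) in E. rewrite E.
      pose proof (Derive_hR_FR 0) as E2. rewrite FR0 in E2.
      pose proof (diffeo_Derive_neq_0 _ _ 0 (br_GL B)). pose proof (diffeo_Derive_neq_0 _ _ 0 dFR).
      pose proof (br_slope B). pose proof (br_sR B).
      apply (Rmult_eq_reg_l (Derive GL 0 * Derive FR 0)); [|apply Rmult_integral_contrapositive_currified; assumption].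
      replace (Derive GL 0 * Derive FR 0 * (Derive FL 0 * Derive hR nu * / Derive GL 0))
        with (Derive FL 0 * (Derive FR 0 * Derive hR nu)) by (field; assumption).
      rewrite E2, <- H1. ring.
    - apply CFL.
    - apply ChR.
    - apply C1_at_comp; auto.
    - apply (diffeo_C1' (br_GL B)). }
  exists h, kk. split; [exact Q1|]. split; [exact Q2|]. split; [|split; [|split; [|split]]].
  - intros x L. destruct (Q3 x (proj2 (HitF x) L)) as (A1 & A2 & A3).
    split; [apply HitG; exact A1|]. split; assumption.
  - intros x L. destruct (Q4 x (proj2 (HitG x) L)) as (A1 & A2 & A3).
    split; [apply HitF; exact A1|]. split; assumption.
  - intros x L. apply Q5. apply HitF. exact L.
  - intros x L L0. apply Rnot_le_lt. intros N.
    destruct (Q3 x (proj2 (HitF x) L)) as (A1 & A2 & A3). rewrite Q2 in A2 by exact N.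
    pose proof (increasing_le kR _ _ kR_inc N) as A. rewrite kR0 in A. lra.
  - intros x L L0. apply Rnot_le_lt. intros N.
    destruct (Q4 x (proj2 (HitG x) L)) as (A1 & A2 & A3). rewrite Q1 in A2 by exact N.
    pose proof (increasing_le hR _ _ IhR N) as A. rewrite hR0 in A. lra.
Qed.

Lemma fixed_left_negative : 0 < nu -> xL < 0 /\ yL < 0.
Proof. intros H. destruct (left_extension H) as (A1 & A2 & _). auto. Qed.

(** An increasing right branch with [nu > 0] maps the right half-line into itself, where [hR]
    already conjugates; only the part left of 0 relies on the extension. *)
Lemma conj_basin_of_attraction :
  0 < nu -> 0 < sR -> increasing_fun FR ->
  exists h k, conj_on F (fun x => xL < x) G (fun y => yL < y) h k /\
    (forall x, 0 <= x -> h x = hR x) /\ (forall y, 0 <= y -> k y = kR y) /\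
    (forall x, xL < x -> x < 0 -> h x < 0) /\ (forall y, yL < y -> y < 0 -> k y < 0).
Proof.
  intros Hnu Hs HFR. destruct (left_extension Hnu) as (A1 & A2 & h & kk & Q1 & Q2 & Q3 & Q4 & Q5 & Q6 & Q7).
  exists h, kk. split; [split; [|split]|auto].
  - exact Q3.
  - exact Q4.
  - intros x L _. unfold F, G. destruct (Rle_lt_dec x 0) as [L0 | L0].
    + assert (h x <= 0).
      { destruct L0 as [L0 | ->]; [left; apply Q6; assumption|]. rewrite Q1 by lra. rewrite hR0. lra. }
      rewrite !glue_le by assumption. apply Q5; assumption.
    + pose proof (br_hR_inc B L0) as C1. rewrite hR0 in C1.
      pose proof (HFR _ _ L0) as C2. rewrite FR0 in C2.
      rewrite (Q1 x), !glue_gt by lra. rewrite Q1 by lra. apply hR_conj.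
Qed.

(** The decreasing right branch maps the part of the interval right of 0 onto the points between
    [xL] and [nu], where the extended map is available, so pulling it back once through the right
    branches defines the conjugacy there. *)
Lemma conj_trapping_interval :
  0 < nu -> sR < 0 -> (forall x y, x < y -> FR y < FR x) ->
  0 < FRi xL /\ 0 < GRi yL /\
  exists h k, conj_on F (fun x => xL < x < FRi xL) G (fun y => yL < y < GRi yL) h k.
Proof.
  intros Hnu Hs HFR. destruct (left_extension Hnu) as (HxL & HyL & h & kk & Q1 & Q2 & Q3 & Q4 & Q5 & Q6 & Q7).
  assert (FRi_dec : forall x y, x < y -> FRi y < FRi x).
  { intros x y L. apply Rnot_le_lt. intros [N | N].
    - apply HFR in N. rewrite !(diffeo_hk dFR) in N. lra.
    - apply (f_equal FR) in N. rewrite !(diffeo_hk dFR) in N. lra. }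
  assert (GR_dec : forall x y, x < y -> GR y < GR x) by (intros x y L; unfold GR; nra).
  assert (GRi_dec : forall x y, x < y -> GRi y < GRi x).
  { intros x y L. unfold GRi, Rdiv. pose proof (Rinv_lt_0_compat _ Hs). nra. }
  assert (FRi_nu : FRi nu = 0) by (rewrite <- FR0; apply (diffeo_kh dFR)).
  assert (GRi_nu : GRi nu = 0) by (unfold GRi, Rdiv; ring).
  assert (GR_0 : GR 0 = nu) by (unfold GR; ring).
  assert (Hw : 0 < FRi xL) by (rewrite <- FRi_nu; apply FRi_dec; lra).
  assert (Hv : 0 < GRi yL) by (rewrite <- GRi_nu; apply GRi_dec; lra).
  assert (hlt : forall x, xL < x -> x < nu -> h x < nu).
  { intros x L1 L2. destruct (Rlt_le_dec x 0) as [L | L]; [specialize (Q6 x L1 L); lra|].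
    rewrite Q1 by exact L. rewrite <- hR_nu. apply IhR. exact L2. }
  assert (klt : forall x, yL < x -> x < nu -> kk x < nu).
  { intros x L1 L2. destruct (Rlt_le_dec x 0) as [L | L]; [specialize (Q7 x L1 L); lra|].
    rewrite Q2 by exact L. rewrite <- kR_nu. apply kR_inc. exact L2. }
  assert (FRim : forall x, 0 < x < FRi xL -> xL < FR x < nu).
  { intros x [L1 L2]. split; [|rewrite <- FR0; apply HFR; exact L1].
    rewrite <- (diffeo_hk dFR xL). apply HFR. exact L2. }
  assert (GRim : forall y, 0 < y < GRi yL -> yL < GR y < nu).
  { intros y [L1 L2]. split; [|rewrite <- GR_0; apply GR_dec; exact L1].
    rewrite <- (diffeo_hk GR_diffeo yL). apply GR_dec. exact L2. }
  split; [exact Hw|]. split; [exact Hv|].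
  set (h3 := glue 0 h (fun x => GRi (h (FR x)))).
  set (k3 := glue 0 kk (fun y => FRi (kk (GR y)))).
  assert (hle : forall x, x <= 0 -> h3 x = h x) by (intros; apply glue_le; assumption).
  assert (hgt : forall x, 0 < x -> h3 x = GRi (h (FR x)))
    by (intros x L; exact (glue_gt 0 h (fun x => GRi (h (FR x))) x L)).
  assert (kle : forall x, x <= 0 -> k3 x = kk x) by (intros; apply glue_le; assumption).
  assert (kgt : forall x, 0 < x -> k3 x = FRi (kk (GR x)))
    by (intros x L; exact (glue_gt 0 kk (fun x => FRi (kk (GR x))) x L)).
  assert (hpos : forall x, 0 < x < FRi xL -> 0 < h3 x < GRi yL).
  { intros x L. rewrite hgt by lra. destruct (FRim x L) as [M1 M2].
    pose proof (proj1 (Q3 _ M1)). pose proof (hlt _ M1 M2).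
    split; [rewrite <- GRi_nu|]; apply GRi_dec; assumption. }
  assert (kpos : forall y, 0 < y < GRi yL -> 0 < k3 y < FRi xL).
  { intros x L. rewrite kgt by lra. destruct (GRim x L) as [M1 M2].
    pose proof (proj1 (Q4 _ M1)). pose proof (klt _ M1 M2).
    split; [rewrite <- FRi_nu|]; apply FRi_dec; assumption. }
  assert (hneg : forall x, xL < x -> x <= 0 -> yL < h3 x <= 0).
  { intros x L1 L2. rewrite hle by exact L2. split; [apply (Q3 x L1)|].
    destruct L2 as [L2 | ->]; [left; apply Q6; assumption|]. rewrite Q1, hR0; lra. }
  assert (kneg : forall x, yL < x -> x <= 0 -> xL < k3 x <= 0).
  { intros x L1 L2. rewrite kle by exact L2. split; [apply (Q4 x L1)|].
    destruct L2 as [L2 | ->]; [left; apply Q7; assumption|]. rewrite Q2, kR0; lra. }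
  assert (hRloc : forall x, 0 <= FR x -> GRi (h (FR x)) = hR x).
  { intros x L. rewrite Q1, hR_conj by exact L. apply (diffeo_kh GR_diffeo). }
  assert (kRloc : forall x, 0 <= GR x -> FRi (kk (GR x)) = kR x).
  { intros x L. rewrite Q2, kR_conj by exact L. apply (diffeo_kh dFR). }
  (* Contraction gives [FR nu >= (1 - k) * nu]. Hence up to [nu] the pulled-back piece is [hR]
     itself, which yields smoothness at 0 and the conjugacy relation for points whose image is
     positive. *)
  assert (FR_nu : forall z, z <= nu -> 0 <= FR z).
  { intros z Lz. apply Rle_trans with (FR nu).
    - pose proof (br_contract B nu 0) as A. rewrite FR0, Rminus_0_r in A.
      pose proof (br_k B). rewrite (Rabs_pos_eq nu) in A by lra.
      assert (FR nu < nu) by (rewrite <- FR0 at 2; apply HFR; exact Hnu).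
      rewrite Rabs_left in A by lra. nra.
    - destruct Lz as [Lz | ->]; [left; apply HFR; exact Lz|lra]. }
  exists h3, k3. split; [|split].
  - intros x L. split; [|split].
    + destruct (Rle_lt_dec x 0) as [M | M].
      * pose proof (hneg x (proj1 L) M). lra.
      * pose proof (hpos x (conj M (proj2 L))). lra.
    + destruct (Rle_lt_dec x 0) as [M | M].
      * rewrite kle by apply (hneg x (proj1 L) M). rewrite hle by exact M. apply (Q3 x (proj1 L)).
      * destruct (FRim x (conj M (proj2 L))) as [M1 M2].
        rewrite kgt by apply (hpos x (conj M (proj2 L))). rewrite hgt by exact M.
        rewrite (diffeo_hk GR_diffeo). rewrite (proj1 (proj2 (Q3 _ M1))).
        apply (diffeo_kh dFR).
    + apply C1_at_glue.
      * intros _. apply (Q3 x (proj1 L)).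
      * intros M. apply (C1_at_comp GRi (fun x => h (FR x))); [|apply CGRi].
        apply C1_at_comp; [apply CFR|]. apply Q3.
        destruct M as [M | <-]; [apply (FRim x (conj M (proj2 L)))|rewrite FR0; lra].
      * rewrite hRloc by (rewrite FR0; lra). apply Q1. lra.
      * intros ->. transitivity (Derive hR 0).
        -- apply (Derive_eq_one_sided _ _ 1); [lra| | |].
           ++ apply C1_at_ex_derive. apply (Q3 0). lra.
           ++ apply C1_at_ex_derive. apply ChR.
           ++ intros z Hz. apply Q1. lra.
        -- apply Derive_ext_loc. generalize (locally_lt 0 nu Hnu). apply filter_imp.
           intros u Hu. symmetry. apply hRloc. apply FR_nu. lra.
  - intros x L. split; [|split].
    + destruct (Rle_lt_dec x 0) as [M | M].
      * pose proof (kneg x (proj1 L) M). lra.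
      * pose proof (kpos x (conj M (proj2 L))). lra.
    + destruct (Rle_lt_dec x 0) as [M | M].
      * rewrite hle by apply (kneg x (proj1 L) M). rewrite kle by exact M. apply (Q4 x (proj1 L)).
      * destruct (GRim x (conj M (proj2 L))) as [M1 M2].
        rewrite hgt by apply (kpos x (conj M (proj2 L))). rewrite kgt by exact M.
        rewrite (diffeo_hk dFR). rewrite (proj1 (proj2 (Q4 _ M1))).
        apply (diffeo_kh GR_diffeo).
    + apply C1_at_glue.
      * intros _. apply (Q4 x (proj1 L)).
      * intros M. apply (C1_at_comp FRi (fun x => kk (GR x))); [|apply (diffeo_C1' dFR)].
        apply C1_at_comp; [apply CGR|]. apply Q4.
        destruct M as [M | <-]; [apply (GRim x (conj M (proj2 L)))|rewrite GR_0; lra].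
      * rewrite kRloc by (rewrite GR_0; lra). apply Q2. lra.
      * intros ->. transitivity (Derive kR 0).
        -- apply (Derive_eq_one_sided _ _ 1); [lra| | |].
           ++ apply C1_at_ex_derive. apply (Q4 0). lra.
           ++ apply C1_at_ex_derive. apply (diffeo_C1' dhR).
           ++ intros z Hz. apply Q2. lra.
        -- assert (Cg : continuous GR 0) by (apply C1_at_continuous, CGR).
           assert (L0 : locally (GR 0) (fun v => 0 < v)) by (apply locally_gt; rewrite GR_0; exact Hnu).
           pose proof (Cg _ L0 : locally 0 (fun u => 0 < GR u)) as L1.
           apply Derive_ext_loc. revert L1. apply filter_imp.
           intros u Hu. symmetry. apply kRloc. left. exact Hu.
  - intros x L _. unfold F, G. destruct (Rle_lt_dec x 0) as [M | M].
    + rewrite (glue_le 0 FL) by exact M. rewrite (glue_le 0 GL) by apply (hneg x (proj1 L) M).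
      rewrite (hle x) by exact M. rewrite <- Q5 by (assumption || apply L).
      assert (N : FL x <= nu) by (rewrite <- FL0; apply increasing_le; [exact IFL|exact M]).
      destruct (Rle_lt_dec (FL x) 0) as [P | P]; [apply hle; exact P|].
      rewrite hgt by exact P. rewrite hRloc by (apply FR_nu; exact N). symmetry. apply Q1. lra.
    + rewrite (glue_gt 0 FL) by exact M. rewrite (glue_gt 0 GL) by apply (hpos x (conj M (proj2 L))).
      rewrite (hgt x) by exact M. rewrite (diffeo_hk GR_diffeo).
      destruct (FRim x (conj M (proj2 L))) as [M1 M2].
      destruct (Rle_lt_dec (FR x) 0) as [P | P]; [apply hle; exact P|].
      rewrite hgt by exact P. rewrite hRloc by (apply FR_nu; lra). symmetry. apply Q1. lra.
Qed.

(** Backward iteration of the right branch moves every point below [xR] to the left, so [hL] is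
    continued along orbits of [FRi]. The fundamental domain runs from 0 to [nu], and the matching
    condition at [nu] is [match_left] read at its other end. *)
Lemma conj_basin_of_repulsion :
  0 < nu -> 0 < sR -> increasing_fun FR ->
  nu < xR /\
  exists h k, conj_on F (fun x => x < xR) G (fun y => y < yR) h k /\
    (forall x, x <= 0 -> h x = hL x) /\ (forall y, y <= 0 -> k y = kL y).
Proof.
  intros Hnu Hs HFR.
  assert (IGR : increasing_fun GR) by (intros x y L; unfold GR; nra).
  pose proof (diffeo_increasing_inv _ _ dFR HFR) as IFRi.
  pose proof (diffeo_increasing_inv _ _ GR_diffeo IGR) as IGRi.
  assert (HxR : nu < xR).
  { pose proof (br_contract B xR 0) as A. rewrite (br_fixR B), FR0, Rminus_0_r in A.
    pose proof (br_k B) as K. assert (0 < xR).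
    { apply Rnot_le_lt. intros N. rewrite !Rabs_left1 in A by lra. nra. }
    rewrite <- FR0, <- (br_fixR B). apply HFR. assumption. }
  assert (FRi_nu : FRi nu = 0) by (rewrite <- FR0; apply (diffeo_kh dFR)).
  assert (GRi_nu : GRi nu = 0) by (unfold GRi, Rdiv; ring).
  assert (kR_conji : forall y, kR (GRi y) = FRi (kR y)).
  { intros y. rewrite <- (diffeo_kh dFR (kR (GRi y))). rewrite <- kR_conj.
    now rewrite (diffeo_hk GR_diffeo). }
  assert (FRi_fix : FRi xR = xR) by (rewrite <- (br_fixR B) at 1; apply (diffeo_kh dFR)).
  assert (HitF : forall x, hits FRi (fun u => u <= nu) x <-> x < xR).
  { intros x. split.
    - intros [n Hn]. apply Rnot_le_lt. intros N.
      assert (It : forall i, xR <= Nat.iter i FRi x).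
      { intros i. induction i as [|i IH]; [exact N|]. simpl. rewrite <- FRi_fix.
        apply increasing_le; [exact IFRi|exact IH]. }
      specialize (It n). lra.
    - intros L. apply (contraction_inverse_hits FR FRi k xR);
        [exact HFR|exact dFR|exact (br_k B)|exact (br_contract B)|exact (br_fixR B)|exact L]. }
  assert (HitG : forall y, hits GRi (fun u => u <= nu) y <-> y < yR).
  { intros y. rewrite <- (diffeo_hk dhR y) at 2. rewrite <- (br_hRx B).
    assert (E : forall n, Nat.iter n FRi (kR y) = kR (Nat.iter n GRi y))
      by (intros n; symmetry; apply iter_conj; exact kR_conji).
    split.
    - intros [n Hn]. apply IhR. apply HitF. exists n. rewrite E, <- kR_nu.
      apply increasing_le; [exact kR_inc|exact Hn].
    - intros L. apply (increasing_lt_inv hR _ _ IhR) in L. apply HitF in L.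
      destruct L as [n Hn]. exists n. rewrite E, <- kR_nu in Hn.
      apply (increasing_le_inv kR _ _ kR_inc). exact Hn. }
  split; [exact HxR|].
  destruct (extend_leftward FRi FR GRi GR hL kL nu nu) as (h & kk & Q1 & Q2 & Q3 & Q4 & Q5 & Q6).
  { apply diffeo_sym. exact dFR. } { apply diffeo_sym. exact GR_diffeo. } { exact dhL. }
  { exact IFRi. } { exact IGRi. } { exact IhL. }
  { rewrite FRi_nu. exact Hnu. } { rewrite GRi_nu. exact Hnu. } { exact hL_nu. }
  { rewrite FRi_nu, GRi_nu. exact hL0. }
  { rewrite (C1_at_Derive_comp GR (fun x => hL (FRi x))), (C1_at_Derive_comp hL FRi).
    - rewrite Derive_GR, FRi_nu.
      pose proof (diffeo_Derive_inv_eq _ _ 0 dFR) as E. rewrite FR0 in E. rewrite E.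
      pose proof match_left as E2.
      rewrite (chain_GRi (fun x => hL (FR x))), (C1_at_Derive_comp hL FR), FR0 in E2
        by (auto; apply C1_at_comp; auto).
      rewrite E2. field. split; [apply (br_sR B)|apply (diffeo_Derive_neq_0 _ _ _ dFR)].
    - apply (diffeo_C1' dFR).
    - apply ChL.
    - apply C1_at_comp; [apply (diffeo_C1' dFR)|apply ChL].
    - apply CGR. }
  assert (hx : forall x, x < xR -> nu <= x -> nu <= h x).
  { intros x L M. destruct M as [M | <-]; [|rewrite Q1 by lra; rewrite hL_nu; lra].
    left. rewrite <- hL_nu, <- Q1 by lra. apply Q6; [apply HitF; exact L|exact M]. }
  exists h, kk. split; [split; [|split]|split].
  - intros x L. destruct (Q3 x (proj2 (HitF x) L)) as (A1 & A2 & A3).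
    split; [apply HitG; exact A1|]. split; assumption.
  - intros x L. destruct (Q4 x (proj2 (HitG x) L)) as (A1 & A2 & A3).
    split; [apply HitF; exact A1|]. split; assumption.
  - intros x L LF. revert LF. unfold F, G. destruct (Rle_lt_dec x 0) as [M | M].
    + pose proof (increasing_le FL _ _ IFL M) as A'. rewrite FL0 in A'.
      pose proof (increasing_le hL _ _ IhL M) as A. rewrite hL0 in A.
      intros _. rewrite (Q1 x) by lra. rewrite !glue_le by assumption. rewrite Q1 by exact A'.
      apply hL_conj.
    + assert (0 < h x).
      { destruct (Rle_lt_dec x nu) as [N | N].
        - rewrite Q1 by exact N. rewrite <- hL0. apply IhL. exact M.
        - pose proof (hx x L). lra. }
      rewrite !glue_gt by assumption. intros LF.
      pose proof (HFR _ _ M) as A. rewrite FR0 in A.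
      specialize (Q5 (FR x) (proj2 (HitF _) LF)). rewrite (diffeo_kh dFR) in Q5.
      rewrite Q5 by lra. symmetry. apply (diffeo_hk GR_diffeo).
  - intros x L. apply Q1. lra.
  - intros y L. apply Q2. lra.
Qed.
End Branches.

Arguments fixed_left_negative {p eta k lo nu sR xL xR yL yR FL FLi FR FRi GL GLi hL kL hR kR} _.
Arguments conj_basin_of_attraction {p eta k lo nu sR xL xR yL yR FL FLi FR FRi GL GLi hL kL hR kR} _.
Arguments conj_basin_of_repulsion {p eta k lo nu sR xL xR yL yR FL FLi FR FRi GL GLi hL kL hR kR} _.
Arguments conj_trapping_interval {p eta k lo nu sR xL xR yL yR FL FLi FR FRi GL GLi hL kL hR kR} _.

(** * Restriction to bounded neighbourhoods and stability of the fixed points *)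

Lemma conj_on_restrict (F G f g h k : R -> R) (U V U0 V0 : R -> Prop) :
  conj_on F U G V h k ->
  (forall x, U0 x -> U x /\ f x = F x /\ V0 (h x)) ->
  (forall y, V0 y -> V y /\ g y = G y /\ U0 (k y)) ->
  diff_conjugate f U0 g V0.
Proof.
  intros (C1 & C2 & C3) HU HV. exists h, k. split; [|split; [|split; [|split]]].
  - intros x Ux. destruct (HU x Ux) as (A1 & A2 & A3). split; [exact A3|apply (C1 x A1)].
  - intros y Vy. destruct (HV y Vy) as (A1 & A2 & A3). split; [exact A3|apply (C2 y A1)].
  - intros x Ux. destruct (HU x Ux) as (A1 & A2 & A3). destruct (C1 x A1) as (_ & _ & A4).
    split; [apply C1_at_ex_derive; exact A4|apply A4].
  - intros y Vy. destruct (HV y Vy) as (A1 & A2 & A3). destruct (C2 y A1) as (_ & _ & A4).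
    split; [apply C1_at_ex_derive; exact A4|apply A4].
  - intros x Ux Ufx. destruct (HU x Ux) as (A1 & A2 & A3). destruct (HU _ Ufx) as (A4 & _ & _).
    destruct (HV _ A3) as (_ & A5 & _). rewrite A5, A2. apply C3; [exact A1|]. rewrite <- A2. exact A4.
Qed.

Lemma unstable_of_expansion (F : R -> R) (a lo d : R) :
  0 < d -> 1 < lo -> (forall y, Rabs (y - a) < d -> lo * Rabs (y - a) <= Rabs (F y - a)) ->
  unstable F a.
Proof.
  (* Stability would confine nearby orbits to the ball of radius [d], where each step multiplies the
     distance from [a] by at least [lo]. *)
  intros Hd Hlo H S. destruct (S d Hd) as (e & He & Se).
  set (y := a + e / 2). assert (Hy : Rabs (y - a) = e / 2).
  { unfold y. replace (a + e / 2 - a) with (e / 2) by ring. apply Rabs_pos_eq. lra. }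
  assert (A : forall n, lo ^ n * (e / 2) <= Rabs (Nat.iter n F y - a)).
  { intros n. induction n as [|n IH]; simpl; [lra|].
    eapply Rle_trans; [|apply H; apply Se; lra]. nra. }
  destruct (pow_small (/ lo) (e / 2 / d)) as [n Hn].
  - split; [left; apply Rinv_0_lt_compat; lra|]. rewrite <- Rinv_1. apply Rinv_lt_contravar; lra.
  - apply Rdiv_lt_0_compat; lra.
  - specialize (A n). specialize (Se y n). rewrite Hy in Se. specialize (Se ltac:(lra)).
    assert (P : 0 < lo ^ n) by (apply pow_lt; lra). rewrite pow_inv in Hn.
    apply (Rmult_lt_compat_r (lo ^ n * d)) in Hn; [|nra].
    replace (/ lo ^ n * (lo ^ n * d)) with d in Hn by (field; lra).
    replace (e / 2 / d * (lo ^ n * d)) with (lo ^ n * (e / 2)) in Hn by (field; lra). lra.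
Qed.

Lemma asymptotically_stable_of_contraction (F : R -> R) (a k d : R) :
  0 < d -> 0 <= k < 1 -> (forall y, Rabs (y - a) < d -> Rabs (F y - a) <= k * Rabs (y - a)) ->
  asymptotically_stable F a.
Proof.
  intros Hd Hk H.
  assert (A : forall y n, Rabs (y - a) < d -> Rabs (Nat.iter n F y - a) <= k ^ n * Rabs (y - a)).
  { intros y n Hy. pose proof (Rabs_pos (y - a)). induction n as [|n IH]; simpl; [lra|].
    assert (k ^ n <= 1) by (rewrite <- (pow1 n); apply pow_incr; lra).
    assert (0 <= k ^ n) by (apply pow_le; lra).
    eapply Rle_trans; [apply H; nra|]. rewrite Rmult_assoc. apply Rmult_le_compat_l; lra. }
  split.
  - intros eps He. exists (Rmin d eps). split; [apply Rmin_glb_lt; lra|].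
    intros y n Hy. pose proof (Rmin_l d eps). pose proof (Rmin_r d eps).
    specialize (A y n ltac:(lra)). pose proof (Rabs_pos (y - a)).
    assert (k ^ n <= 1) by (rewrite <- (pow1 n); apply pow_incr; lra). nra.
  - exists d. split; [exact Hd|]. intros y Hy. apply is_lim_seq_spec. intros eps.
    pose proof (cond_pos eps). destruct (pow_lt_1_zero k) with (y := eps / d) as [N HN].
    { rewrite Rabs_pos_eq; lra. } { apply Rdiv_lt_0_compat; lra. }
    exists N. intros n Hn. specialize (HN n Hn). specialize (A y n Hy).
    assert (0 <= k ^ n) by (apply pow_le; lra). rewrite Rabs_pos_eq in HN by assumption.
    pose proof (Rabs_pos (y - a)).
    apply (Rmult_lt_compat_r d) in HN; [|exact Hd].
    replace (eps / d * d) with (pos eps) in HN by (field; lra). nra.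
Qed.

Lemma piecewise_fixed_points (l r FL FR : R -> R) (q1 q2 lo k a b : R) :
  (forall x, q1 < x < q2 -> x <= 0 -> l x = FL x) -> (forall x, q1 < x < q2 -> 0 < x -> r x = FR x) ->
  1 < lo -> (forall x y, lo * Rabs (x - y) <= Rabs (FL x - FL y)) -> FL a = a ->
  0 <= k < 1 -> (forall x y, Rabs (FR x - FR y) <= k * Rabs (x - y)) -> FR b = b ->
  q1 < a -> a < 0 -> 0 < b -> b < q2 ->
  fixed_point_pair (piecewise l r) (open_interval q1 q2) a b.
Proof.
  intros Hl Hr Hlo HL Ha Hk HR Hb A1 A2 A3 A4. unfold open_interval.
  assert (Pl : forall x, q1 < x < q2 -> x <= 0 -> piecewise l r x = FL x).
  { intros x Hx L. unfold piecewise. destruct (Rle_dec x 0); [apply Hl; assumption|lra]. }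
  assert (Pr : forall x, q1 < x < q2 -> 0 < x -> piecewise l r x = FR x).
  { intros x Hx L. unfold piecewise. destruct (Rle_dec x 0); [lra|apply Hr; assumption]. }
  split; [lra|]. split; [lra|]. split; [lra|]. split; [|split].
  - intros x Hx. destruct (Rle_lt_dec x 0) as [L | L].
    + rewrite Pl by assumption. split.
      * intros E. left. specialize (HL x a). rewrite E, Ha in HL.
        destruct (Req_dec x a) as [|N]; [assumption|].
        assert (0 < Rabs (x - a)) by (apply Rabs_pos_lt; lra). nra.
      * intros [-> | ->]; [exact Ha|lra].
    + rewrite Pr by assumption. split.
      * intros E. right. specialize (HR x b). rewrite E, Hb in HR.
        destruct (Req_dec x b) as [|N]; [assumption|].
        assert (0 < Rabs (x - b)) by (apply Rabs_pos_lt; lra). nra.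
      * intros [-> | ->]; [lra|exact Hb].
  - apply (unstable_of_expansion _ a lo (Rmin (- a) (a - q1))); [apply Rmin_glb_lt; lra|exact Hlo|].
    intros y Hy. pose proof (Rmin_l (- a) (a - q1)). pose proof (Rmin_r (- a) (a - q1)).
    apply Rabs_def2 in Hy. rewrite Pl by lra. rewrite <- Ha at 2. apply HL.
  - apply (asymptotically_stable_of_contraction _ b k (Rmin b (q2 - b))); [apply Rmin_glb_lt; lra|exact Hk|].
    intros y Hy. pose proof (Rmin_l b (q2 - b)). pose proof (Rmin_r b (q2 - b)).
    apply Rabs_def2 in Hy. rewrite Pr by lra. rewrite <- Hb at 1. apply HR.
Qed.

(** The required conclusion for one parameter value, with cases split by the signs of [nu] and [sR]
    in place of those of [mu] and [aR]. *)
Definition conjugacies_at (p nu sL sR t xL xR yL yR : R) (f fr : R -> R) (qm qp : R) : Prop :=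
  (nu <= 0 -> diff_conjugate f (open_interval (- p) p)
                (normal_form nu sL sR t) (open_interval qm qp)) /\
  (0 < nu ->
    fixed_point_pair f (open_interval (- p) p) xL xR /\
    fixed_point_pair (normal_form nu sL sR t) (open_interval qm qp) yL yR /\
    (0 < sR ->
      diff_conjugate f (fun x => open_interval (- p) p x /\ xL < x)
        (normal_form nu sL sR t) (fun y => open_interval qm qp y /\ yL < y) /\
      diff_conjugate f (fun x => open_interval (- p) p x /\ x < xR)
        (normal_form nu sL sR t) (fun y => open_interval qm qp y /\ y < yR)) /\
    (sR < 0 ->
      (exists w v : R,
        unique (fun x => open_interval (- p) p x /\ 0 <= x /\ fr x = xL) w /\
        unique (fun y => nu + sR * y = yL) v /\
        diff_conjugate f (open_interval xL w)
          (normal_form nu sL sR t) (open_interval yL v)) /\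
      diff_conjugate f (fun x => open_interval (- p) p x /\ x < 0)
        (normal_form nu sL sR t) (fun y => open_interval qm qp y /\ y < 0))).

(** The target interval starts at [hL (- p)]. For [nu <= 0] it ends at the image of [p] under the
    single conjugacy; for [nu > 0] it ends at [hR p], and one interval suits both basins because
    their conjugacies equal [hR] on the right and [hL] on the left respectively.
    [exp (3 * eta) * p <= r] keeps it where the quadratic branch coincides with [GL]. *)
Lemma local_conjugacies (p r eta k lo nu sL sR t xL xR yL yR : R)
    (fl fr FL FLi FR FRi GL GLi hL kL hR kR : R -> R) :
  branches p eta k lo nu sR xL xR yL yR FL FLi FR FRi GL GLi hL kL hR kR ->
  0 < p -> p <= r -> 0 <= eta -> exp (3 * eta) * p <= r ->
  (forall x, Rabs x <= r -> fl x = FL x) -> (forall x, Rabs x <= r -> fr x = FR x) ->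
  (forall y, Rabs y <= r -> nu + sL * y + t * y ^ 2 = GL y) ->
  (forall x y, lo * Rabs (x - y) <= Rabs (GL x - GL y)) -> GL yL = yL ->
  Rabs sR <= k -> nu + sR * yR = yR ->
  (0 < sR -> increasing_fun FR) -> (sR < 0 -> forall x y, x < y -> FR y < FR x) ->
  Rabs xL < p -> Rabs xR < p -> FRi xL < p ->
  exists qm qp : R,
    (exp (- (3 * eta)) * p <= - qm <= exp (3 * eta) * p) /\
    (exp (- (3 * eta)) * p <= qp <= exp (3 * eta) * p) /\
    conjugacies_at p nu sL sR t xL xR yL yR (piecewise fl fr) fr qm qp.
Proof.
  unfold conjugacies_at. intros B Hp Hpr He Her Hfl Hfr Hgl HGLe HGLf HsRk HyR Hinc Hdec HxLp HxRp Hwp.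
  pose proof (br_sR B) as HsR.
  pose proof (diffeo_increasing_inv _ _ (br_hL B) (br_hL_inc B)) as IkL.
  pose proof (diffeo_increasing_inv _ _ (br_hR B) (br_hR_inc B)) as IkR.
  pose proof (br_hL_inc B) as IhL. pose proof (br_hR_inc B) as IhR.
  pose proof (br_hL0 B) as hL0. pose proof (br_hR0 B) as hR0.
  assert (kL0 : kL 0 = 0) by (rewrite <- hL0 at 1; apply (diffeo_kh (br_hL B))).
  assert (kR0 : kR 0 = 0) by (rewrite <- hR0 at 1; apply (diffeo_kh (br_hR B))).
  pose proof (diffeo_kh (br_hL B)) as khL. pose proof (diffeo_kh (br_hR B)) as khR.
  apply Rabs_def2 in HxLp. apply Rabs_def2 in HxRp.
  pose proof (exp_pos eta) as He0. pose proof (exp_pos (- eta)) as He1.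
  assert (E1 : exp (- (3 * eta)) <= exp (- eta)) by (apply exp_nondecreasing; lra).
  assert (E2 : exp eta <= exp (3 * eta)) by (apply exp_nondecreasing; lra).
  assert (Qm : exp (- (3 * eta)) * p <= - hL (- p) <= exp (3 * eta) * p).
  { destruct (MVT_all hL (Derive hL) (- p) 0) as [c [Hc E]].
    - intros x. apply C1_at_is_derive, (diffeo_C1 (br_hL B)).
    - rewrite Rmin_left, Rmax_right in Hc by lra. rewrite hL0 in E.
      pose proof (br_hL_bound B c) as [D1 D2]; [apply Rabs_le; lra|]. nra. }
  assert (Qp : exp (- (3 * eta)) * p <= hR p <= exp (3 * eta) * p).
  { destruct (MVT_all hR (Derive hR) 0 p) as [c [Hc E]].
    - intros x. apply C1_at_is_derive, (diffeo_C1 (br_hR B)).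
    - rewrite Rmin_left, Rmax_right in Hc by lra. rewrite hR0 in E.
      pose proof (br_hR_bound B c) as [D1 D2]; [apply Rabs_le; lra|]. nra. }
  set (F := glue 0 FL FR). set (G := glue 0 GL (fun y => nu + sR * y)).
  assert (HF : forall x, - p < x < p -> piecewise fl fr x = F x).
  { intros x Hx. assert (Rabs x <= r) by (apply Rabs_le; lra).
    unfold piecewise, F, glue. destruct (Rle_dec x 0); auto. }
  (* The affine right branch is its own extension, so agreement for [y > 0] has no size restriction;
     this covers the right end of the trapping interval of the normal form. *)
  assert (HG : forall y, Rabs y <= r \/ 0 < y -> normal_form nu sL sR t y = G y).
  { intros y Hy. unfold normal_form, piecewise, G, glue. destruct (Rle_dec y 0); [|reflexivity].
    apply Hgl. destruct Hy; [assumption|lra]. }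
  destruct (Rle_lt_dec nu 0) as [Hnu | Hnu].
  - assert (W : exists h kk, conj_on F (fun _ => True) G (fun _ => True) h kk /\ increasing_fun h /\
      (forall x, x <= 0 -> h x = hL x) /\ exp (- (3 * eta)) * p <= h p <= exp (3 * eta) * p).
    { destruct (Rtotal_order sR 0) as [S | [S | S]]; [|contradiction|].
      - eapply conj_nonpositive_decreasing; eauto.
      - destruct Hnu as [Hnu | Hnu].
        + eapply conj_negative_increasing; eauto.
        + eapply conj_zero_increasing; eauto. }
    destruct W as (h & kk & C & Ih & hle & Hb).
    exists (hL (- p)), (h p). split; [exact Qm|]. split; [exact Hb|]. split; [|intros; lra].
    intros _. pose proof C as (C1 & C2 & _).
    assert (Em : h (- p) = hL (- p)) by (apply hle; lra).
    apply (conj_on_restrict F G _ _ h kk (fun _ => True) (fun _ => True)); [exact C| |].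
    + intros x Hx. split; [exact I|]. split; [apply HF; exact Hx|]. unfold open_interval in *.
      rewrite <- Em. split; apply Ih; lra.
    + intros y Hy. unfold open_interval in *. split; [exact I|]. split.
      * apply HG. left. apply Rabs_le. lra.
      * rewrite <- Em in Hy. destruct (C2 y I) as (_ & E & _).
        split; apply (increasing_lt_inv h _ _ Ih); rewrite E; lra.
  - destruct (fixed_left_negative B Hnu) as [HxL HyL].
    assert (HxR : 0 < xR).
    { pose proof (br_contract B xR 0) as A. rewrite (br_fixR B), (br_FR0 B), Rminus_0_r in A.
      pose proof (br_k B) as K. apply Rnot_le_lt. intros N. rewrite !Rabs_left1 in A by lra. nra. }
    assert (HyRp : 0 < yR) by (rewrite <- (br_hRx B), <- hR0; apply IhR; exact HxR).
    assert (HyLq : hL (- p) < yL) by (rewrite <- (br_hLx B); apply IhL; lra).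
    assert (HyRq : yR < hR p) by (rewrite <- (br_hRx B); apply IhR; lra).
    exists (hL (- p)), (hR p). split; [exact Qm|]. split; [exact Qp|]. split; [intros; lra|].
    intros _. split; [|split; [|split]].
    + apply (piecewise_fixed_points fl fr FL FR (- p) p lo k);
        [| |exact (br_lo B)|exact (br_expand B)|exact (br_fixL B)|exact (br_k B)|exact (br_contract B)
        |exact (br_fixR B)| | | |]; try lra.
      * intros x Hx _. apply Hfl. apply Rabs_le. lra.
      * intros x Hx _. apply Hfr. apply Rabs_le. lra.
    + apply (piecewise_fixed_points _ _ GL (fun y => nu + sR * y) _ _ lo k);
        [| |exact (br_lo B)|exact HGLe|exact HGLf|exact (br_k B)| |exact HyR| | | |]; try lra.
      * intros y Hy _. apply Hgl. apply Rabs_le. lra.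
      * intros y _ _. reflexivity.
      * intros x y. replace (nu + sR * x - (nu + sR * y)) with (sR * (x - y)) by ring.
        rewrite Rabs_mult. apply Rmult_le_compat_r; [apply Rabs_pos|exact HsRk].
    + intros S. specialize (Hinc S). split.
      * destruct (conj_basin_of_attraction B Hnu S Hinc)
          as (h & kk & C & Q1 & Q2 & Q3 & Q4).
        pose proof C as (C1 & C2 & _).
        apply (conj_on_restrict F G _ _ h kk (fun x => xL < x) (fun y => yL < y)); [exact C| |].
        -- intros x [Hx L]. unfold open_interval in *. split; [exact L|]. split; [apply HF; exact Hx|].
           destruct (C1 x L) as (D1 & _). split; [split; [lra|]|exact D1].
           destruct (Rlt_le_dec x 0) as [M | M].
           ++ specialize (Q3 x L M). lra.
           ++ rewrite Q1 by exact M. apply IhR. lra.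
        -- intros y [Hy L]. unfold open_interval in *. split; [exact L|]. split.
           { apply HG. left. apply Rabs_le. lra. }
           destruct (C2 y L) as (D1 & _). split; [split; [lra|]|exact D1].
           destruct (Rlt_le_dec y 0) as [M | M].
           ++ specialize (Q4 y L M). lra.
           ++ rewrite Q2 by exact M. rewrite <- (khR p). apply IkR. lra.
      * destruct (conj_basin_of_repulsion B Hnu S Hinc)
          as (_ & h & kk & C & Q1 & Q2).
        pose proof C as (C1 & C2 & _).
        apply (conj_on_restrict F G _ _ h kk (fun x => x < xR) (fun y => y < yR)); [exact C| |].
        -- intros x [Hx L]. unfold open_interval in *. split; [exact L|]. split; [apply HF; exact Hx|].
           destruct (C1 x L) as (D1 & D2 & _). split; [split; [|lra]|exact D1].
           destruct (Rle_lt_dec x 0) as [M | M].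
           ++ rewrite Q1 by exact M. apply IhL. lra.
           ++ apply Rlt_trans with 0; [rewrite <- hL0; apply IhL; lra|]. apply Rnot_le_lt. intros N.
              rewrite Q2 in D2 by exact N. pose proof (increasing_le kL _ _ IkL N). lra.
        -- intros y [Hy L]. unfold open_interval in *. split; [exact L|]. split.
           { apply HG. left. apply Rabs_le. lra. }
           destruct (C2 y L) as (D1 & D2 & _). split; [split; [|lra]|exact D1].
           destruct (Rle_lt_dec y 0) as [M | M].
           ++ rewrite Q2 by exact M. rewrite <- (khL (- p)). apply IkL. lra.
           ++ apply Rlt_trans with 0; [lra|]. apply Rnot_le_lt. intros N.
              rewrite Q1 in D2 by exact N. pose proof (increasing_le hL _ _ IhL N). lra.
    + intros S. specialize (Hdec S). split.
      * destruct (conj_trapping_interval B Hnu S Hdec)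
          as (Hw & Hv & h & kk & C).
        exists (FRi xL), ((yL - nu) / sR). split; [|split].
        -- unfold open_interval. split.
           ++ split; [lra|]. split; [lra|]. rewrite Hfr by (apply Rabs_le; lra). apply (diffeo_hk (br_FR B)).
           ++ intros x (Hx & _ & E). rewrite Hfr in E by (apply Rabs_le; lra).
              rewrite <- E. apply (diffeo_kh (br_FR B)).
        -- split; [field; exact HsR|]. intros y E. rewrite <- E. field. exact HsR.
        -- pose proof C as (C1 & C2 & _).
           apply (conj_on_restrict F G _ _ h kk _ _ _ _ C).
           ++ intros x Hx. unfold open_interval in *. split; [exact Hx|]. split; [apply HF; lra|apply (C1 x Hx)].
           ++ intros y Hy. unfold open_interval in *. split; [exact Hy|]. split; [|apply (C2 y Hy)].
              apply HG. destruct (Rle_lt_dec y 0); [left; apply Rabs_le; lra|right; assumption].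
      * assert (hneg : forall x, x < 0 -> hL x < 0) by (intros x L; rewrite <- hL0; apply IhL; exact L).
        assert (kneg : forall x, x < 0 -> kL x < 0) by (intros x L; rewrite <- kL0; apply IkL; exact L).
        apply (conj_on_restrict F G _ _ hL kL (fun x => x < 0) (fun y => y < 0)).
        -- split; [|split].
           ++ intros x L. split; [auto|]. split; [apply khL|apply (diffeo_C1 (br_hL B))].
           ++ intros x L. split; [auto|]. split; [apply (diffeo_hk (br_hL B))|apply (diffeo_C1' (br_hL B))].
           ++ intros x L _. pose proof (hneg x L). unfold F, G. rewrite !glue_le by lra. apply (br_hL_conj B).
        -- intros x [Hx L]. unfold open_interval in *. split; [exact L|]. split; [apply HF; exact Hx|].
           pose proof (hneg x L). pose proof (IhR 0 p Hp). split; [split; [apply IhL; lra|lra]|assumption].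
        -- intros y [Hy L]. unfold open_interval in *. split; [exact L|]. split; [apply HG; left; apply Rabs_le; lra|].
           pose proof (kneg y L). split; [split; [rewrite <- (khL (- p)); apply IkL; lra|lra]|assumption].
Qed.

(** * Families of slopes and implicit fixed points *)

Definition clamp (r x : R) : R := Rmax (- r) (Rmin r x).

Lemma clamp_id (r x : R) : Rabs x <= r -> clamp r x = x.
Proof.
  intros H. apply Rabs_le_between in H. unfold clamp.
  rewrite Rmin_right by lra. rewrite Rmax_right by lra. reflexivity.
Qed.

Lemma clamp_bound (r x : R) : 0 <= r -> Rabs (clamp r x) <= r.
Proof.
  intros H. apply Rabs_le. unfold clamp. split; [apply Rmax_l|].
  apply Rmax_lub; [lra|apply Rmin_l].
Qed.

Lemma clamp_lipschitz (r x y : R) : Rabs (clamp r x - clamp r y) <= Rabs (x - y).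
Proof.
  unfold clamp, Rmax, Rmin.
  destruct (Rle_dec r x), (Rle_dec r y); repeat destruct (Rle_dec _ _);
    unfold Rabs; repeat destruct (Rcase_abs _); lra.
Qed.

Lemma lipschitz_on_segment (f df : R -> R) (a b C : R) :
  (forall x, Rmin a b <= x <= Rmax a b -> is_derive f x (df x)) ->
  (forall x, Rmin a b <= x <= Rmax a b -> Rabs (df x) <= C) ->
  Rabs (f b - f a) <= C * Rabs (b - a).
Proof.
  intros H HC. destruct (MVT_gen f a b df) as [c [Hc E]].
  - intros x Hx. apply H. lra.
  - intros x Hx. apply continuity_pt_filterlim. apply (ex_derive_continuous (V := R_NormedModule)).
    exists (df x). apply H. exact Hx.
  - rewrite E, Rabs_mult. apply Rmult_le_compat_r; [apply Rabs_pos|apply HC; exact Hc].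
Qed.

Lemma segment_in_ball (a b r x : R) :
  Rabs a <= r -> Rabs b <= r -> Rmin a b <= x <= Rmax a b -> Rabs x <= r.
Proof.
  intros Ha Hb Hx. apply Rabs_le_between in Ha. apply Rabs_le_between in Hb. apply Rabs_le.
  unfold Rmin, Rmax in Hx. destruct (Rle_dec a b); lra.
Qed.

(* Continue [f] beyond [[-r, r]] with constant slope. *)
Definition affine_ext (r : R) (f Df : R -> R) (x : R) : R :=
  f 0 + RInt (fun s => Df (clamp r s)) 0 x.

(** The clamp is 1-Lipschitz with values in [[-r, r]], so slope estimates valid on that interval
    become global. [Rmax 0 K] appears because [K] comes without a sign. *)
Lemma affine_ext_spec (r K : R) (f Df : R -> R) :
  0 < r ->
  (forall x, Rabs x <= r -> is_derive f x (Df x)) ->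
  (forall x y, Rabs x <= r -> Rabs y <= r -> Rabs (Df x - Df y) <= K * Rabs (x - y)) ->
  (forall x, is_derive (affine_ext r f Df) x (Df (clamp r x))) /\
  (forall x, Rabs x <= r -> f x = affine_ext r f Df x) /\
  (forall x y, Rabs (Df (clamp r x) - Df (clamp r y)) <= Rmax 0 K * Rabs (x - y)).
Proof.
  intros Hr Hd Hl.
  assert (L : forall x y, Rabs (Df (clamp r x) - Df (clamp r y)) <= Rmax 0 K * Rabs (x - y)).
  { intros x y. eapply Rle_trans; [apply Hl; apply clamp_bound; lra|].
    apply Rle_trans with (Rmax 0 K * Rabs (clamp r x - clamp r y)).
    - apply Rmult_le_compat_r; [apply Rabs_pos|apply Rmax_r].
    - apply Rmult_le_compat_l; [apply Rmax_l|apply clamp_lipschitz]. }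
  assert (D : forall x, is_derive (affine_ext r f Df) x (Df (clamp r x))).
  { intros x. unfold affine_ext.
    replace (Df (clamp r x)) with (plus 0 (Df (clamp r x))) by apply Rplus_0_l.
    apply (is_derive_plus (V := R_NormedModule) (fun _ => f 0)).
    - apply (is_derive_const (V := R_NormedModule)).
    - apply (is_derive_RInt_continuous (fun s => Df (clamp r s))).
      intros u. apply (lipschitz_continuous (fun s => Df (clamp r s)) (Rmax 0 K)). exact L. }
  split; [exact D|]. split; [|exact L].
  intros x Hx.
  assert (E0 : affine_ext r f Df 0 = f 0).
  { unfold affine_ext. rewrite (RInt_point (V := R_CompleteNormedModule)). apply Rplus_0_r. }
  assert (E : Rabs ((f x - affine_ext r f Df x) - (f 0 - affine_ext r f Df 0)) <= 0 * Rabs (x - 0)).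
  { apply (lipschitz_on_segment (fun x => f x - affine_ext r f Df x) (fun x => Df x - Df (clamp r x))).
    - intros z Hz. assert (Rabs z <= r) by (apply (segment_in_ball 0 x); [rewrite Rabs_R0; lra|exact Hx|exact Hz]).
      apply (is_derive_minus (V := R_NormedModule)); [apply Hd; assumption|apply D].
    - intros z Hz. assert (Rabs z <= r) by (apply (segment_in_ball 0 x); [rewrite Rabs_R0; lra|exact Hx|exact Hz]).
      rewrite clamp_id, Rminus_diag, Rabs_R0 by assumption. lra. }
  rewrite E0, Rminus_diag, Rminus_0_r, Rmult_0_l in E.
  destruct (Req_dec (f x - affine_ext r f Df x) 0) as [Z | Z]; [lra|].
  apply Rabs_pos_lt in Z. lra.
Qed.

Set Implicit Arguments.

(** Uniform estimates on a square about the origin. [D] is the partial derivative in [x], [e] the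
    oscillation allowed around its value at the origin, and a single [K] serves both variables. *)
Record slope_box (phi D : R -> R -> R) (a e r m K : R) : Prop := {
  box_deriv : forall x mu, Rabs x <= r -> Rabs mu <= m -> is_derive (fun z => phi z mu) x (D x mu);
  box_near : forall x mu, Rabs x <= r -> Rabs mu <= m -> Rabs (D x mu - a) <= e;
  box_lip : forall x mu x' mu', Rabs x <= r -> Rabs mu <= m -> Rabs x' <= r -> Rabs mu' <= m ->
    Rabs (D x mu - D x' mu') <= K * (Rabs (x - x') + Rabs (mu - mu'));
  box_mu : forall x mu mu', Rabs x <= r -> Rabs mu <= m -> Rabs mu' <= m ->
    Rabs (phi x mu - phi x mu') <= K * Rabs (mu - mu') }.

Unset Implicit Arguments.

Lemma slope_box_mono (phi D : R -> R -> R) (a e r m K r' m' K' : R) :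
  slope_box phi D a e r m K -> r' <= r -> m' <= m -> K <= K' -> slope_box phi D a e r' m' K'.
Proof.
  intros [B1 B2 B3 B4] Hr Hm HK. split; intros.
  - apply B1; lra.
  - apply B2; lra.
  - eapply Rle_trans; [apply B3; lra|]. apply Rmult_le_compat_r; [|exact HK].
    pose proof (Rabs_pos (x - x')). pose proof (Rabs_pos (mu - mu')). lra.
  - eapply Rle_trans; [apply B4; lra|]. apply Rmult_le_compat_r; [apply Rabs_pos|exact HK].
Qed.

Lemma continuity_2d_bounded (f : R -> R -> R) (x y : R) :
  continuity_2d_pt f x y -> locally_2d (fun u v => Rabs (f u v) <= Rabs (f x y) + 1) x y.
Proof.
  intros H. destruct (H (mkposreal 1 Rlt_0_1)) as [d Hd]. exists d. intros u v Hu Hv.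
  specialize (Hd u v Hu Hv). simpl in Hd.
  replace (f u v) with (f x y + (f u v - f x y)) by ring.
  eapply Rle_trans; [apply Rabs_triang|]. lra.
Qed.

(** [K] is produced before [e]: it comes from bounds on partial derivatives near the origin, and
    shrinking the square to bring the slope closer to [a] leaves it unchanged. Differentiability of
    [D] at the origin is recorded separately, as it yields the derivatives at [mu = 0] of the
    multipliers. *)
Lemma slope_box_of_C3 (phi : R -> R -> R) (a : R) :
  locally_2d (fun u v => ex_diff_n phi 3 u v) 0 0 ->
  is_derive (fun x => phi x 0) 0 a ->
  exists D : R -> R -> R, D 0 0 = a /\
    (exists l1 l2, differentiable_pt_lim D 0 0 l1 l2) /\
    exists K, 0 < K /\ forall e, 0 < e -> exists d, 0 < d /\ slope_box phi D a e d d K.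
Proof.
  intros H3 Ha.
  set (D := fun u v => Derive (fun z => phi z v) u).
  set (P2 := fun u v => Derive (fun z => phi u z) v).
  set (D1 := fun u v => Derive (fun z => D z v) u).
  set (D2 := fun u v => Derive (fun z => D u z) v).
  assert (H : locally_2d (fun u v =>
    (is_derive (fun z => phi z v) u (D u v) /\ is_derive (fun z => phi u z) v (P2 u v)) /\
    (is_derive (fun z => D z v) u (D1 u v) /\ is_derive (fun z => D u z) v (D2 u v)) /\
    continuity_2d_pt P2 u v /\ continuity_2d_pt D u v /\
    continuity_2d_pt D1 u v /\ continuity_2d_pt D2 u v) 0 0).
  { destruct H3 as [d Hd]. exists d. intros u v Hu Hv. specialize (Hd u v Hu Hv).
    destruct Hd as (_ & E1 & E2 & (C1 & E3 & E4 & (C2 & _) & (C3 & _)) & (C4 & _)).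
    apply Derive_correct in E1, E2, E3, E4. tauto. }
  clear H3. destruct (locally_2d_singleton _ _ _ H) as (_ & _ & CP2 & CD & CD1 & CD2).
  exists D. split; [apply is_derive_unique; exact Ha|]. split.
  - exists (D1 0 0), (D2 0 0). apply filterdiff_differentiable_pt_lim.
    apply (is_derive_filterdiff D 0 0 D1 (D2 0 0)).
    + apply locally_2d_locally in H. revert H. apply filter_imp. intros u Hu. apply Hu.
    + apply (locally_2d_singleton _ _ _ H).
    + apply continuity_2d_pt_filterlim in CD1. exact CD1.
  - pose proof (continuity_2d_bounded _ _ _ CP2) as B0.
    pose proof (continuity_2d_bounded _ _ _ CD1) as B1.
    pose proof (continuity_2d_bounded _ _ _ CD2) as B2.
    set (K0 := Rabs (P2 0 0) + 1) in *. set (K1 := Rabs (D1 0 0) + 1) in *. set (K2 := Rabs (D2 0 0) + 1) in *.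
    assert (0 < K0 /\ 0 < K1 /\ 0 < K2) as (Q0 & Q1 & Q2).
    { unfold K0, K1, K2. pose proof (Rabs_pos (P2 0 0)). pose proof (Rabs_pos (D1 0 0)).
      pose proof (Rabs_pos (D2 0 0)). lra. }
    exists (K0 + K1 + K2). split; [lra|]. intros e He.
    pose proof (CD (mkposreal e He)) as B3.
    destruct (locally_2d_and _ _ _ _ H (locally_2d_and _ _ _ _ B0 (locally_2d_and _ _ _ _ B1
      (locally_2d_and _ _ _ _ B2 B3)))) as [d Hd].
    pose proof (cond_pos d) as Hdp.
    assert (W : forall u v, Rabs u <= d / 2 -> Rabs v <= d / 2 ->
      is_derive (fun z => phi z v) u (D u v) /\ is_derive (fun z => phi u z) v (P2 u v) /\
      is_derive (fun z => D z v) u (D1 u v) /\ is_derive (fun z => D u z) v (D2 u v) /\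
      Rabs (P2 u v) <= K0 /\ Rabs (D1 u v) <= K1 /\ Rabs (D2 u v) <= K2 /\ Rabs (D u v - a) <= e).
    { intros u v Hu Hv. destruct (Hd u v) as (((A1 & A2) & (A3 & A4) & _) & A5 & A6 & A7 & A8).
      - rewrite Rminus_0_r. lra.
      - rewrite Rminus_0_r. lra.
      - simpl in A8. replace (D 0 0) with a in A8 by (symmetry; apply is_derive_unique; exact Ha).
        apply Rlt_le in A8. tauto. }
    clear H Hd. exists (d / 2). split; [lra|]. split.
    + intros x mu Hx Hm. apply (W x mu Hx Hm).
    + intros x mu Hx Hm. apply (W x mu Hx Hm).
    + intros x mu x' mu' Hx Hm Hx' Hm'.
      assert (V1 : Rabs (D x mu - D x' mu) <= K1 * Rabs (x - x')).
      { apply (lipschitz_on_segment (fun z => D z mu) (fun z => D1 z mu)); intros z Hz;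
          apply (segment_in_ball x' x (d / 2)) in Hz; try assumption; apply (W z mu Hz Hm). }
      assert (V2 : Rabs (D x' mu - D x' mu') <= K2 * Rabs (mu - mu')).
      { apply (lipschitz_on_segment (fun z => D x' z) (fun z => D2 x' z)); intros z Hz;
          apply (segment_in_ball mu' mu (d / 2)) in Hz; try assumption; apply (W x' z Hx' Hz). }
      replace (D x mu - D x' mu') with ((D x mu - D x' mu) + (D x' mu - D x' mu')) by ring.
      eapply Rle_trans; [apply Rabs_triang|].
      pose proof (Rabs_pos (x - x')). pose proof (Rabs_pos (mu - mu')). nra.
    + intros x mu mu' Hx Hm Hm'.
      eapply Rle_trans; [apply (lipschitz_on_segment (fun z => phi x z) (fun z => P2 x z) mu' mu K0)|].
      * intros z Hz. apply (segment_in_ball mu' mu (d / 2)) in Hz; try assumption. apply (W x z Hx Hz).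
      * intros z Hz. apply (segment_in_ball mu' mu (d / 2)) in Hz; try assumption. apply (W x z Hx Hz).
      * apply Rmult_le_compat_r; [apply Rabs_pos|lra].
Qed.

(** [x - phi x mu] has slope within [e] of [1 - a], hence bounded away from 0 with a constant sign,
    whether [a] exceeds 1 or not. Existence is the intermediate value theorem and the Lipschitz
    bound is quantitative injectivity. The parameter [mu] may have either sign, so virtual fixed
    points are included. *)
Lemma implicit_fixed_point (phi D : R -> R -> R) (a e r m K beta : R) :
  0 < r -> 0 < m -> 0 < K -> e < Rabs (1 - a) -> D 0 0 = a ->
  slope_box phi D a e r m K -> phi 0 0 = 0 -> is_derive (fun mu => phi 0 mu) 0 beta ->
  exists (X : R -> R) (m' L : R), 0 < m' <= m /\ 0 < L /\ X 0 = 0 /\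
    (forall mu, Rabs mu <= m' -> Rabs (X mu) <= r /\ phi (X mu) mu = X mu) /\
    (forall mu mu', Rabs mu <= m' -> Rabs mu' <= m' -> Rabs (X mu - X mu') <= L * Rabs (mu - mu')) /\
    is_derive X 0 (beta / (1 - a)).
Proof.
  intros Hr Hm HK He HD Bx H0 Hb. destruct Bx as [B1 B2 B3 B4].
  set (c := 1 - a) in *.
  assert (Hr0 : Rabs 0 <= r) by (rewrite Rabs_R0; lra).
  assert (Hm0 : Rabs 0 <= m) by (rewrite Rabs_R0; lra).
  assert (Hc : 0 < Rabs c).
  { specialize (B2 0 0 Hr0 Hm0). pose proof (Rabs_pos (D 0 0 - a)). lra. }
  assert (Hc0 : c <> 0) by (intros Z; rewrite Z, Rabs_R0 in Hc; lra).
  set (kap := Rabs c - e). assert (Hkap : 0 < kap) by (unfold kap; lra).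
  (* [x - phi x mu] has slope within [e] of [c]. *)
  assert (Hinj : forall mu x x', Rabs mu <= m -> Rabs x <= r -> Rabs x' <= r ->
    kap * Rabs (x - x') <= Rabs ((x - phi x mu) - (x' - phi x' mu))).
  { intros mu x x' Hmu Hx Hx'.
    assert (V : Rabs ((phi x mu - a * x) - (phi x' mu - a * x')) <= e * Rabs (x - x')).
    { apply (lipschitz_on_segment (fun z => phi z mu - a * z) (fun z => D z mu - a)).
      - intros z Hz. apply (segment_in_ball x' x r) in Hz; try assumption.
        apply (is_derive_minus (V := R_NormedModule)); [apply B1; assumption|].
        evar_last; [apply (is_derive_scal (fun z => z) z a 1); apply (is_derive_id (K := R_AbsRing))|apply Rmult_1_r].
      - intros z Hz. apply (segment_in_ball x' x r) in Hz; try assumption. apply B2; assumption. }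
    replace (x - phi x mu - (x' - phi x' mu)) with
      (c * (x - x') - ((phi x mu - a * x) - (phi x' mu - a * x'))) by (unfold c; ring).
    eapply Rle_trans; [|apply Rabs_triang_inv]. rewrite Rabs_mult. unfold kap. lra. }
  (* For such [mu] the displacement at 0 is at most [kap * r], which a slope of at least [kap]
     compensates within distance [r]. *)
  set (m' := Rmin m (kap * r / K)).
  assert (Hm' : 0 < m' <= m).
  { split; [|apply Rmin_l]. apply Rmin_glb_lt; [exact Hm|]. apply Rdiv_lt_0_compat; [|exact HK].
    apply Rmult_lt_0_compat; assumption. }
  assert (Hm'K : forall mu, Rabs mu <= m' -> Rabs (phi 0 mu) <= kap * r).
  { intros mu Hmu. pose proof (B4 0 mu 0 Hr0 ltac:(lra) Hm0) as V. rewrite H0, !Rminus_0_r in V.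
    eapply Rle_trans; [exact V|]. apply Rle_trans with (K * (kap * r / K)).
    - apply Rmult_le_compat_l; [lra|]. eapply Rle_trans; [exact Hmu|apply Rmin_r].
    - right. field. lra. }
  assert (Hex : forall mu, exists x, Rabs mu <= m' -> Rabs x <= r /\ phi x mu = x).
  { intros mu. destruct (Rle_dec (Rabs mu) m') as [Hmu | N]; [|exists 0; intros; contradiction].
    destruct (affine_ext_spec r K (fun z => phi z mu) (fun z => D z mu)) as (E1 & E2 & _).
    - exact Hr.
    - intros x Hx. apply B1; lra.
    - intros x y Hx Hy. eapply Rle_trans; [apply B3; lra|].
      rewrite Rminus_diag, Rabs_R0, Rplus_0_r. lra.
    - set (psi := affine_ext r (fun z => phi z mu) (fun z => D z mu)) in *.
      (* Division by [c = 1 - a] makes the function increasing for either sign of [c]. *)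
      set (g := fun x => (x - psi x) / c).
      assert (Hg : forall x, is_derive g x ((1 - D (clamp r x) mu) / c)).
      { intros x. unfold g. apply (is_derive_ext (fun x => / c * (x - psi x))); [intros; apply Rmult_comm|].
        unfold Rdiv. rewrite Rmult_comm. apply (is_derive_scal (fun x => x - psi x)).
        apply (is_derive_minus (V := R_NormedModule)); [apply (is_derive_id (K := R_AbsRing))|apply E1]. }
      assert (Hgp : forall x, kap / Rabs c <= (1 - D (clamp r x) mu) / c).
      { intros x. replace ((1 - D (clamp r x) mu) / c) with (1 - (D (clamp r x) mu - a) / c) by (unfold c; field; exact Hc0).
        pose proof (B2 (clamp r x) mu (clamp_bound r x (Rlt_le _ _ Hr)) (Rle_trans _ _ _ Hmu (proj2 Hm'))) as V.
        pose proof (Rle_abs ((D (clamp r x) mu - a) / c)) as V2.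
        unfold Rdiv in V2. rewrite Rabs_mult, Rabs_inv in V2.
        replace (kap / Rabs c) with (1 - e * / Rabs c) by (unfold kap; field; lra).
        assert (Rabs (D (clamp r x) mu - a) * / Rabs c <= e * / Rabs c).
        { apply Rmult_le_compat_r; [left; apply Rinv_0_lt_compat; exact Hc|exact V]. }
        unfold Rdiv. lra. }
      assert (Hg0 : Rabs (g 0) <= kap / Rabs c * r).
      { unfold g. rewrite <- E2 by exact Hr0. unfold Rdiv. rewrite Rabs_mult, Rabs_inv.
        rewrite Rminus_0_l, Rabs_Ropp.
        replace (kap * / Rabs c * r) with (kap * r * / Rabs c) by ring.
        apply Rmult_le_compat_r; [left; apply Rinv_0_lt_compat; exact Hc|apply Hm'K; exact Hmu]. }
      apply Rabs_le_between in Hg0.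
      assert (Hgr : 0 <= g r).
      { destruct (MVT_all g _ 0 r Hg) as [z [_ E]]. specialize (Hgp z). cbv beta in E. nra. }
      assert (Hgr' : g (- r) <= 0).
      { destruct (MVT_all g _ (- r) 0 Hg) as [z [_ E]]. specialize (Hgp z). cbv beta in E. nra. }
      destruct (IVT_gen g (- r) r 0) as [x [Hx E]].
      + intros z. apply continuity_pt_filterlim. apply (ex_derive_continuous (V := R_NormedModule)).
        eexists. apply Hg.
      + rewrite Rmin_left, Rmax_right by lra. lra.
      + exists x. intros _. rewrite Rmin_left, Rmax_right in Hx by lra.
        assert (Hxr : Rabs x <= r) by (apply Rabs_le; lra). split; [exact Hxr|].
        rewrite E2 by exact Hxr. unfold g in E.
        apply (f_equal (fun z => z * c)) in E. unfold Rdiv in E.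
        rewrite Rmult_assoc, Rinv_l, Rmult_1_r, Rmult_0_l in E by exact Hc0.
        change (psi x = x). lra. }
  set (X := fun mu => proj1_sig (constructive_indefinite_description _ (Hex mu))).
  assert (HX : forall mu, Rabs mu <= m' -> Rabs (X mu) <= r /\ phi (X mu) mu = X mu).
  { intros mu. unfold X. destruct (constructive_indefinite_description _ (Hex mu)); assumption. }
  assert (HL : forall mu mu', Rabs mu <= m' -> Rabs mu' <= m' ->
    Rabs (X mu - X mu') <= K / kap * Rabs (mu - mu')).
  { intros mu mu' Hmu Hmu'. destruct (HX mu Hmu) as [A1 A2]. destruct (HX mu' Hmu') as [A3 A4].
    pose proof (Hinj mu (X mu) (X mu') ltac:(lra) A1 A3) as V.
    replace (X mu - phi (X mu) mu - (X mu' - phi (X mu') mu)) with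
      (phi (X mu') mu - phi (X mu') mu') in V by (rewrite A2, A4; ring).
    pose proof (B4 (X mu') mu mu' A3 ltac:(lra) ltac:(lra)) as V2.
    apply (Rmult_le_reg_l kap); [exact Hkap|].
    replace (kap * (K / kap * Rabs (mu - mu'))) with (K * Rabs (mu - mu')) by (field; lra). lra. }
  set (L := K / kap) in *. assert (HLp : 0 < L) by (apply Rdiv_lt_0_compat; assumption).
  assert (Hm'0 : Rabs 0 <= m') by (rewrite Rabs_R0; lra).
  assert (X0 : X 0 = 0).
  { destruct (HX 0 Hm'0) as [A1 A2]. pose proof (Hinj 0 (X 0) 0 Hm0 A1 Hr0) as V.
    rewrite A2, H0 in V. replace (X 0 - X 0 - (0 - 0)) with 0 in V by ring.
    rewrite Rabs_R0, Rminus_0_r in V. destruct (Req_dec (X 0) 0) as [|N]; [assumption|].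
    apply Rabs_pos_lt in N. nra. }
  exists X, m', L. split; [exact Hm'|]. split; [exact HLp|]. split; [exact X0|].
  split; [exact HX|]. split; [exact HL|].
  apply is_derive_eps. intros eps Heps.
  set (e1 := eps * Rabs c / 2). assert (He1 : 0 < e1) by (unfold e1; nra).
  set (d := Rmin m' (e1 / (K * (L + 1) * L))).
  assert (HKL : 0 < K * (L + 1) * L) by (apply Rmult_lt_0_compat; [apply Rmult_lt_0_compat; lra|exact HLp]).
  assert (Hd : 0 < d) by (apply Rmin_glb_lt; [lra|apply Rdiv_lt_0_compat; assumption]).
  assert (Hld : locally 0 (fun mu => Rabs mu < d)).
  { exists (mkposreal d Hd). intros u Hu. change (Rabs (u - 0) < d) in Hu. rewrite Rminus_0_r in Hu. exact Hu. }
  generalize (filter_and _ _ Hld (proj1 (is_derive_eps _ _ _) Hb e1 He1)). apply filter_imp.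
  intros mu [Hmu V]. rewrite X0, H0, !Rminus_0_r in *.
  assert (Hmu1 : Rabs mu <= m') by (pose proof (Rmin_l m' (e1 / (K * (L + 1) * L))); fold d in H; lra).
  assert (Hmu2 : Rabs mu <= e1 / (K * (L + 1) * L)) by (pose proof (Rmin_r m' (e1 / (K * (L + 1) * L))); fold d in H; lra).
  destruct (HX mu Hmu1) as [A1 A2].
  assert (A3 : Rabs (X mu) <= L * Rabs mu).
  { pose proof (HL mu 0 Hmu1 Hm'0) as Q. rewrite X0, !Rminus_0_r in Q. exact Q. }
  (* Between 0 and [X mu] the slope differs from [a] by at most [K * (L + 1) * Rabs mu], so the
     linearisation error is quadratic in [mu] and does not affect the derivative. *)
  assert (V3 : Rabs ((phi (X mu) mu - a * X mu) - (phi 0 mu - a * 0)) <= (K * (L + 1) * Rabs mu) * Rabs (X mu - 0)).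
  { apply (lipschitz_on_segment (fun z => phi z mu - a * z) (fun z => D z mu - a)).
    - intros z Hz. apply (segment_in_ball 0 (X mu) r) in Hz; try assumption.
      apply (is_derive_minus (V := R_NormedModule)); [apply B1; lra|].
      evar_last; [apply (is_derive_scal (fun z => z) z a 1); apply (is_derive_id (K := R_AbsRing))|apply Rmult_1_r].
    - intros z Hz. apply (segment_in_ball 0 (X mu) (L * Rabs mu)) in Hz.
      + assert (Rabs z <= r).
        { eapply Rle_trans; [exact Hz|]. apply Rle_trans with (L * m').
          - apply Rmult_le_compat_l; lra.
          - apply Rle_trans with (L * (kap * r / K)).
            + apply Rmult_le_compat_l; [lra|apply Rmin_r].
            + right. unfold L. field. lra. }
        rewrite <- HD. eapply Rle_trans; [apply B3; lra|]. rewrite !Rminus_0_r.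
        rewrite Rmult_assoc. apply Rmult_le_compat_l; lra.
      + rewrite Rabs_R0. apply Rmult_le_pos; [lra|apply Rabs_pos].
      + exact A3. }
  rewrite A2, Rmult_0_r, !Rminus_0_r in V3.
  apply (Rmult_le_reg_l (Rabs c)); [exact Hc|]. rewrite <- Rabs_mult.
  replace (c * (X mu - beta / c * mu)) with ((X mu - a * X mu - phi 0 mu) + (phi 0 mu - beta * mu))
    by (unfold c; field; exact Hc0).
  eapply Rle_trans; [apply Rabs_triang|].
  assert (V4 : K * (L + 1) * Rabs mu * Rabs (X mu) <= e1 * Rabs mu).
  { apply Rle_trans with (K * (L + 1) * Rabs mu * (L * Rabs mu)).
    - apply Rmult_le_compat_l; [|exact A3]. apply Rmult_le_pos; [|apply Rabs_pos].
      apply Rmult_le_pos; lra.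
    - replace (K * (L + 1) * Rabs mu * (L * Rabs mu)) with (K * (L + 1) * L * Rabs mu * Rabs mu) by ring.
      apply Rmult_le_compat_r; [apply Rabs_pos|].
      apply Rle_trans with (K * (L + 1) * L * (e1 / (K * (L + 1) * L))).
      + apply Rmult_le_compat_l; lra.
      + right. field. lra. }
  unfold e1 in *. lra.
Qed.

(** In the Lipschitz constant, [lo * lo] comes from the difference of two reciprocals and the third
    [lo] from the Lipschitz constant of [Fi]. The ratio bound [/ hi] uses that the multiplier of the
    inverse is less than 1. *)
Lemma expansion_inverse_contraction (F DF Fi : R -> R) (lo hi K xs : R) :
  1 < lo -> 0 <= K -> (forall x, is_derive F x (DF x)) -> (forall x, lo <= DF x <= hi) ->
  (forall x y, Rabs (DF x - DF y) <= K * Rabs (x - y)) ->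
  diffeo F Fi -> F xs = xs ->
  contraction (/ lo) (/ hi) (K / (lo * lo * lo)) Fi (fun y => / DF (Fi y)) xs.
Proof.
  intros Hlo HK Hd Hb Hl D Hx.
  assert (Hi : forall y, 0 < / DF (Fi y) <= / lo).
  { intros y. specialize (Hb (Fi y)). split; [apply Rinv_0_lt_compat; lra|apply Rinv_le_contravar; lra]. }
  assert (Hh : forall y, / hi <= / DF (Fi y)).
  { intros y. specialize (Hb (Fi y)). apply Rinv_le_contravar; lra. }
  assert (Hde : forall y, is_derive Fi y (/ DF (Fi y))).
  { intros y. apply (is_derive_inverse F).
    - apply C1_at_continuous, (diffeo_C1' D).
    - apply (diffeo_hk D).
    - specialize (Hb (Fi y)). lra.
    - apply Hd. }
  assert (Hab : forall y, Rabs (/ DF (Fi y)) <= / lo).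
  { intros y. specialize (Hi y). rewrite Rabs_pos_eq; lra. }
  assert (Hlo' : 0 < / lo) by (apply Rinv_0_lt_compat; lra).
  assert (Hlo1 : / lo < 1) by (rewrite <- Rinv_1; apply Rinv_lt_contravar; lra).
  assert (Hfx : Fi xs = xs) by (rewrite <- Hx at 1; apply (diffeo_kh D)).
  split.
  - exact Hde.
  - exact Hab.
  - intros y. specialize (Hh y). specialize (Hi xs). unfold Rdiv.
    apply Rle_trans with (1 := Hh). rewrite <- (Rmult_1_r (/ DF (Fi y))) at 1.
    specialize (Hb (Fi y)). apply Rmult_le_compat_l.
    + left. apply Rinv_0_lt_compat. lra.
    + rewrite <- Rinv_1. apply Rinv_le_contravar; lra.
  - specialize (Hh xs). specialize (Hi xs). rewrite Rabs_pos_eq; lra.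
  - intros x y. pose proof (Hb (Fi x)) as B1. pose proof (Hb (Fi y)) as B2.
    replace (/ DF (Fi x) - / DF (Fi y)) with ((DF (Fi y) - DF (Fi x)) * (/ DF (Fi x) * / DF (Fi y))) by (field; lra).
    rewrite Rabs_mult, (Rabs_pos_eq (/ DF (Fi x) * / DF (Fi y)))
      by (left; apply Rmult_lt_0_compat; apply Rinv_0_lt_compat; lra).
    pose proof (deriv_bound_lipschitz Fi (fun y => / DF (Fi y)) (/ lo) y x Hde Hab) as L1.
    specialize (Hl (Fi y) (Fi x)).
    replace (K / (lo * lo * lo) * Rabs (x - y)) with ((K * (/ lo * Rabs (y - x))) * (/ lo * / lo))
      by (rewrite (Rabs_minus_sym y); field; lra).
    pose proof (Hi x). pose proof (Hi y).
    apply Rmult_le_compat.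
    + apply Rabs_pos.
    + left. apply Rmult_lt_0_compat; lra.
    + eapply Rle_trans; [exact Hl|]. apply Rmult_le_compat_l; assumption.
    + apply Rmult_le_compat; lra.
  - exact Hfx.
Qed.

Lemma slope_lower_bound (F DF : R -> R) (m x y : R) :
  (forall x, is_derive F x (DF x)) -> (forall x, m <= Rabs (DF x)) ->
  m * Rabs (x - y) <= Rabs (F x - F y).
Proof.
  intros H HC. destruct (MVT_all F DF y x H) as [c [_ E]]. rewrite E, Rabs_mult.
  apply Rmult_le_compat_r; [apply Rabs_pos|apply HC].
Qed.

Lemma diffeo_of_signed_deriv (F DF : R -> R) (s m : R) :
  s = 1 \/ s = -1 -> 0 < m ->
  (forall x, is_derive F x (DF x)) -> (forall x, continuous DF x) -> (forall x, m <= s * DF x) ->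
  exists Fi, diffeo F Fi.
Proof.
  intros Hs Hm Hd Hc Hb.
  destruct (diffeo_of_deriv_bound (fun x => s * F x) (fun x => s * DF x) m) as [k D].
  - exact Hm.
  - intros x. apply (is_derive_scal F x s). apply Hd.
  - intros x. apply (continuous_mult (K := R_AbsRing) (fun _ => s) DF); [apply continuous_const|apply Hc].
  - exact Hb.
  - assert (Hss : s * s = 1) by (destruct Hs; subst s; ring).
    exists (fun y => k (s * y)). split.
    + apply (diffeo_kh D).
    + intros y. pose proof (diffeo_hk D (s * y)) as E. cbv beta in E.
      rewrite <- (Rmult_1_l (F _)), <- Hss, Rmult_assoc, E, <- Rmult_assoc, Hss. ring.
    + intros x. apply (C1_at_of_is_derive_all F DF); auto.
    + intros y. apply (C1_at_comp k (fun y => s * y)); [|apply (diffeo_C1' D)].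
      apply (C1_at_of_is_derive_all _ (fun _ => s)); [|apply continuous_const].
      intros u. auto_derive; [exact I|ring].
Qed.

(** The first alternative covers [mu = 0], where both fixed points are at the kink. *)
Definition ratio_within (eta x y : R) : Prop :=
  (x = 0 /\ y = 0) \/ (x <> 0 /\ exp (- eta) <= y / x <= exp eta).

(** [s] is the orientation of the right branch. The two long inequalities are the slope estimates
    for the left and right conjugacies. [Rabs nu <= (1 - k) * p] makes [[-p, p]] invariant under
    [FR], and [Rabs xL + Rabs nu < m * p] places the preimage of [xL] below [p]. *)
Lemma build_branches (lo hi k m K p eta eta0 s nu sR xL xR yL yR : R) (FL DFL FR DFR GL DGL : R -> R) :
  1 < lo -> 0 <= k < 1 -> 0 < m -> m <= k -> 0 <= K ->
  (forall x, is_derive FL x (DFL x)) -> (forall x, lo <= DFL x <= hi) ->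
  (forall x y, Rabs (DFL x - DFL y) <= K * Rabs (x - y)) ->
  (forall x, is_derive GL x (DGL x)) -> (forall x, lo <= DGL x <= hi) ->
  (forall x y, Rabs (DGL x - DGL y) <= K * Rabs (x - y)) ->
  s = 1 \/ s = -1 ->
  (forall x, is_derive FR x (DFR x)) -> (forall x, m <= s * DFR x <= k) ->
  (forall x y, Rabs (DFR x - DFR y) <= K * Rabs (x - y)) ->
  FL 0 = nu -> FR 0 = nu -> GL 0 = nu -> DFL 0 * sR = DGL 0 * DFR 0 ->
  FL xL = xL -> GL yL = yL -> DFL xL = DGL yL ->
  FR xR = xR -> DFR xR = sR -> nu + sR * yR = yR ->
  ratio_within eta0 xL yL -> ratio_within eta0 xR yR ->
  0 < p -> 0 <= eta0 -> eta <= 1 / 2 ->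
  eta0 + K / (lo * lo * lo) / (/ hi * / hi) / (1 - / lo) * (3 * p + 2 * Rabs xL + 2 * Rabs yL) <= eta ->
  eta0 + K / (m * m) / (1 - k) * (3 * p + 2 * Rabs xR + 2 * Rabs yR) <= eta ->
  Rabs nu <= (1 - k) * p ->
  Rabs xL + Rabs nu < m * p ->
  exists FLi FRi GLi hL kL hR kR : R -> R,
    branches p eta k lo nu sR xL xR yL yR FL FLi FR FRi GL GLi hL kL hR kR /\
    (forall x y, lo * Rabs (x - y) <= Rabs (GL x - GL y)) /\
    Rabs sR <= k /\ (0 < sR -> increasing_fun FR) /\ (sR < 0 -> forall x y, x < y -> FR y < FR x) /\
    FRi xL < p.
Proof.
  intros Hlo Hk Hm Hmk HK dFL bFL lFL dGL bGL lGL Hs dFR bFR lFR FL0 FR0 GL0 Hsl fFL fGL eL fFR eR fGR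
    rL rR Hp He0 He smL smR Hnu HxLnu.
  assert (Hss : s * s = 1) by (destruct Hs; subst s; ring).
  assert (Hsa : Rabs s = 1) by (destruct Hs; subst s; [apply Rabs_R1|rewrite Rabs_left; lra]).
  assert (cFL : forall x, continuous DFL x) by (intros x; apply (lipschitz_continuous DFL K); exact lFL).
  assert (cGL : forall x, continuous DGL x) by (intros x; apply (lipschitz_continuous DGL K); exact lGL).
  assert (cFR : forall x, continuous DFR x) by (intros x; apply (lipschitz_continuous DFR K); exact lFR).
  destruct (diffeo_of_deriv_bound FL DFL lo) as [FLi DL]; try assumption; [lra|intros; apply bFL|].
  destruct (diffeo_of_deriv_bound GL DGL lo) as [GLi DGi]; try assumption; [lra|intros; apply bGL|].
  destruct (diffeo_of_signed_deriv FR DFR s m) as [FRi DR]; try assumption; [intros; apply bFR|].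
  assert (iFL : increasing_fun FL) by (apply (increasing_of_deriv FL DFL); [exact dFL|intros x; specialize (bFL x); lra]).
  assert (iGL : increasing_fun GL) by (apply (increasing_of_deriv GL DGL); [exact dGL|intros x; specialize (bGL x); lra]).
  assert (aFR : forall x, Rabs (DFR x) = s * DFR x).
  { intros x. rewrite <- (Rmult_1_l (Rabs _)), <- Hsa, <- Rabs_mult. apply Rabs_pos_eq.
    specialize (bFR x). lra. }
  assert (HsR : m <= s * sR <= k) by (rewrite <- eR; apply bFR).
  assert (HsR0 : sR <> 0) by (intros Z; rewrite Z in HsR; lra).
  assert (HsRa : Rabs sR = s * sR) by (rewrite <- eR; apply aFR).
  assert (contr : forall x y, Rabs (FR x - FR y) <= k * Rabs (x - y)).
  { intros x y. apply (deriv_bound_lipschitz FR DFR); [exact dFR|]. intros u. rewrite aFR. apply bFR. }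
  assert (expa : forall x y, lo * Rabs (x - y) <= Rabs (FL x - FL y)).
  { intros x y. apply (slope_lower_bound FL DFL); [exact dFL|]. intros u. specialize (bFL u).
    rewrite Rabs_pos_eq; lra. }
  assert (expaG : forall x y, lo * Rabs (x - y) <= Rabs (GL x - GL y)).
  { intros x y. apply (slope_lower_bound GL DGL); [exact dGL|]. intros u. specialize (bGL u).
    rewrite Rabs_pos_eq; lra. }
  assert (lowR : forall x y, m * Rabs (x - y) <= Rabs (FR x - FR y)).
  { intros x y. apply (slope_lower_bound FR DFR); [exact dFR|]. intros u. rewrite aFR. apply bFR. }
  assert (Hilo : 0 < / lo) by (apply Rinv_0_lt_compat; lra).
  assert (Hilo1 : / lo < 1) by (rewrite <- Rinv_1; apply Rinv_lt_contravar; lra).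
  assert (Hhi : 0 < hi) by (specialize (bFL 0); lra).
  (* The left branches expand, so their inverses are the contractions to linearise; a conjugacy of
     the inverses conjugates the branches themselves. *)
  destruct (pinned_conjugacy (/ lo) (/ hi) (K / (lo * lo * lo)) eta0
    FLi FL (fun y => / DFL (FLi y)) GLi GL (fun y => / DGL (GLi y)) xL yL)
    as (hL & kL & lL & D1 & dL & hL0 & hLx & hLc & hLz & hLb).
  { lra. } { apply Rinv_0_lt_compat. exact Hhi. }
  { apply Rmult_le_pos; [exact HK|]. left. apply Rinv_0_lt_compat.
    repeat apply Rmult_lt_0_compat; lra. }
  { exact He0. }
  { apply (expansion_inverse_contraction FL DFL); assumption. }
  { apply (diffeo_kh DL). }
  { apply (expansion_inverse_contraction GL DGL); assumption. }
  { apply (diffeo_kh DGi). }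
  { rewrite <- fFL at 1. rewrite (diffeo_kh DL). rewrite <- fGL at 1. rewrite (diffeo_kh DGi).
    rewrite eL. reflexivity. }
  { exact rL. }
  set (GR := fun y => nu + sR * y).
  destruct (pinned_conjugacy k m K eta0 FR FRi DFR GR (fun y => (y - nu) / sR) (fun _ => sR) xR yR)
    as (hR & kR & lR & D2 & dR & hR0 & hRx & hRc & hRz & hRb); try assumption.
  { split; try assumption.
    - intros u. rewrite aFR. apply bFR.
    - intros u. rewrite eR. replace (DFR u / sR) with ((s * DFR u) / (s * sR)).
      + apply (Rmult_le_reg_r (s * sR)); [lra|].
        replace (s * DFR u / (s * sR) * (s * sR)) with (s * DFR u) by (field; split; [exact HsR0|intros Z; rewrite Z in Hsa; rewrite Rabs_R0 in Hsa; lra]).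
        specialize (bFR u). apply Rle_trans with (m * 1); [apply Rmult_le_compat_l; lra|lra].
      + field. split; [exact HsR0|intros Z; rewrite Z in Hsa; rewrite Rabs_R0 in Hsa; lra].
    - rewrite aFR. apply bFR. }
  { apply (diffeo_hk DR). }
  { split.
    - intros u. unfold GR. auto_derive; [exact I|ring].
    - intros _. rewrite HsRa. apply HsR.
    - intros _. rewrite Rdiv_diag by exact HsR0. lra.
    - rewrite HsRa. apply HsR.
    - intros u v. rewrite Rminus_diag, Rabs_R0. apply Rmult_le_pos; [exact HK|apply Rabs_pos].
    - exact fGR. }
  { intros y. unfold GR. field. exact HsR0. }
  assert (DhL : forall x, Derive hL x = exp (lL x)) by (intros x; apply is_derive_unique, dL).
  assert (DhR : forall x, Derive hR x = exp (lR x)) by (intros x; apply is_derive_unique, dR).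
  exists FLi, FRi, GLi, hL, kL, hR, kR. split; [split|split; [|split; [|split; [|split]]]]; try assumption.
  - rewrite (is_derive_unique _ _ _ (dFL 0)), (is_derive_unique _ _ _ (dGL 0)), (is_derive_unique _ _ _ (dFR 0)).
    exact Hsl.
  - apply (increasing_of_deriv hL (fun x => exp (lL x))); [exact dL|intros; apply exp_pos].
  - intros x. rewrite <- (diffeo_hk DGi (hL (FL x))). rewrite <- hLc.
    now rewrite (diffeo_kh DL).
  - apply (increasing_of_deriv hR (fun x => exp (lR x))); [exact dR|intros; apply exp_pos].
  - intros x Hx. specialize (hLb p eta x Hp He smL Hx). apply Rabs_le_between in hLb. rewrite DhL.
    split; apply exp_nondecreasing; lra.
  - intros x Hx. specialize (hRb p eta x Hp He smR Hx). apply Rabs_le_between in hRb. rewrite DhR.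
    split; apply exp_nondecreasing; lra.
  - intros x Hx. specialize (contr x 0). rewrite FR0, Rminus_0_r in contr.
    replace (FR x) with (nu + (FR x - nu)) by ring.
    eapply Rle_trans; [apply Rabs_triang|].
    assert (k * Rabs x <= k * p) by (apply Rmult_le_compat_l; lra). lra.
  (* When [nu = 0] the fixed points of both branches are 0, and both conjugacies have slope [exp 0]
     there. *)
  - intros Z. rewrite DhL, DhR, hLz, hRz; [reflexivity| |].
    + specialize (contr xR 0). rewrite fFR, FR0, Z, !Rminus_0_r in contr.
      destruct (Req_dec xR 0) as [|N]; [assumption|]. apply Rabs_pos_lt in N.
      assert (k * Rabs xR < 1 * Rabs xR) by (apply Rmult_lt_compat_r; lra). lra.
    + specialize (expa xL 0). rewrite fFL, FL0, Z, !Rminus_0_r in expa.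
      destruct (Req_dec xL 0) as [|N]; [assumption|]. apply Rabs_pos_lt in N.
      assert (1 * Rabs xL < lo * Rabs xL) by (apply Rmult_lt_compat_r; lra). lra.
  - rewrite HsRa. apply HsR.
  - intros S. apply (increasing_of_deriv FR DFR); [exact dFR|]. intros x. specialize (bFR x).
    destruct Hs as [-> | ->]; lra.
  - intros S x y L. assert (Q : increasing_fun (fun x => - FR x)).
    { apply (increasing_of_deriv _ (fun x => - DFR x)).
      - intros u. apply (is_derive_opp (V := R_NormedModule)). apply dFR.
      - intros u. specialize (bFR u). destruct Hs as [-> | ->]; lra. }
    specialize (Q x y L). cbv beta in Q. lra.
  - specialize (lowR (FRi xL) 0). rewrite (diffeo_hk DR), FR0, Rminus_0_r in lowR.
    assert (Rabs (xL - nu) <= Rabs xL + Rabs nu)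
      by (unfold Rminus; rewrite <- (Rabs_Ropp nu); apply Rabs_triang).
    apply Rle_lt_trans with (1 := Rle_abs (FRi xL)). apply (Rmult_lt_reg_l m); lra.
Qed.

(** * Difference quotients and continuity in the parameter *)

Definition quot (f : R -> R) (l mu : R) : R := if Req_dec_T mu 0 then l else f mu / mu.

Lemma quot_mul (f : R -> R) (l mu : R) : f 0 = 0 -> quot f l mu * mu = f mu.
Proof.
  intros H. unfold quot. destruct (Req_dec_T mu 0) as [-> | N]; [rewrite H; ring|field; exact N].
Qed.

Lemma quot_0 (f : R -> R) (l : R) : quot f l 0 = l.
Proof. unfold quot. destruct (Req_dec_T 0 0); [reflexivity|contradiction]. Qed.

Lemma quot_continuous_0 (f : R -> R) (l : R) : is_derive f 0 l -> f 0 = 0 -> continuous (quot f l) 0.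
Proof.
  intros D H. apply filterlim_locally. intros eps. pose proof (cond_pos eps) as He.
  assert (He2 : 0 < eps / 2) by lra.
  generalize (proj1 (is_derive_eps _ _ _) D (eps / 2) He2). apply filter_imp.
  intros u Hu. rewrite H, !Rminus_0_r in Hu. change (Rabs (quot f l u - quot f l 0) < eps).
  rewrite quot_0. unfold quot. destruct (Req_dec_T u 0) as [-> | N]; [rewrite Rminus_diag, Rabs_R0; lra|].
  apply Rabs_pos_lt in N as N'.
  replace (f u / u - l) with ((f u - l * u) * / u) by (field; exact N).
  rewrite Rabs_mult, Rabs_inv. apply Rle_lt_trans with (eps / 2); [|lra].
  apply (Rmult_le_reg_r (Rabs u)); [exact N'|]. rewrite Rmult_assoc, Rinv_l by lra. lra.
Qed.

Lemma continuous_Rmult (f g : R -> R) (x : R) :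
  continuous f x -> continuous g x -> continuous (fun u => f u * g u) x.
Proof. intros; apply (continuous_mult (K := R_AbsRing)); assumption. Qed.

Lemma continuous_Rdiv (f g : R -> R) (x : R) :
  continuous f x -> continuous g x -> g x <> 0 -> continuous (fun u => f u / g u) x.
Proof.
  intros Hf Hg N. apply (continuous_Rmult f (fun u => / g u)); [exact Hf|].
  apply (continuous_comp g Rinv); [exact Hg|].
  apply continuity_pt_filterlim. apply (continuity_pt_inv (fun u => u)); [apply continuity_pt_id|exact N].
Qed.

Lemma continuous_Rplus (f g : R -> R) (x : R) :
  continuous f x -> continuous g x -> continuous (fun u => f u + g u) x.
Proof. intros; apply (continuous_plus (V := R_NormedModule)); assumption. Qed.

Lemma continuous_Rminus (f g : R -> R) (x : R) :
  continuous f x -> continuous g x -> continuous (fun u => f u - g u) x.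
Proof. intros; apply (continuous_minus (V := R_NormedModule)); assumption. Qed.

Lemma quot_continuous (f : R -> R) (l mu : R) :
  is_derive f 0 l -> f 0 = 0 -> continuous f mu -> continuous (quot f l) mu.
Proof.
  intros D H C. destruct (Req_dec mu 0) as [-> | N]; [apply quot_continuous_0; assumption|].
  apply (continuous_ext_loc _ (fun u => f u / u)).
  - assert (P : 0 < Rabs mu) by (apply Rabs_pos_lt; exact N).
    exists (mkposreal _ P). intros u Hu. change (Rabs (u - mu) < Rabs mu) in Hu.
    unfold quot. destruct (Req_dec_T u 0) as [-> | N2]; [|reflexivity].
    rewrite Rminus_0_l, Rabs_Ropp in Hu. lra.
  - apply continuous_Rdiv; [exact C|apply continuous_id|exact N].
Qed.

Lemma continuous_locally_near (f : R -> R) (x e : R) :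
  continuous f x -> 0 < e -> locally x (fun u => Rabs (f u - f x) < e).
Proof.
  intros C He. exact (C _ (locally_ball (f x) (mkposreal e He))).
Qed.

Lemma continuous_locally_small (f : R -> R) (e : R) :
  continuous f 0 -> f 0 = 0 -> 0 < e -> locally 0 (fun u => Rabs (f u) < e).
Proof.
  intros C H He. generalize (continuous_locally_near f 0 e C He). apply filter_imp.
  intros u. rewrite H, Rminus_0_r. exact (fun h => h).
Qed.

Lemma continuous_of_local_lipschitz (f : R -> R) (m C x : R) :
  (forall u v, Rabs u <= m -> Rabs v <= m -> Rabs (f u - f v) <= C * Rabs (u - v)) ->
  Rabs x < m -> continuous f x.
Proof.
  intros H Hx. apply (continuous_ext_loc _ (fun u => f (clamp m u))).
  - assert (P : 0 < m - Rabs x) by lra. exists (mkposreal _ P). intros u Hu.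
    change (Rabs (u - x) < m - Rabs x) in Hu. rewrite clamp_id; [reflexivity|].
    replace u with (x + (u - x)) by ring. eapply Rle_trans; [apply Rabs_triang|]. lra.
  - apply (lipschitz_continuous _ (Rmax 0 C)). intros u v.
    assert (Hm : 0 <= m) by (pose proof (Rabs_pos x); lra).
    eapply Rle_trans; [apply H; apply clamp_bound; exact Hm|].
    apply Rle_trans with (Rmax 0 C * Rabs (clamp m u - clamp m v)).
    + apply Rmult_le_compat_r; [apply Rabs_pos|apply Rmax_r].
    + apply Rmult_le_compat_l; [apply Rmax_l|apply clamp_lipschitz].
Qed.

Lemma eq_up_to_O_mu_of_derive (s : R -> R) (c l : R) : is_derive s 0 l -> s 0 = c -> eq_up_to_O_mu s c.
Proof.
  intros D H. exists (Rabs l + 1). generalize (proj1 (is_derive_eps _ _ _) D 1 Rlt_0_1).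
  apply filter_imp. intros u Hu. rewrite H, !Rminus_0_r in Hu.
  replace (s u - c) with (l * u + (s u - c - l * u)) by ring.
  eapply Rle_trans; [apply Rabs_triang|]. rewrite Rabs_mult. lra.
Qed.

(** The factor [mu] cancels in the ratio of the fixed points, which leaves a continuous function
    equal to 1 at the origin; the estimate thus holds for both signs of [mu]. *)
Lemma ratio_within_locally (eta : R) (qx qy x y : R -> R) :
  0 < eta -> continuous qx 0 -> continuous qy 0 -> qx 0 = qy 0 -> qx 0 <> 0 ->
  (forall mu, x mu = qx mu * mu) -> (forall mu, y mu = qy mu * mu) ->
  locally 0 (fun mu => ratio_within eta (x mu) (y mu)).
Proof.
  intros He Cx Cy E N Hx Hy.
  pose proof (continuous_Rdiv qy qx 0 Cy Cx N) as C.
  assert (E1 : qy 0 / qx 0 = 1) by (rewrite <- E; field; exact N).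
  assert (L1 : exp (- eta) < qy 0 / qx 0) by (rewrite E1, <- exp_0; apply exp_increasing; lra).
  assert (L2 : qy 0 / qx 0 < exp eta) by (rewrite E1, <- exp_0; apply exp_increasing; lra).
  pose proof (C _ (locally_gt _ _ L1) : locally 0 (fun u => exp (- eta) < qy u / qx u)) as M1.
  pose proof (C _ (locally_lt _ _ L2) : locally 0 (fun u => qy u / qx u < exp eta)) as M2.
  pose proof (continuous_locally_near qx 0 (Rabs (qx 0)) Cx (Rabs_pos_lt _ N)) as M3.
  generalize (filter_and _ _ (filter_and _ _ M1 M2) M3). apply filter_imp.
  intros mu [[A1 A2] A3]. rewrite Hx, Hy. destruct (Req_dec mu 0) as [-> | Nmu]; [left; split; ring|right].
  assert (N2 : qx mu <> 0).
  { intros Z. rewrite Z, Rminus_0_l, Rabs_Ropp in A3. lra. }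
  split; [apply Rmult_integral_contrapositive_currified; assumption|].
  replace (qy mu * mu / (qx mu * mu)) with (qy mu / qx mu) by (field; split; assumption). lra.
Qed.

Lemma open_interval_around_0_ball (A : R -> Prop) :
  open_interval_around_0 A -> exists d, 0 < d /\ forall x, Rabs x <= d -> A x.
Proof.
  intros [H0 (a & b & H)]. apply H in H0 as H0'. destruct H0' as [Ha Hb].
  assert (Qa : exists d, 0 < d /\ forall x, - d <= x -> Rbar_lt a x).
  { destruct a as [a | |]; simpl in *; [|contradiction|exists 1; split; [lra|intros; exact I]].
    exists (- a / 2). split; [lra|]. intros x Hx. lra. }
  assert (Qb : exists d, 0 < d /\ forall x, x <= d -> Rbar_lt x b).
  { destruct b as [b | |]; simpl in *; [|exists 1; split; [lra|intros; exact I]|contradiction].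
    exists (b / 2). split; [lra|]. intros x Hx. lra. }
  destruct Qa as (d1 & P1 & Q1). destruct Qb as (d2 & P2 & Q2).
  exists (Rmin d1 d2). split; [apply Rmin_glb_lt; assumption|]. intros x Hx.
  apply Rabs_le_between in Hx. pose proof (Rmin_l d1 d2). pose proof (Rmin_r d1 d2).
  apply H. split; [apply Q1; lra|apply Q2; lra].
Qed.

Lemma open_interval_contains_0 (a b : R) : a < 0 < b -> open_interval_around_0 (open_interval a b).
Proof.
  intros H. split; [exact H|]. exists (Finite a), (Finite b). intros x. reflexivity.
Qed.

Lemma piecewise_at_0 (l r : R -> R) : piecewise l r 0 = l 0.
Proof. unfold piecewise. destruct (Rle_dec 0 0); [reflexivity|lra]. Qed.

Lemma is_derive_along_curve (D : R -> R -> R) (X : R -> R) (l1 l2 dX : R) :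
  differentiable_pt_lim D 0 0 l1 l2 -> X 0 = 0 -> is_derive X 0 dX ->
  is_derive (fun mu => D (X mu) mu) 0 (l1 * dX + l2).
Proof.
  intros HD HX H. apply is_derive_Reals. rewrite <- (Rmult_1_r l2).
  apply (derivable_pt_lim_comp_2d D X (fun mu => mu)).
  - rewrite HX. exact HD.
  - apply is_derive_Reals. exact H.
  - apply derivable_pt_lim_id.
Qed.

Lemma box_curve_continuous (phi D : R -> R -> R) (X : R -> R) (a e r m K m' L mu : R) :
  slope_box phi D a e r m K -> 0 <= K -> 0 <= L -> m' <= m ->
  (forall u, Rabs u <= m' -> Rabs (X u) <= r) ->
  (forall u v, Rabs u <= m' -> Rabs v <= m' -> Rabs (X u - X v) <= L * Rabs (u - v)) ->
  Rabs mu < m' -> continuous (fun u => D (X u) u) mu.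
Proof.
  intros B HK HL Hm HX HXL Hmu.
  apply (continuous_of_local_lipschitz _ m' (K * (L + 1))); [|exact Hmu].
  intros u v Hu Hv. eapply Rle_trans; [apply (box_lip B)|]; try lra; auto.
  rewrite Rmult_assoc. apply Rmult_le_compat_l; [exact HK|]. specialize (HXL u v Hu Hv). lra.
Qed.

(** The bound 1/6 makes [3 * eta <= 1 / 2], which keeps [exp (3 * eta)] below 2. The lower estimate
    follows from the upper one because [1 - delta < / (1 + delta)]. *)
Lemma exists_small_exponent (delta : R) : 0 < delta ->
  exists eta, 0 < eta <= 1 / 6 /\ exp (3 * eta) < 1 + delta /\ 1 - delta < exp (- (3 * eta)).
Proof.
  intros Hd. assert (Hln : 0 < ln (1 + delta)) by (rewrite <- ln_1; apply ln_increasing; lra).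
  set (eta := Rmin (1 / 6) (ln (1 + delta) / 4)). exists eta.
  assert (0 < eta) by (apply Rmin_glb_lt; lra).
  assert (eta <= 1 / 6) by apply Rmin_l. assert (eta <= ln (1 + delta) / 4) by apply Rmin_r.
  assert (E : exp (3 * eta) < 1 + delta).
  { rewrite <- (exp_ln (1 + delta)) by lra. apply exp_increasing. lra. }
  split; [lra|]. split; [exact E|]. rewrite exp_Ropp.
  apply Rlt_le_trans with (/ (1 + delta)).
  - apply (Rmult_lt_reg_r (1 + delta)); [lra|]. rewrite Rinv_l by lra. nra.
  - apply Rinv_le_contravar; [apply exp_pos|lra].
Qed.

(** * Fitting the normal form and choosing the neighbourhoods *)

Theorem theorem2p2 :
  forall (Omega J : R -> Prop) (fL fR : R -> R -> R) (aL aR beta : R),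
    open_interval_around_0 Omega ->
    open_interval_around_0 J ->
    piecewise_Ck 3 Omega J fL fR ->
    (forall mu, J mu -> fL 0 mu = fR 0 mu) ->
    fL 0 0 = 0 ->
    fR 0 0 = 0 ->
    is_derive (fun x => fL x 0) 0 aL ->
    is_derive (fun x => fR x 0) 0 aR ->
    is_derive (fun mu => fL 0 mu) 0 beta ->
    is_derive (fun mu => fR 0 mu) 0 beta ->
    0 < beta ->
    1 < aL ->
    0 < Rabs aR < 1 ->
    exists sL sR t : R -> R,
      eq_up_to_O_mu sL aL /\
      eq_up_to_O_mu sR aR /\
      (exists (mu0 : R) (N : R -> Prop) (M : R -> R -> Prop),
         conjugacies Omega J fL fR aR sL sR t mu0 N M) /\
      (forall delta : R, 0 < delta ->
         exists (mu0 p : R) (qm qp : R -> R),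
           conjugacies Omega J fL fR aR sL sR t mu0
             (open_interval (- p) p)
             (fun mu => open_interval (qm mu) (qp mu)) /\
           (forall mu, - mu0 < mu < mu0 ->
              (1 - delta) * p < Rabs (qm mu) < (1 + delta) * p /\
              (1 - delta) * p < Rabs (qp mu) < (1 + delta) * p)).
Proof.
  intros Omega J fL fR aL aR beta HOm HJ [HCL HCR] Heq HfL HfR HaL HaR HbL HbR Hbeta H1 H2.
  pose proof HOm as [HOm0 _]. pose proof HJ as [HJ0 _].
  destruct (open_interval_around_0_ball _ HOm) as (dO & HdO & HOball).
  destruct (open_interval_around_0_ball _ HJ) as (dJ & HdJ & HJball).
  destruct (slope_box_of_C3 fL aL) as (DL & DL0 & (l1 & l2 & DLd) & KL & HKL & BL);
    [apply HCL; split; [exact HOm0|split; [exact HJ0|lra]]|exact HaL|].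
  destruct (slope_box_of_C3 fR aR) as (DR & DR0 & (r1 & r2 & DRd) & KR & HKR & BR);
    [apply HCR; split; [exact HOm0|split; [exact HJ0|lra]]|exact HaR|].
  (* These tolerances keep the left slopes above [(1 + aL) / 2 > 1], and the right ones of constant
     sign with modulus between [Rabs aR / 2] and [(1 + Rabs aR) / 2 < 1]. *)
  set (eL := (aL - 1) / 2). set (eR := Rmin (Rabs aR) (1 - Rabs aR) / 2).
  assert (HeL : 0 < eL) by (unfold eL; lra).
  assert (HeR : 0 < eR) by (unfold eR; assert (0 < Rmin (Rabs aR) (1 - Rabs aR)) by (apply Rmin_glb_lt; lra); lra).
  assert (HeR1 : eR <= Rabs aR / 2) by (unfold eR; pose proof (Rmin_l (Rabs aR) (1 - Rabs aR)); lra).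
  assert (HeR2 : eR <= (1 - Rabs aR) / 2) by (unfold eR; pose proof (Rmin_r (Rabs aR) (1 - Rabs aR)); lra).
  destruct (BL eL HeL) as (dL & HdL & BL1). destruct (BR eR HeR) as (dR & HdR & BR1). clear BL BR.
  set (K := KL + KR). assert (HK : 0 < K) by (unfold K; lra).
  set (r := Rmin (Rmin dL dR) (Rmin dO dJ)).
  assert (Hr : 0 < r) by (unfold r; repeat apply Rmin_glb_lt; assumption).
  assert (r <= dL /\ r <= dR /\ r <= dO /\ r <= dJ) as (HrL & HrR & HrO & HrJ).
  { unfold r. pose proof (Rmin_l (Rmin dL dR) (Rmin dO dJ)). pose proof (Rmin_r (Rmin dL dR) (Rmin dO dJ)).
    pose proof (Rmin_l dL dR). pose proof (Rmin_r dL dR). pose proof (Rmin_l dO dJ). pose proof (Rmin_r dO dJ).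
    lra. }
  assert (BoxL : slope_box fL DL aL eL r r K) by (apply (slope_box_mono _ _ _ _ _ _ _ _ _ _ BL1); unfold K; lra).
  assert (BoxR : slope_box fR DR aR eR r r K) by (apply (slope_box_mono _ _ _ _ _ _ _ _ _ _ BR1); unfold K; lra).
  assert (H1aR : 1 - Rabs aR <= 1 - aR) by (pose proof (Rle_abs aR); lra).
  destruct (implicit_fixed_point fL DL aL eL r r K beta) as (XL & mL & LL & HmL & HLL & XL0 & XLf & XLl & XLd);
    try assumption; [rewrite Rabs_left; unfold eL; lra|].
  destruct (implicit_fixed_point fR DR aR eR r r K beta) as (XR & mR' & LR & HmR & HLR & XR0 & XRf & XRl & XRd);
    try assumption; [rewrite Rabs_pos_eq; lra|].
  set (m := Rmin mL mR').
  assert (Hm : 0 < m) by (apply Rmin_glb_lt; lra).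
  assert (HmmL : m <= mL) by apply Rmin_l. assert (HmmR : m <= mR') by apply Rmin_r.
  set (nu := fun mu => fL 0 mu).
  set (lam := fun mu => DL (XL mu) mu). set (sR := fun mu => DR (XR mu) mu).
  set (sL := fun mu => sR mu * DL 0 mu / DR 0 mu).
  assert (Hr0 : Rabs 0 <= r) by (rewrite Rabs_R0; lra).
  assert (aR0 : aR <> 0) by (intros Z; rewrite Z, Rabs_R0 in H2; lra).
  assert (DRn : forall mu, Rabs mu <= r -> DR 0 mu <> 0).
  { intros mu Hmu Z. pose proof (box_near BoxR 0 mu Hr0 Hmu) as V.
    rewrite Z, Rminus_0_l, Rabs_Ropp in V. lra. }
  assert (lam0 : lam 0 = aL) by (unfold lam; rewrite XL0; exact DL0).
  assert (sR0 : sR 0 = aR) by (unfold sR; rewrite XR0; exact DR0).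
  assert (sL0 : sL 0 = aL) by (unfold sL; rewrite sR0, DL0, DR0; field; exact aR0).
  assert (Clam : forall mu, Rabs mu < m -> continuous lam mu).
  { intros mu Hmu. apply (box_curve_continuous fL DL XL aL eL r r K m LL); try lra; auto.
    - intros u Hu. apply XLf. lra.
    - intros u v Hu Hv. apply XLl; lra. }
  assert (CsR : forall mu, Rabs mu < m -> continuous sR mu).
  { intros mu Hmu. apply (box_curve_continuous fR DR XR aR eR r r K m LR); try lra; auto.
    - intros u Hu. apply XRf. lra.
    - intros u v Hu Hv. apply XRl; lra. }
  assert (CDL0 : forall mu, Rabs mu < m -> continuous (fun u => DL 0 u) mu).
  { intros mu Hmu. apply (box_curve_continuous fL DL (fun _ => 0) aL eL r r K m 0); try lra; auto.
    intros u v _ _. rewrite Rminus_diag, Rabs_R0. lra. }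
  assert (CDR0 : forall mu, Rabs mu < m -> continuous (fun u => DR 0 u) mu).
  { intros mu Hmu. apply (box_curve_continuous fR DR (fun _ => 0) aR eR r r K m 0); try lra; auto.
    intros u v _ _. rewrite Rminus_diag, Rabs_R0. lra. }
  assert (CsL : forall mu, Rabs mu < m -> continuous sL mu).
  { intros mu Hmu. apply (continuous_Rdiv (fun u => sR u * DL 0 u) (fun u => DR 0 u)); auto.
    - apply (continuous_Rmult sR (fun u => DL 0 u)); auto.
    - apply DRn. lra. }
  assert (Cnu : forall mu, Rabs mu < m -> continuous nu mu).
  { intros mu Hmu. apply (continuous_of_local_lipschitz _ m K); [|exact Hmu].
    intros u v Hu Hv. apply (box_mu BoxL); lra. }
  assert (Hm0 : Rabs 0 < m) by (rewrite Rabs_R0; exact Hm).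
  pose proof (is_derive_along_curve DL XL l1 l2 _ DLd XL0 XLd) as Dlam.
  pose proof (is_derive_along_curve DR XR r1 r2 _ DRd XR0 XRd) as DsR.
  assert (DDL0 : is_derive (fun mu => DL 0 mu) 0 (l1 * 0 + l2)).
  { apply (is_derive_along_curve DL (fun _ => 0)); [exact DLd|reflexivity|apply (is_derive_const (V := R_NormedModule))]. }
  assert (DDR0 : is_derive (fun mu => DR 0 mu) 0 (r1 * 0 + r2)).
  { apply (is_derive_along_curve DR (fun _ => 0)); [exact DRd|reflexivity|apply (is_derive_const (V := R_NormedModule))]. }
  assert (DsL : exists l, is_derive sL 0 l).
  { eexists. apply (is_derive_div (fun u => sR u * DL 0 u) (fun u => DR 0 u)).
    - apply (is_derive_mult sR (fun u => DL 0 u)); [exact DsR|exact DDL0|intros; apply Rmult_comm].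
    - exact DDR0.
    - apply DRn. rewrite Rabs_R0. lra. }
  destruct DsL as [dsL DsL].
  (* Numerator and denominator of [t] both vanish at [mu = 0]; replacing [lam - sL] and [nu] by
     their quotients by [mu] removes the singularity, and the new denominator is [2 * beta]
     there. *)
  set (q1 := quot (fun u => lam u - sL u) (l1 * (beta / (1 - aL)) + l2 - dsL)).
  set (q2 := quot nu beta).
  set (w := fun mu => 1 - (sL mu + lam mu) / 2).
  set (t := fun mu => q1 mu * w mu / (2 * q2 mu)).
  assert (D1 : is_derive (fun u => lam u - sL u) 0 (l1 * (beta / (1 - aL)) + l2 - dsL))
    by (apply (is_derive_minus (V := R_NormedModule)); assumption).
  assert (D10 : lam 0 - sL 0 = 0) by lra.
  assert (nu0 : nu 0 = 0) by exact HfL.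
  assert (Cq1 : forall mu, Rabs mu < m -> continuous q1 mu).
  { intros mu Hmu. apply quot_continuous; [exact D1|exact D10|].
    apply (continuous_Rminus lam sL); auto. }
  assert (Cq2 : forall mu, Rabs mu < m -> continuous q2 mu)
    by (intros mu Hmu; apply quot_continuous; auto).
  assert (Cw : forall mu, Rabs mu < m -> continuous w mu).
  { intros mu Hmu. apply (continuous_Rminus (fun _ => 1)); [apply continuous_const|].
    apply (continuous_Rdiv (fun u => sL u + lam u) (fun _ => 2)); [|apply continuous_const|lra].
    apply (continuous_Rplus sL lam); auto. }
  assert (q20 : q2 0 = beta) by apply quot_0.
  assert (w0 : w 0 = 1 - aL) by (unfold w; rewrite sL0, lam0; field).
  assert (Ct : forall mu, Rabs mu < m -> q2 mu <> 0 -> continuous t mu).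
  { intros mu Hmu N. apply (continuous_Rdiv (fun u => q1 u * w u) (fun u => 2 * q2 u)).
    - apply (continuous_Rmult q1 w); auto.
    - apply (continuous_Rmult (fun _ => 2) q2); auto. apply continuous_const.
    - lra. }
  (* Requiring slope [sL + 2 * t * yL = lam] gives [t * yL = (lam - sL) / 2]; substituted into the
     fixed point equation of the quadratic branch, this leaves [nu = yL * w]. *)
  set (yL := fun mu => nu mu / w mu). set (yR := fun mu => nu mu / (1 - sR mu)).
  assert (Q1 : forall mu, q1 mu * mu = lam mu - sL mu)
    by (intros mu; exact (quot_mul (fun u => lam u - sL u) _ mu D10)).
  assert (Q2 : forall mu, q2 mu * mu = nu mu) by (intros mu; exact (quot_mul nu _ mu nu0)).
  assert (sR1 : 1 - sR 0 <> 0) by (rewrite sR0; lra).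
  assert (w1 : w 0 <> 0) by lra.
  assert (C1sR : continuous (fun u => 1 - sR u) 0)
    by (apply (continuous_Rminus (fun _ => 1) sR); [apply continuous_const|auto]).
  assert (CyL : continuous yL 0) by (apply (continuous_Rdiv nu w); auto).
  assert (CyR : continuous yR 0) by (apply (continuous_Rdiv nu (fun u => 1 - sR u)); auto).
  assert (CXL : continuous XL 0) by (apply (ex_derive_continuous (V := R_NormedModule)); eexists; exact XLd).
  assert (CXR : continuous XR 0) by (apply (ex_derive_continuous (V := R_NormedModule)); eexists; exact XRd).
  assert (yL0 : yL 0 = 0) by (unfold yL; rewrite nu0; unfold Rdiv; ring).
  assert (yR0 : yR 0 = 0) by (unfold yR; rewrite nu0; unfold Rdiv; ring).
  set (T0 := Rabs (t 0) + 1). assert (HT0 : 0 < T0) by (unfold T0; pose proof (Rabs_pos (t 0)); lra).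
  (* On [[-rr, rr]] the quadratic term changes the slope by at most [eL / 2]; with [sL] within
     [eL / 2] of [aL], the left branch of the normal form obeys the same slope bounds as that of
     [f]. *)
  set (rr := Rmin r (eL / (4 * T0))).
  assert (Hrr : 0 < rr) by (apply Rmin_glb_lt; [exact Hr|apply Rdiv_lt_0_compat; lra]).
  assert (Hrr1 : rr <= r) by apply Rmin_l.
  assert (Hrr2 : T0 * rr <= eL / 4).
  { apply Rle_trans with (T0 * (eL / (4 * T0))); [apply Rmult_le_compat_l; [lra|apply Rmin_r]|].
    right. field. lra. }
  set (lo := aL - eL). set (hi := aL + eL). set (k := (1 + Rabs aR) / 2). set (mm := Rabs aR / 2).
  (* A common Lipschitz constant for the slopes of [f] and of the quadratic branch. *)
  set (KF := Rmax K (2 * T0)).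
  assert (HKF1 : K <= KF) by apply Rmax_l. assert (HKF2 : 2 * T0 <= KF) by apply Rmax_r.
  assert (Hlo : 1 < lo) by (unfold lo, eL; lra).
  assert (Hk : 0 <= k < 1) by (unfold k; lra).
  set (CL := KF / (lo * lo * lo) / (/ hi * / hi) / (1 - / lo)).
  set (CR := KF / (mm * mm) / (1 - k)).
  assert (HCL0 : 0 <= CL).
  { unfold CL. assert (0 < hi) by (unfold hi; lra).
    assert (/ lo < 1) by (rewrite <- Rinv_1; apply Rinv_lt_contravar; lra).
    repeat (apply Rmult_le_pos; [|left; apply Rinv_0_lt_compat]); try lra.
    - repeat apply Rmult_lt_0_compat; lra.
    - apply Rmult_lt_0_compat; apply Rinv_0_lt_compat; assumption. }
  assert (HCR0 : 0 <= CR).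
  { unfold CR. repeat (apply Rmult_le_pos; [|left; apply Rinv_0_lt_compat]); try lra.
    apply Rmult_lt_0_compat; unfold mm; lra. }
  assert (HE : forall mu, pw_map fL fR 0 mu = nu mu) by (intros mu; apply piecewise_at_0).
  (* [sL], [sR] and [t] are fixed before [delta]; only [mu0], [p] and the ends of [M mu] depend on
     it. *)
  assert (Main : forall delta : R, 0 < delta ->
         exists (mu0 p : R) (qm qp : R -> R),
           conjugacies Omega J fL fR aR sL sR t mu0
             (open_interval (- p) p)
             (fun mu => open_interval (qm mu) (qp mu)) /\
           (forall mu, - mu0 < mu < mu0 ->
              (1 - delta) * p < Rabs (qm mu) < (1 + delta) * p /\
              (1 - delta) * p < Rabs (qp mu) < (1 + delta) * p)).
  { intros delta Hdelta.
    destruct (exists_small_exponent delta Hdelta) as (eta & Heta & Hdel1 & Hdel2).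
    (* The budget for [eta]: the ratios of the fixed points take [eta / 2]; after multiplication by
       [CL] or [CR], the term [3 * p] costs at most [eta / 4], and the fixed points, each below
       [ce], cost at most another [eta / 4]. The bound [rr / 2] keeps [M mu], whose ends have
       modulus below [2 * p], inside [[-rr, rr]]. *)
    set (p := Rmin (rr / 2) (eta / (12 * (CL + CR + 1)))).
    assert (Hp : 0 < p) by (apply Rmin_glb_lt; [lra|apply Rdiv_lt_0_compat; lra]).
    assert (Hp1 : p <= rr / 2) by apply Rmin_l.
    assert (Hp2 : (CL + CR + 1) * p <= eta / 12).
    { apply Rle_trans with ((CL + CR + 1) * (eta / (12 * (CL + CR + 1)))).
      - apply Rmult_le_compat_l; [lra|apply Rmin_r].
      - right. field. lra. }
    pose proof (exp_lt_2 (3 * eta) ltac:(lra)) as Hexp2.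
    set (ce := eta / (16 * (CL + CR + 1))).
    assert (Hce : 0 < ce) by (apply Rdiv_lt_0_compat; lra).
    assert (Hce1 : (CL + CR + 1) * ce = eta / 16) by (unfold ce; field; lra).
    (* Respectively: the slope budget, fixed points inside [N], invariance of [[-p, p]] under the
       right branch, and the preimage of [xL] below [p]. *)
    set (e0 := Rmin (Rmin ce (p / 2)) (Rmin ((1 - k) * p) (mm * p / 2))).
    assert (Hmmp : 0 < mm * p) by (apply Rmult_lt_0_compat; unfold mm; lra).
    assert (Hkp : 0 < (1 - k) * p) by (apply Rmult_lt_0_compat; lra).
    assert (He0 : 0 < e0) by (unfold e0; repeat apply Rmin_glb_lt; lra).
    assert (e0 <= ce /\ e0 <= p / 2 /\ e0 <= (1 - k) * p /\ e0 <= mm * p / 2) as (E1 & E2 & E3 & E4).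
    { unfold e0. pose proof (Rmin_l (Rmin ce (p / 2)) (Rmin ((1 - k) * p) (mm * p / 2))).
      pose proof (Rmin_r (Rmin ce (p / 2)) (Rmin ((1 - k) * p) (mm * p / 2))).
      pose proof (Rmin_l ce (p / 2)). pose proof (Rmin_r ce (p / 2)).
      pose proof (Rmin_l ((1 - k) * p) (mm * p / 2)). pose proof (Rmin_r ((1 - k) * p) (mm * p / 2)). lra. }
    assert (Near : locally 0 (fun mu =>
      (Rabs mu < m /\ 0 < q2 mu /\ w mu < 0 /\ Rabs (t mu) <= T0 /\ Rabs (sL mu - aL) <= eL / 2) /\
      (Rabs (XL mu) < e0 /\ Rabs (XR mu) < e0 /\ Rabs (yL mu) < e0 /\ Rabs (yR mu) < e0 /\ Rabs (nu mu) < e0) /\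
      ratio_within (eta / 2) (XL mu) (yL mu) /\ ratio_within (eta / 2) (XR mu) (yR mu))).
    { assert (Ct0 : continuous t 0) by (apply Ct; [exact Hm0|lra]).
      apply filter_and; [|apply filter_and; [|apply filter_and]].
      - repeat apply filter_and.
        + exact (continuous_locally_small (fun u => u) m (continuous_id 0) eq_refl Hm).
        + assert (P : 0 < q2 0) by lra. exact (Cq2 0 Hm0 _ (locally_gt _ _ P)).
        + assert (P : w 0 < 0) by lra. exact (Cw 0 Hm0 _ (locally_lt _ _ P)).
        + generalize (continuous_locally_near t 0 1 Ct0 Rlt_0_1). apply filter_imp.
          intros u Hu. replace (t u) with (t 0 + (t u - t 0)) by ring.
          eapply Rle_trans; [apply Rabs_triang|]. unfold T0. lra.
        + assert (P : 0 < eL / 2) by lra.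
          generalize (continuous_locally_near sL 0 (eL / 2) (CsL 0 Hm0) P). apply filter_imp.
          intros u Hu. rewrite sL0 in Hu. lra.
      - repeat apply filter_and; apply continuous_locally_small; auto.
      - apply (ratio_within_locally _ (quot XL (beta / (1 - aL))) (fun u => q2 u / w u)).
        + lra.
        + apply quot_continuous_0; assumption.
        + apply (continuous_Rdiv q2 w); auto.
        + rewrite quot_0, q20, w0. reflexivity.
        + rewrite quot_0. unfold Rdiv. apply Rmult_integral_contrapositive_currified; [lra|apply Rinv_neq_0_compat; lra].
        + intros u. symmetry. apply quot_mul. exact XL0.
        + intros u. unfold yL. rewrite <- Q2. unfold Rdiv. ring.
      - apply (ratio_within_locally _ (quot XR (beta / (1 - aR))) (fun u => q2 u / (1 - sR u))).
        + lra.
        + apply quot_continuous_0; assumption.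
        + apply (continuous_Rdiv q2 (fun u => 1 - sR u)); auto.
        + rewrite quot_0, q20, sR0. reflexivity.
        + rewrite quot_0. unfold Rdiv. apply Rmult_integral_contrapositive_currified; [lra|apply Rinv_neq_0_compat; lra].
        + intros u. symmetry. apply quot_mul. exact XR0.
        + intros u. unfold yR. rewrite <- Q2. unfold Rdiv. ring. }
    destruct Near as [mu0 Near].
    assert (Near' : forall mu, - mu0 < mu < mu0 -> ball 0 mu0 mu).
    { intros mu Hmu. change (Rabs (mu - 0) < mu0). rewrite Rminus_0_r. apply Rabs_def1; lra. }
    set (s := if Rlt_dec 0 aR then 1 else -1).
    assert (Hs : s = 1 \/ s = -1) by (unfold s; destruct (Rlt_dec 0 aR); auto).
    assert (Hsa : s * aR = Rabs aR).
    { unfold s. destruct (Rlt_dec 0 aR); [rewrite Rabs_pos_eq; lra|rewrite Rabs_left1; lra]. }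
    (* The two ends of [M mu] are packed into a pair so that [epsilon] can select them together for
       each [mu]. *)
    set (P := fun (mu : R) (qq : R * R) =>
      (exp (- (3 * eta)) * p <= - fst qq <= exp (3 * eta) * p) /\
      (exp (- (3 * eta)) * p <= snd qq <= exp (3 * eta) * p) /\
      conjugacies_at p (nu mu) (sL mu) (sR mu) (t mu) (XL mu) (XR mu) (yL mu) (yR mu)
        (fun x => pw_map fL fR x mu) (fun x => fR x mu) (fst qq) (snd qq)).
    assert (Loc : forall mu, - mu0 < mu < mu0 -> exists qq : R * R, P mu qq).
    { intros mu Hmu.
      destruct (Near mu (Near' mu Hmu)) as
        ((N1 & N2 & N3 & N4 & N5) & (S1 & S2 & S3 & S4 & S5) & R1 & R2).
      assert (Hmur : Rabs mu <= r) by lra.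
      destruct (affine_ext_spec rr K (fun x => fL x mu) (fun x => DL x mu)) as (FLd & FLe & FLl).
      { exact Hrr. }
      { intros x Hx. apply (box_deriv BoxL); lra. }
      { intros x y Hx Hy. eapply Rle_trans; [apply (box_lip BoxL); lra|].
        rewrite Rminus_diag, Rabs_R0, Rplus_0_r. lra. }
      destruct (affine_ext_spec rr K (fun x => fR x mu) (fun x => DR x mu)) as (FRd & FRe & FRl).
      { exact Hrr. }
      { intros x Hx. apply (box_deriv BoxR); lra. }
      { intros x y Hx Hy. eapply Rle_trans; [apply (box_lip BoxR); lra|].
        rewrite Rminus_diag, Rabs_R0, Rplus_0_r. lra. }
      destruct (affine_ext_spec rr (2 * T0) (fun y => nu mu + sL mu * y + t mu * y ^ 2)
        (fun y => sL mu + 2 * t mu * y)) as (GLd & GLe & GLl).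
      { exact Hrr. }
      { intros x Hx. auto_derive; [exact I|ring]. }
      { intros x y Hx Hy. replace (sL mu + 2 * t mu * x - (sL mu + 2 * t mu * y)) with (2 * t mu * (x - y)) by ring.
        rewrite !Rabs_mult, (Rabs_pos_eq 2) by lra. apply Rmult_le_compat_r; [apply Rabs_pos|lra]. }
      set (FL := affine_ext rr (fun x => fL x mu) (fun x => DL x mu)) in *.
      set (FR := affine_ext rr (fun x => fR x mu) (fun x => DR x mu)) in *.
      set (GL := affine_ext rr (fun y => nu mu + sL mu * y + t mu * y ^ 2) (fun y => sL mu + 2 * t mu * y)) in *.
      assert (Hc : forall x, Rabs (clamp rr x) <= rr) by (intros x; apply clamp_bound; lra).
      assert (Hc0 : clamp rr 0 = 0) by (apply clamp_id; rewrite Rabs_R0; lra).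
      assert (HcXL : clamp rr (XL mu) = XL mu) by (apply clamp_id; lra).
      assert (HcXR : clamp rr (XR mu) = XR mu) by (apply clamp_id; lra).
      assert (HcyL : clamp rr (yL mu) = yL mu) by (apply clamp_id; lra).
      destruct (XLf mu ltac:(lra)) as [_ XLe]. destruct (XRf mu ltac:(lra)) as [_ XRe].
      assert (Hty : 2 * t mu * yL mu = lam mu - sL mu).
      { rewrite <- Q1. unfold t, yL. rewrite <- Q2. field. split; lra. }
      assert (Hr00 : Rabs 0 <= rr) by (rewrite Rabs_R0; lra).
      assert (HfRnu : fR 0 mu = nu mu) by (symmetry; apply Heq, HJball; lra).
      assert (HsRn : Rabs (sR mu - aR) <= eR) by (apply (box_near BoxR); lra).
      assert (HKLip : forall C x y, C <= KF -> Rmax 0 C * Rabs (x - y) <= KF * Rabs (x - y)).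
      { intros C x y HC. apply Rmult_le_compat_r; [apply Rabs_pos|]. apply Rmax_lub; lra. }
      assert (Hsub : forall c, 0 <= c <= CL + CR + 1 -> forall u v, Rabs u < e0 -> Rabs v < e0 ->
        eta / 2 + c * (3 * p + 2 * Rabs u + 2 * Rabs v) <= eta).
      { intros c Hc' u v Hu Hv.
        assert (c * (3 * p + 2 * Rabs u + 2 * Rabs v) <= (CL + CR + 1) * (3 * p + 4 * ce)).
        { pose proof (Rabs_pos u). pose proof (Rabs_pos v). apply Rmult_le_compat; lra. }
        lra. }
      assert (HGLfix : GL (yL mu) = yL mu).
      { rewrite <- GLe by lra.
        replace (nu mu + sL mu * yL mu + t mu * yL mu ^ 2)
          with (nu mu + yL mu * (sL mu + 2 * t mu * yL mu / 2)) by field.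
        rewrite Hty. replace (nu mu) with (yL mu * w mu) at 1 by (unfold yL; field; lra). unfold w. field. }
      destruct (build_branches lo hi k mm KF p eta (eta / 2) s (nu mu) (sR mu) (XL mu) (XR mu) (yL mu) (yR mu)
        FL (fun x => DL (clamp rr x) mu) FR (fun x => DR (clamp rr x) mu)
        GL (fun y => sL mu + 2 * t mu * clamp rr y))
        as (FLi & FRi & GLi & hL & kL & hR & kR & Br & G1 & G2 & G3 & G4 & G5).
      { exact Hlo. } { exact Hk. } { unfold mm; lra. } { unfold mm, k; lra. } { lra. }
      { exact FLd. }
      { intros x. pose proof (box_near BoxL (clamp rr x) mu) as V.
        specialize (Hc x). specialize (V ltac:(lra) Hmur). apply Rabs_le_between in V. unfold lo, hi. lra. }
      { intros x y. eapply Rle_trans; [apply FLl|apply HKLip; exact HKF1]. }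
      { exact GLd. }
      { intros x. specialize (Hc x).
        assert (V : Rabs (2 * t mu * clamp rr x) <= eL / 2).
        { rewrite !Rabs_mult, (Rabs_pos_eq 2) by lra.
          assert (Rabs (t mu) * Rabs (clamp rr x) <= T0 * rr)
            by (apply Rmult_le_compat; try apply Rabs_pos; lra).
          rewrite Rmult_assoc. lra. }
        apply Rabs_le_between in V. apply Rabs_le_between in N5. unfold lo, hi. lra. }
      { intros x y. eapply Rle_trans; [apply GLl|apply HKLip; exact HKF2]. }
      { exact Hs. }
      { exact FRd. }
      { intros x. pose proof (box_near BoxR (clamp rr x) mu) as V.
        specialize (Hc x). specialize (V ltac:(lra) Hmur). apply Rabs_le_between in V.
        unfold mm, k. destruct Hs as [-> | ->]; lra. }
      { intros x y. eapply Rle_trans; [apply FRl|apply HKLip; exact HKF1]. }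
      { rewrite <- FLe by exact Hr00. reflexivity. }
      { rewrite <- FRe by exact Hr00. exact HfRnu. }
      { rewrite <- GLe by exact Hr00. ring. }
      { cbv beta. rewrite !Hc0. rewrite Rmult_0_r, Rplus_0_r. unfold sL. field. apply DRn. exact Hmur. }
      { rewrite <- FLe by lra. exact XLe. }
      { exact HGLfix. }
      { cbv beta. rewrite HcXL, HcyL, Hty. unfold lam. ring. }
      { rewrite <- FRe by lra. exact XRe. }
      { cbv beta. rewrite HcXR. reflexivity. }
      { unfold yR. field. apply Rabs_le_between in HsRn. pose proof (Rle_abs aR). lra. }
      { exact R1. } { exact R2. } { exact Hp. } { lra. } { lra. }
      { fold CL. apply Hsub; try assumption. lra. }
      { fold CR. apply Hsub; try assumption. lra. }
      { lra. } { lra. }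
      assert (E2p : exp (3 * eta) * p <= rr).
      { apply Rle_trans with (2 * p); [apply Rmult_le_compat_r|]; lra. }
      destruct (local_conjugacies p rr eta k lo (nu mu) (sL mu) (sR mu) (t mu) (XL mu) (XR mu) (yL mu) (yR mu)
        (fun x => fL x mu) (fun x => fR x mu) FL FLi FR FRi GL GLi hL kL hR kR Br)
        as (qm & qp & C1 & C2 & C3); try assumption; try lra.
      { unfold yR. field. apply Rabs_le_between in HsRn. pose proof (Rle_abs aR). lra. }
      exists (qm, qp). split; [exact C1|]. split; [exact C2|exact C3]. }
    set (qq := fun mu => epsilon (inhabits (0, 0)) (P mu)).
    assert (Lq : forall mu, - mu0 < mu < mu0 -> P mu (qq mu))
      by (intros mu Hmu; apply epsilon_spec; apply Loc; exact Hmu).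
    exists mu0, p, (fun mu => fst (qq mu)), (fun mu => snd (qq mu)).
    pose proof (exp_pos (- (3 * eta))) as Hep.
    assert (Hepp : 0 < exp (- (3 * eta)) * p) by (apply Rmult_lt_0_compat; assumption).
    split.
    - unfold conjugacies. cbv zeta. split; [apply cond_pos|]. split; [|split; [|split; [|split; [|split]]]].
      + intros mu Hmu. destruct (Near mu (Near' mu Hmu)) as ((N1 & N2 & _) & _).
        split; [apply HJball; lra|]. split; [auto|]. split; [auto|]. apply Ct; [exact N1|lra].
      + apply open_interval_contains_0. lra.
      + intros x Hx. unfold open_interval in Hx. apply HOball. apply Rabs_le. lra.
      + intros mu Hmu. destruct (Lq mu Hmu) as (A1 & A2 & _).
        apply open_interval_contains_0. lra.
      + intros mu Hmu. assert (Hmu1 : - mu0 < mu < mu0) by (pose proof (cond_pos mu0); lra).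
        destruct (Near mu (Near' mu Hmu1)) as ((N1 & N2 & _) & _).
        destruct (Lq mu Hmu1) as (A1 & A2 & A3 & _).
        (* [nu mu = q2 mu * mu] with [q2 mu > 0], so [nu] and [mu] have the same sign. *)
        rewrite HE. apply A3. rewrite <- Q2. rewrite <- (Rmult_0_r (q2 mu)). apply Rmult_le_compat_l; lra.
      + assert (Lim : forall X : R -> R, continuous X 0 -> X 0 = 0 -> filterlim X (at_right 0) (locally 0)).
        { intros X CX X0. unfold continuous in CX. rewrite X0 in CX.
          eapply filterlim_filter_le_1; [|exact CX]. apply filter_le_within. }
        exists XL, XR, yL, yR. split; [auto|]. split; [auto|]. split; [auto|]. split; [auto|].
        intros mu Hmu. assert (Hmu1 : - mu0 < mu < mu0) by (pose proof (cond_pos mu0); lra).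
        destruct (Near mu (Near' mu Hmu1)) as ((N1 & N2 & _) & _).
        assert (HsRn : Rabs (sR mu - aR) <= eR).
        { apply (box_near BoxR); [|lra]. apply XRf. lra. }
        apply Rabs_le_between in HsRn.
        destruct (Lq mu Hmu1) as (A1 & A2 & _ & A4).
        rewrite HE. destruct A4 as (A5 & A6 & A7 & A8); [rewrite <- Q2; apply Rmult_lt_0_compat; lra|].
        split; [exact A5|]. split; [exact A6|]. split.
        (* [sR mu] lies within [eR], at most half of the modulus of [aR], of [aR] and therefore has
           its sign. *)
        * intros HaR0. apply A7. rewrite Rabs_pos_eq in HeR1 by lra. lra.
        * intros HaR0. apply A8. rewrite Rabs_left in HeR1 by lra. lra.
    - intros mu Hmu. destruct (Lq mu Hmu) as (A1 & A2 & _).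
      assert (B1 : (1 - delta) * p < exp (- (3 * eta)) * p) by (apply Rmult_lt_compat_r; assumption).
      assert (B2 : exp (3 * eta) * p < (1 + delta) * p) by (apply Rmult_lt_compat_r; assumption).
      rewrite (Rabs_left (fst (qq mu))), (Rabs_pos_eq (snd (qq mu))) by lra. lra. }
  exists sL, sR, t. split; [|split; [|split]].
  - apply (eq_up_to_O_mu_of_derive _ _ dsL); assumption.
  - eapply eq_up_to_O_mu_of_derive; [exact DsR|exact sR0].
  - destruct (Main 1 Rlt_0_1) as (mu0 & p & qm & qp & C & _).
    exists mu0, (open_interval (- p) p), (fun mu => open_interval (qm mu) (qp mu)). exact C.
  - exact Main.
Qed.
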